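(* Let $\ell\ge 4$ be even and $r\ge 3$. If $H$ is a linear $r$-graph with maximum degree at most $\Delta$, then $$\mathrm{ex}(H,C_\ell^r)\ge \Delta^{-1+\frac1{\ell-1}-o(1)}\cdot e(H).$$ Moreover, there exists a linear $r$-graph $H$ with at least one edge and maximum degree at most $\Delta$ such that $$\mathrm{ex}(H,C_\ell^r)\le \Delta^{-1+\frac1{\ell-1}+o(1)}\cdot e(H).$$
   Context: An $r$-graph is an $r$-uniform hypergraph; it is linear if any two distinct edges share at most one vertex; $e(H)$ is the number of edges; the maximum degree is the maximum number of edges containing a given vertex. $\mathrm{ex}(H,F)$ is the maximum number of edges in a subgraph of $H$ containing no subgraph isomorphic to $F$. The loose cycle $C_\ell^r$ is the $r$-graph with $\ell$ edges $e_1,\dots,e_\ell$ such that $e_i\cap e_{i+1}=\{v_i\}$ for $1\le i\le\ell$ with all $v_i$ distinct and indices cyclic, and $e_i\cap e_j=\emptyset$ for any other pair of indices $i\neq j$. Asymptotics are as $\Delta\to\infty$ with $\ell,r$ fixed. The first bound means: for every $\varepsilon>0$ there is $\Delta_0$ such that for all $\Delta\ge\Delta_0$ and all linear $r$-graphs $H$ with maximum degree at most $\Delta$ the inequality holds with $o(1)$ replaced by $\varepsilon$. The second means: for every $\varepsilon>0$ there is $\Delta_0$ such that for all $\Delta\ge\Delta_0$ such an $H$ exists satisfying the inequality with $o(1)$ replaced by $\varepsilon$. *)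

(* Defs.v *)
From mathcomp Require Import all_boot.
From mathcomp Require Import zify.

Set Implicit Arguments.
Unset Strict Implicit.
Unset Printing Implicit Defensive.

(** A finite hypergraph on the vertex type [V] is given by its set of edges
    [H : {set {set V}}]; its number of edges is [#|H|], and its subgraphs are
    the subsets of [H].  (Isolated vertices play no role below, since every
    vertex of a loose cycle lies in an edge.) *)

Section Hypergraphs.
Variable V : finType.
Implicit Types (H G : {set {set V}}) (v : V).

Definition is_rgraph (r : nat) H : Prop := {in H, forall e : {set V}, #|e| = r}.

Definition is_linear H : Prop :=
  {in H &, forall e f : {set V}, e != f -> #|e :&: f| <= 1}.

Definition degree H v : nat := #|[set e in H | v \in e]|.

Definition max_degree H : nat := \max_(v : V) degree H v.

End Hypergraphs.

(** [H] has a subgraph isomorphic to [F]. *)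
Definition contains_copy (U V : finType)
    (F : {set {set U}}) (H : {set {set V}}) : bool :=
  [exists f : {ffun U -> V},
     injectiveb f && [forall e in F, (f @: e) \in H]].

(** The relative Turan number ex(H, F). *)
Definition turan (U V : finType)
    (H : {set {set V}}) (F : {set {set U}}) : nat :=
  \max_(G : {set {set V}} | (G \subset H) && ~~ contains_copy F G) #|G|.

(** A concrete model of the loose cycle on the vertex set Z/l x {0,..,r-2}:
    the i-th edge consists of the r-1 vertices (i, j) and of (i+1, 0), which
    is the vertex shared with the next edge.  [ordS] is the cyclic successor. *)
Definition loose_edge (l r : nat) (i : 'I_l) : {set 'I_l * 'I_r.-1} :=
  [set p : 'I_l * 'I_r.-1 |
     (p.1 == i) || ((p.1 == ordS i) && (p.2 == 0 :> nat))].

Definition loose_cycle (l r : nat) : {set {set 'I_l * 'I_r.-1}} :=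
  [set loose_edge r i | i : 'I_l].

(** The defining properties of a loose cycle with l edges of size r; the
    model [loose_cycle] has them by [loose_cycleP], and they determine it up to
    isomorphism and isolated vertices when l >= 3. *)
Definition is_loose_cycle (V : finType) (l r : nat) (C : {set {set V}}) :=
  exists (e : 'I_l -> {set V}) (v : 'I_l -> V),
    [/\ C = [set e i | i : 'I_l], injective e /\ (forall i, #|e i| = r),
        injective v,
        forall i, e i :&: e (ordS i) = [set v i]
      & forall i j, i != j -> j != ordS i -> i != ordS j ->
          e i :&: e j = set0].

Lemma ordS_neq (l : nat) (i : 'I_l) : 1 < l -> ordS i != i.
Proof.
move=> l1; apply/eqP => /(congr1 val) /=; case: i => i /= li.
case: (ltnP i.+1 l) => [lt|ge]; first by rewrite modn_small //; lia.
have -> : i.+1 = l by lia.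
by rewrite modnn; lia.
Qed.

Lemma ordSS_neq (l : nat) (i : 'I_l) : 2 < l -> ordS (ordS i) != i.
Proof.
move=> l2; apply/eqP => /(congr1 val) /=; case: i => i /= li.
case: (ltnP i.+1 l) => [lt|ge]; last first.
  have -> : i.+1 = l by lia.
  by rewrite modnn modn_small; lia.
rewrite (modn_small lt); case: (ltnP i.+2 l) => [lt2|ge2].
  by rewrite modn_small //; lia.
have -> : i.+2 = l by lia.
by rewrite modnn; lia.
Qed.

Lemma loose_cycleP (l r : nat) :
  2 < l -> 1 < r -> is_loose_cycle l r (loose_cycle l r).
Proof.
move=> l2 r1; have l1 : 1 < l by apply: ltnW.
have r0 : 0 < r.-1 by lia.
pose z : 'I_r.-1 := Ordinal r0.
have val0 (j : 'I_r.-1) : (j == 0 :> nat) = (j == z) by [].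
exists (@loose_edge l r), (fun i => (ordS i, z)); split=> //.
- split=> [i j E|i].
    have: (i, z) \in loose_edge r j by rewrite -E inE /= eqxx.
    have: (j, z) \in loose_edge r i by rewrite E inE /= eqxx.
    rewrite !inE /= !eqxx !andbT => /orP[/eqP //|/eqP ->] /orP[/eqP //|].
    by rewrite eq_sym (negbTE (ordSS_neq i l2)).
  have -> : loose_edge r i = (ordS i, z) |: setX [set i] setT.
    by apply/setP => -[a b]; rewrite !inE xpair_eqE val0 andbT orbC.
  rewrite cardsU1 cardsX cards1 cardsT card_ord !inE /= andbT.
  by rewrite (negbTE (ordS_neq i l1)); lia.
- by move=> i j [h]; apply: ordS_inj; apply: val_inj.
- move=> i; apply/setP => -[a b]; rewrite !inE xpair_eqE val0 /=.
  case: (eqVneq a i) => [->|_] /=.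
    by rewrite ![i == _]eq_sym (negbTE (ordS_neq i l1)) (negbTE (ordSS_neq i l2)).
  case: (eqVneq a (ordS i)) => [->|_] //=.
  by rewrite andbT.
- move=> i j ij jSi iSj; apply/setP => -[a b]; rewrite !inE /=.
  case: (eqVneq a i) => [->|_] /=.
    by rewrite (negbTE ij) (negbTE iSj).
  case: (eqVneq a (ordS i)) => [->|_] //=.
  rewrite ![ordS i == _]eq_sym (negbTE jSi) /=.
  by rewrite (inj_eq (@ordS_inj _)) [j == i]eq_sym (negbTE ij) andbF.
Qed.

(* Main.v *)
Require Import Defs.
From mathcomp Require Import all_boot all_order all_algebra.
From mathcomp Require Import ring lra zify.
From mathcomp Require Import reals sequences exp.

(** Lower bound: keep a random 1/s fraction of the edges, with s a constant
    times Delta^((l-2)/(l-1)), and delete one edge from every surviving loose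
    cycle.  There are only O(e(H) Delta^(l-2)) loose cycles, because in a linear
    hypergraph the edge closing a cycle is determined by two of its vertices.

    Upper bound: take a random function phi from [n] x [n] to [4n] and the
    triples (a, b, phi(a, b)) that share at most one coordinate with every other
    such triple; padding them with private vertices gives a linear r-graph with
    at least n^2/4 edges.  A family of triples without loose cycles is an
    independent set of the hypergraph of all l-cycles of triples, so it lies in
    one of few containers, each of size at most n^(2 + 1/(l-1) + o(1)), and by an
    exponential moment bound phi meets every container in n^(1 + 1/(l-1) + o(1))
    triples.

    The container theorem is driven by supersaturation in a dual form: every
    family G of nonempty sets that covers all l-cycles inside a large set K of
    triples has large cost, the sum of q^(|E|-1) over E in G.  For this, forget
    the coordinate whose complementary pair has the smallest codegree.  The
    triples become a bipartite multigraph, the number of closed walks of length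
    l is the trace of a power of its adjacency matrix, and log-convexity in the
    exponent bounds both the closed walks that repeat a vertex or a forgotten
    coordinate and those that run through a given set of edges. *)

Set Implicit Arguments.
Unset Strict Implicit.
Unset Printing Implicit Defensive.
Import Order.TTheory GRing.Theory Num.Theory.
Local Open Scope ring_scope.

(** * Containers from covers *)

(** No balanced family of cycles is ever built: the codegree conditions that containers need are
    replaced by the dual statement that no cheap family covers all cycles, and this is tested on
    each family by counting closed walks. The obstacle is that some edges of the multigraph may lie
    on far more closed walks than the average. Return weights are therefore evened out until their
    maximum [M] is the average up to a small factor. The equation [M = D * lam^(2k)] then defines a
    growth rate [lam] of walks. Forgetting the right coordinate matters because the square of the
    smallest codegree [D] is at most about each degree of the multigraph. All logarithms and
    constants are paid in powers of one integer [w]. With [s = w^h], [n = s^(l-1)] and [m0 = s^l]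
    the powers of [s] balance exactly: containers have at most about [s^(2l-1)] triples, while the
    logarithm of their number and their intersections with the random system are about [s^l]. As [w]
    is about [Delta^(1/E)] for a large fixed [E = h * (l-1)], a bounded power of [w] is
    [Delta^o(1)]. *)

Lemma leq_expl m n e : (m <= n)%N -> (m ^ e <= n ^ e)%N.
Proof. by case: e => [|e] mn; rewrite ?expn0 // leq_exp2r. Qed.

(* A container for uniformity s.+1 drops a fraction 2^-(container_depth s) of the
   robustness bound. *)
Fixpoint container_depth s : nat :=
  if s is s'.+1 then (s'.+1.+4.+1 + container_depth s')%N else 0%N.

Section Containers.
Variables (R : realFieldType) (V : finType).
Implicit Types (H L : {set {set V}}) (K I S : {set V}) (G : seq {set V}).
Implicit Types (q b : R).

(** The exponent makes a singleton cost 1 for every [q], so covering by deleted vertices costs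
    exactly their number. *)
Definition cost q G : R := \sum_(E <- G) q ^+ #|E|.-1.

Definition covers G H :=
  {in H, forall A : {set V}, exists2 E : {set V}, E \in G & E \subset A}.

(** Integral form of the linear programming dual of a measure on [H] in which each set [E] has
    codegree at most [q^(|E|-1)]; [b] stands for the total mass. *)
Definition robust q b H :=
  forall G, set0 \notin G -> covers G H -> b <= cost q G.

Definition indep H I := {in H, forall A : {set V}, ~~ (A \subset I)}.

Definition codeg L S : nat := #|[set A in L | S \subset A]|.

(* Largest codegree of S allowed in the s-uniform link hypergraph under construction. *)
Definition cap q s S : R := q^-1 ^+ (s - #|S|).

Definition saturated q s (c : R) L : {set {set V}} :=
  [set S | (S != set0) && (c * cap q s S <= (codeg L S)%:R)].

Lemma cost_cat q G1 G2 : cost q (G1 ++ G2) = cost q G1 + cost q G2.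
Proof. by rewrite /cost big_cat. Qed.

Lemma codeg_gt0 L S : (0 < codeg L S)%N -> exists2 A, A \in L & S \subset A.
Proof. by case/card_gt0P=> A; rewrite inE => /andP[? ?]; exists A. Qed.

Lemma codegE L S : codeg L S = (\sum_(A in L) (S \subset A : nat))%N.
Proof.
rewrite /codeg -sum1_card big_mkcond [RHS]big_mkcond /=.
by apply: eq_bigr => A _; rewrite inE; case: (A \in L); case: (S \subset A).
Qed.

Lemma sum_codeg s L : {in L, forall A : {set V}, #|A| = s} ->
  (\sum_(S : {set V}) codeg L S = #|L| * 2 ^ s)%N.
Proof.
move=> Ls; under eq_bigr do rewrite codegE.
rewrite exchange_big /= -sum_nat_const; apply: eq_bigr => A /Ls <-.
rewrite -card_powerset -sum1_card [RHS]big_mkcond /=.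
by apply: eq_bigr => S _; rewrite powersetE; case: (S \subset A).
Qed.

Lemma cap_gt0 q s S : 0 < q -> 0 < cap q s S.
Proof. by move=> q0; rewrite exprn_gt0 // invr_gt0. Qed.

Lemma cap_ge1 q s S : 0 < q -> q <= 1 -> 1 <= cap q s S.
Proof. by move=> q0 q1; apply: exprn_ege1; rewrite invf_ge1. Qed.

Lemma expr_cap q s S : 0 < q -> (#|S| <= s)%N ->
  q ^+ #|S| = q ^+ s * cap q s S.
Proof.
move=> q0 Ss; have -> : q ^+ s = q ^+ #|S| * q ^+ (s - #|S|).
  by rewrite -exprD subnKC.
by rewrite /cap exprVn mulfK // expf_neq0 // gt_eqF.
Qed.

(** Saturation converts weight into codegree, because [q^|S| = q^s * cap q s S], and the codegrees
    of all [S] add up to [2^s * #|L|]. *)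
Lemma saturated_sum q s c L : 0 < q -> 0 < c ->
  {in L, forall A : {set V}, #|A| = s} ->
  \sum_(S in saturated q s c L) q ^+ #|S| <= q ^+ s * (2 ^+ s * #|L|%:R / c).
Proof.
move=> q0 c0 Ls.
have le1 S : S \in saturated q s c L ->
    q ^+ #|S| <= q ^+ s * ((codeg L S)%:R / c).
  rewrite inE => /andP[_ Sc].
  have d0 : (0 < codeg L S)%N.
    by rewrite -(ltr_nat R) (lt_le_trans _ Sc) // mulr_gt0 // cap_gt0.
  have [A AL SA] := codeg_gt0 d0.
  have Ss : (#|S| <= s)%N by rewrite -(Ls A AL) subset_leq_card.
  rewrite (expr_cap q0 Ss) ler_pM2l ?exprn_gt0 // ler_pdivlMr // mulrC //.
apply: (le_trans (ler_sum _ le1)).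
rewrite -mulr_sumr ler_pM2l ?exprn_gt0 // -mulr_suml ler_pM2r ?invr_gt0 //.
rewrite -natrX -natrM mulnC -(sum_codeg Ls) natr_sum.
rewrite big_mkcond /=; apply: ler_sum => S _; case: ifP => // _.

Qed.

(** A member [E] of a cover pays [q^(|E|-1)] and takes care of at most [2 * cap] edges, hence of at
    most [2 / q^s] edges per unit of cost. *)
Lemma robust_of_codeg q s L : 0 < q ->
  {in L, forall A : {set V}, #|A| = s.+1} ->
  (forall S, S != set0 -> (codeg L S)%:R <= 2 * cap q s.+1 S) ->
  robust q (#|L|%:R * q ^+ s / 2) L.
Proof.
move=> q0 Ls Ld G G0 cov; rewrite ler_pdivrMr //.
have qs0 : 0 < q ^+ s by rewrite exprn_gt0.
have LG : #|L|%:R <= \sum_(E <- G) (codeg L E)%:R :> R.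
  rewrite -natr_sum ler_nat; under eq_bigr do rewrite codegE.
  rewrite exchange_big /= -sum1_card; apply: leq_sum => A AL.
  have [E EG EA] := cov A AL.
  by rewrite (perm_big _ (perm_to_rem EG)) big_cons EA.
apply: (le_trans (ler_wpM2r (ltW qs0) LG)).
rewrite mulr_suml /cost mulr_suml big_seq [leRHS]big_seq.
apply: ler_sum => E EG.
have E0 : E != set0 by apply: contraNneq G0 => <-.
case: (leqP (codeg L E) 0) => [|d0].
  by rewrite leqn0 => /eqP ->; rewrite mul0r mulr_ge0 // exprn_ge0 // ltW.
have [A AL EA] := codeg_gt0 d0.
have Es : (#|E| <= s.+1)%N by rewrite -(Ls A AL) subset_leq_card.
have -> : q ^+ #|E|.-1 * 2 = 2 * cap q s.+1 E * q ^+ s.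
  have qn : q != 0 by rewrite gt_eqF.
  apply: (mulfI qn).
  rewrite mulrA -exprS prednK ?card_gt0 // (expr_cap q0 Es) exprS; ring.
by rewrite ler_pM2r //; apply: Ld.
Qed.

Lemma codegU L1 L2 S : (codeg (L1 :|: L2) S <= codeg L1 S + codeg L2 S)%N.
Proof.
rewrite /codeg; apply: leq_trans (leq_card_setU _ _).
by apply: subset_leq_card; apply/subsetP => A; rewrite !inE andb_orl.
Qed.

(* By maximality, an edge of F that cannot be added to M contains a set whose
   codegree is at least half its cap. *)
Lemma max_capped q s (F : {set {set V}}) : 0 < q -> q <= 1 ->
  {in F, forall A : {set V}, #|A| = s.+1} ->
  exists M : {set {set V}}, [/\ M \subset F,
    forall S, S != set0 -> (codeg M S)%:R <= cap q s.+1 S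
    & covers (enum (saturated q s.+1 (1/2) M)) F].
Proof.
move=> q0 q1 Fs.
pose P (M : {set {set V}}) := (M \subset F) &&
  [forall S : {set V}, (S != set0) ==> ((codeg M S)%:R <= cap q s.+1 S)].
have P0 : P set0.
  rewrite /P sub0set; apply/forallP => S; apply/implyP => _.
  rewrite (_ : codeg set0 S = 0%N) ?ltW ?cap_gt0 //.
  by rewrite codegE big_set0.
case: (arg_maxnP (fun M : {set {set V}} => #|M|) P0) => M /andP[MF /forallP Mcap] Mmax.
exists M; split=> // [S S0|A AF]; first by apply: (implyP (Mcap S)).
have A0 : A != set0 by rewrite -card_gt0 Fs.
case: (boolP (A \in M)) => AM.
  exists A => //; rewrite mem_enum inE A0 /=.
  rewrite /cap (Fs _ AF) subnn expr0 mulr1.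
  have : (1 <= codeg M A)%N by apply/card_gt0P; exists A; rewrite inE AM subxx.
  by rewrite -(ler_nat R); lra.
have : ~~ P (A |: M).
  by apply/negP => /Mmax; rewrite /geq /= cardsU1 AM add1n ltnn.
rewrite /P subUset sub1set AF MF /= negb_forall => /existsP[S].
rewrite negb_imply -ltNge => /andP[S0 capS].
have dU : (codeg (A |: M) S <= (S \subset A) + codeg M S)%N.
  apply: leq_trans (codegU _ _ _) _; rewrite leq_add2r.
  by rewrite codegE big_set1.
case: (boolP (S \subset A)) dU => SA dU; last first.
  have := implyP (Mcap S) S0; rewrite leNgt (lt_le_trans capS) //.
  by rewrite ler_nat.
exists S => //; rewrite mem_enum inE S0 /=.
have c1 := cap_ge1 s.+1 S q0 q1.
move: dU; rewrite -(ler_nat R) natrD /= => dU.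
case: (posnP (codeg M S)) => [d0|]; first by rewrite d0 in dU; lra.
rewrite -(ler_nat R) => d1; lra.
Qed.

(* Induction on the uniformity.  The algorithm scans K for a vertex v whose link
   contains a capped family M of at least g sets compatible with L.  If v is in I
   then M joins the list L of sets forbidden in I, and this happens at most tau
   times before L itself is robust; otherwise v leaves K.  If no such v exists,
   the sets saturated by the links form a cheap cover, unless many vertices have
   already been deleted. *)
Lemma container_step s :
  forall q b K H (tau : nat), 0 < q -> q <= 1 -> 0 < b ->
  {in H, forall A : {set V}, #|A| = s.+1 /\ A \subset K} -> robust q b H ->
  2 * q * #|K|%:R <= tau%:R ->
  exists C : {set {set V}},
  [/\ (#|C| <= #|V|.+1 ^ (s * tau.+1))%N,
      {in C, forall D : {set V}, D \subset K /\
         #|D|%:R <= #|K|%:R - b / 2 ^+ container_depth s}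
    & forall I, I \subset K -> indep H I -> exists2 D, D \in C & I \subset D].
Proof.
elim: s => [|s IHs].
  move=> q b K H tau q0 q1 b0 Hs Hrob _.
  pose D := [set v in K | [set v] \notin H].
  exists [set D]; split.
  - by rewrite cards1.
  - move=> _ /set1P ->; split; first by apply/subsetP => v; rewrite inE => /andP[].
    have : b <= cost q (enum H).
      apply: Hrob.
        by rewrite mem_enum; apply/negP => /Hs[]; rewrite cards0.
      by move=> A AH; exists A; rewrite ?mem_enum.
    rewrite /cost big_enum /=.
    have -> : \sum_(E in H) q ^+ #|E|.-1 = #|H|%:R.
      by rewrite -sum1_card natr_sum; apply: eq_bigr => E /Hs[->].
    have KD : (#|D| + #|H| <= #|K|)%N.
      have H1 : H \subset [set [set v] | v in K :\: D].
        apply/subsetP => A AH; have [/eqP/cards1P[v Av] AK] := Hs A AH.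
        apply/imsetP; exists v => //; rewrite !inE -Av AH /= andbF /=.
        by apply: (subsetP AK); rewrite Av set11.
      have DK : D \subset K by apply/subsetP => v; rewrite inE => /andP[].
      have := leq_trans (subset_leq_card H1) (leq_imset_card _ _).
      rewrite cardsD (setIidPr DK) => H2.
      by have := subset_leq_card DK; lia.
    move: KD; rewrite -(ler_nat R) natrD expr0; lra.
  - move=> I IK HI; exists D; first exact: set11.
    apply/subsetP => v vI; rewrite inE (subsetP IK) //=.
    by apply/negP => /HI; rewrite sub1set vI.
have [t tE] : exists t, t = s.+1 by exists s.+1.
have [e eE] : exists e, e = container_depth s by exists (container_depth s).
rewrite -eE in IHs; have -> : container_depth s.+1 = (t.+4.+1 + e)%N by rewrite tE eE.
move=> q b K H tau q0 q1 b0 Hs Hrob Htau.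
have p2 n : 0 < 2 ^+ n :> R by rewrite exprn_gt0.
have qs0 n : 0 < q ^+ n by rewrite exprn_gt0.
have K0 : 0 < #|K|%:R :> R.
  rewrite ltr0n lt0n; apply/eqP => K0.
  have : b <= cost q [::].
    apply: Hrob => // A AH; have [A1] := Hs A AH.
    by move/subset_leq_card; rewrite A1 K0.
  by rewrite /cost big_nil leNgt b0.
(* The constants are tuned so that [L0 = 2 * q * #|K| * g], which makes [tau] additions of [g] sets
   reach [L0], and so that a list of size [L0] is robust at level [2 * b']. Fewer than [d] deleted
   vertices, with [d] half of [b'], still leave it robust at level [b']. *)
pose L0 : R := b / (4 * 2 ^+ t) / q ^+ s.
pose g : R := b / (2 ^+ t.+3 * #|K|%:R * q ^+ t).
pose d : R := b / 2 ^+ t.+4.+1.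
pose b' : R := b / 2 ^+ t.+4.
pose F : nat := (#|V|.+1 ^ (s * tau.+1))%N.
have b'0 : 0 < b' by rewrite divr_gt0.
have db' : b' = 2 * d.
  rewrite /b' /d [2 ^+ t.+4.+1]exprS.
  by field; rewrite gt_eqF ?p2.
have dE : b / 2 ^+ (t.+4.+1 + e) <= d.
  rewrite /d exprD invfM mulrA ler_pdivrMr ?p2 // ler_peMr //.
    by rewrite divr_ge0 ?(ltW b0) ?(ltW (p2 _)).
  by rewrite exprn_ege1 // ler1n.
have b'E : b / 2 ^+ (t.+4.+1 + e) <= b' / 2 ^+ e.
  rewrite exprD invfM mulrA ler_pM2r ?invr_gt0 // -/d db'.
  have : 0 < d by rewrite divr_gt0.
  lra.
have L0E : L0 * q ^+ s / 2 = 2 * b'.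
  rewrite /L0 /b' !exprS; field.
  by rewrite (gt_eqF (qs0 _)) (gt_eqF (p2 _)).
have L0g : L0 <= tau%:R * g.
  have -> : L0 = (2 * q * #|K|%:R) * g.
    rewrite /L0 /g tE !exprS; field.
    by rewrite (gt_eqF K0) (gt_eqF q0) (gt_eqF (qs0 _)) (gt_eqF (p2 _)).
  rewrite ler_wpM2r // divr_ge0 ?(ltW b0) // ltW //.
  exact: mulr_gt0 (mulr_gt0 (p2 _) K0) (qs0 _).
(* The factor 2 survives an addition: a set whose codegree grows was unsaturated, hence below its
   cap, and the new family adds at most one more cap. *)
pose inv L := {in L, forall A : {set V}, #|A| = t /\ A \subset K} /\
  forall S, S != set0 -> (codeg L S)%:R <= 2 * cap q t S.
(* Here [r] bounds the additions still to come and [a] the vertices left. Each choice of a vertex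
   lowers one of them, and the count closes by [a^(r+1) + (a+1)^r <= (a+1)^(r+1)]. *)
suff main m r a K' L : (r + a < m)%N -> (#|K'| <= a)%N -> K' \subset K ->
    inv L -> L0 - #|L|%:R <= r%:R * g ->
    exists C : {set {set V}}, [/\ (#|C| <= a.+1 ^ r * F)%N,
      {in C, forall D : {set V}, D \subset K' /\
         #|D|%:R <= #|K|%:R - b / 2 ^+ (t.+4.+1 + e)}
    & forall I, I \subset K' -> indep H I -> indep L I ->
        exists2 D, D \in C & I \subset D].
  have [||||C [C1 C2 C3]] := main (tau + #|K|).+1%N tau #|K| K set0 _ (leqnn _).
  - by rewrite ltnS.
  - exact: subxx.
  - split=> [A|S S0]; first by rewrite inE.
    by rewrite codegE big_set0 mulr_ge0 // ltW // cap_gt0.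
  - by rewrite cards0 subr0.
  exists C; split=> // [|I IK HI]; last by apply: C3 => // A; rewrite inE.
  apply: (leq_trans C1); rewrite mulSn expnD leq_mul //.
  apply: leq_trans (_ : #|V|.+1 ^ tau <= _)%N; last by rewrite leq_pexp2l.
  by rewrite leq_expl // ltnS max_card.
elim: m => [|m IHm] // in r a K' L *.
rewrite ltnS => ra K'a K'K [Ls Lcap] Lg.
have F0 : (0 < F)%N by rewrite expn_gt0.
(* Once [d] vertices have been deleted, [K'] itself is small enough to be a container. *)
have [K'd|K'd] := lerP d (#|K|%:R - #|K'|%:R).
  exists [set K']; split.
  - by rewrite cards1 muln_gt0 F0 expn_gt0.
  - by move=> _ /set1P ->; split=> //; move: K'd dE; clear; lra.
  - by move=> I IK' _ _; exists K'; rewrite ?set11.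
have [L0L|LL0] := lerP L0 #|L|%:R.
  pose L' := [set A in L | A \subset K'].
  have [|||C [C1 C2 C3]] := IHs q b' K' L' tau q0 q1 b'0.
  - by move=> A; rewrite inE => /andP[/Ls[-> _] ->].
  - move=> G G0 GL'.
    (* A cover of the part of [L] inside [K'] becomes a cover of [L] when the deleted vertices join
       it, at a cost below [d]. *)
    pose G' := G ++ [seq [set x] | x <- enum (K :\: K')].
    have : L0 * q ^+ s / 2 <= cost q G'.
      apply: le_trans (_ : #|L|%:R * q ^+ s / 2 <= _).
        by rewrite ler_pM2r ?invr_gt0 // ler_pM2r.
      have Ls' : {in L, forall A : {set V}, #|A| = s.+1} by rewrite -tE => A /Ls[].
      have Lcap' S : S != set0 -> (codeg L S)%:R <= 2 * cap q s.+1 S.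
        by rewrite -tE; exact: Lcap.
      apply: (robust_of_codeg q0 Ls' Lcap') => [|A AL].
        rewrite mem_cat negb_or G0 /=; apply/mapP => -[x _ /setP/(_ x)].
        by rewrite !inE eqxx.
      have [_ AK] := Ls A AL.
      case: (boolP (A \subset K')) => [AK'|/subsetPn[x xA xK']].
        have [|E EG EA] := GL' A; first by rewrite inE AL.
        by exists E => //; rewrite mem_cat EG.
      exists [set x]; rewrite ?sub1set // mem_cat map_f ?orbT //.
      by rewrite mem_enum inE xK' (subsetP AK).
    rewrite cost_cat {2}/cost big_map big_enum /=.
    have -> : \sum_(x in K :\: K') q ^+ #|[set x]|.-1 = #|K|%:R - #|K'|%:R :> R.
      under eq_bigr do rewrite cards1 expr0.
      rewrite sumr_const cardsD (setIidPr K'K) natrB //.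
      exact: subset_leq_card.
    rewrite L0E; move: K'd b'0; rewrite db'; clear; lra.
  - apply: le_trans Htau; rewrite ler_pM2l ?mulr_gt0 // ler_nat.
    exact: subset_leq_card.
  exists C; split.
  - by apply: (leq_trans C1); rewrite leq_pmull // expn_gt0.
  - move=> D /C2[DK' DC]; split=> //; apply: le_trans DC _.
    have : #|K'|%:R <= #|K|%:R :> R by rewrite ler_nat subset_leq_card.
    move: b'E; clear; lra.
  - move=> I IK' _ LI; apply: C3 => // A; rewrite inE => /andP[AL _].
    exact: LI.
case: r => [|r] in ra Lg *.
  by move: Lg LL0; rewrite mul0r; clear; lra.
(* Sets saturated by [L] are kept out of the link, so that adding a capped part of it cannot break
   the codegree bound on [L]. *)
pose link v : {set {set V}} := [set A : {set V} |
  [&& v \notin A, v |: A \in H, v |: A \subset K' &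
      [forall S in saturated q t 1 L, ~~ (S \subset v |: A)]]].
have links v : {in link v, forall A : {set V}, #|A| = t}.
  move=> A; rewrite inE => /and4P[vA /Hs[vAt _] _ _].
  by move: vAt; rewrite cardsU1 vA tE add1n => -[].
have links' v : {in link v, forall A : {set V}, #|A| = s.+1}.
  by rewrite -tE; exact: links.
have /fin_all_exists [M HM] v := max_capped q0 q1 (links' v).
have [v vK' gM] : exists2 v, v \in K' & g <= #|M v|%:R.
  apply/exists_inP; apply: contraT; rewrite negb_exists => /forallP noM.
  have gM v : v \in K' -> #|M v|%:R < g.
    by move=> vK'; move: (noM v); rewrite vK' /= -ltNge.
  (* If every link were poor, deleted vertices, sets saturated by [L] and sets saturated by the
     links would together cover [H] at cost at most [b/8 + b/4 + b/4], less than [b]. *)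
  pose G1 := [seq [set x] | x <- enum (K :\: K')].
  pose G2 := enum (saturated q t 1 L).
  pose G3 := flatten [seq [seq v |: T | T <- enum (saturated q t (1/2) (M v))]
                      | v <- enum K'].
  have : b <= cost q (G1 ++ (G2 ++ G3)).
    apply: Hrob => [|A AH].
      rewrite !mem_cat !negb_or; apply/and3P; split.
      - apply/mapP => -[x _ /setP/(_ x)].
        by rewrite !inE eqxx.
      - by rewrite mem_enum inE eqxx.
      - apply/flatten_mapP => -[v _ /mapP[S _ /setP/(_ v)]].
        by rewrite !inE eqxx.
    have [At AK] := Hs A AH.
    case: (boolP (A \subset K')) => [AK'|/subsetPn[x xA xK']]; last first.
      exists [set x]; rewrite ?sub1set // mem_cat map_f //.
      by rewrite mem_enum inE xK' (subsetP AK).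
    case: (boolP [forall S in saturated q t 1 L, ~~ (S \subset A)]); last first.
      rewrite negb_forall => /existsP[S]; rewrite negb_imply negbK => /andP[SL SA].
      by exists S => //; rewrite !mem_cat mem_enum SL orbT.
    move=> satA; have /card_gt0P[v vA] : (0 < #|A|)%N by rewrite At.
    have [MF _ Mcov] := HM v.
    have vAA : v |: A :\ v = A by rewrite setD1K.
    have [|E] := Mcov (A :\ v).
      by rewrite inE vAA AH AK' satA !inE eqxx.
    rewrite mem_enum => EM EA.
    exists (v |: E).
      rewrite !mem_cat; apply/orP; right; apply/orP; right.
      apply/flatten_mapP; exists v; first by rewrite mem_enum (subsetP AK').
      by apply: map_f; rewrite mem_enum tE.
    by rewrite -vAA setUS.
  rewrite !cost_cat.
  have -> : cost q G1 = #|K|%:R - #|K'|%:R.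
    rewrite /cost big_map big_enum /=.
    under eq_bigr do rewrite cards1 expr0.
    rewrite sumr_const cardsD (setIidPr K'K) natrB //.
    exact: subset_leq_card.
  have c2 : cost q G2 <= b / 4.
    have : q * cost q G2 <= q ^+ t * (2 ^+ t * #|L|%:R / 1).
      apply: le_trans (saturated_sum (c := 1) q0 _ _) => [||A /Ls[]//] //.
      rewrite /cost big_enum mulr_sumr le_eqVlt; apply/orP; left; apply/eqP.
      apply: eq_bigr => S; rewrite inE -card_gt0 => /andP[S0 _].
      by rewrite -exprS prednK.
    rewrite {1}tE exprS -mulrA ler_pM2l // divr1 => c2.
    apply: (le_trans c2).
    have -> : b / 4 = q ^+ s * (2 ^+ t * L0).
      rewrite /L0; field.
      by rewrite (gt_eqF (qs0 _)) (gt_eqF (p2 _)).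
    by rewrite ler_pM2l // ler_pM2l // ltW.
  have c3 : cost q G3 <= b / 4.
    rewrite /cost big_flatten big_map big_enum /=.
    have -> : b / 4 = \sum_(v in K) (q ^+ t * (2 ^+ t * g / (1/2))).
      rewrite sumr_const -mulr_natr /g !exprS; field.
      by rewrite (gt_eqF K0) (gt_eqF (qs0 _)) (gt_eqF (p2 _)).
    rewrite [leRHS](big_setID K') /= (setIidPr K'K) -[leLHS]addr0.
    have g0 : 0 <= g.
      rewrite divr_ge0 ?(ltW b0) // ltW //.
      exact: mulr_gt0 (mulr_gt0 (p2 _) K0) (qs0 _).
    apply: lerD; last first.
      apply: sumr_ge0 => v _; rewrite mulr_ge0 ?(ltW (qs0 _)) //.
      by rewrite divr_ge0 ?(mulr_ge0 (ltW (p2 _))) //; clear; lra.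
    apply: ler_sum => v vK'; rewrite big_map big_enum /=.
    have [MF _ _] := HM v.
    apply: le_trans (_ : q ^+ t * (2 ^+ t * #|M v|%:R / (1/2)) <= _).
      apply: le_trans (saturated_sum (c := 1/2) q0 _ _); last 2 first.
      - by clear; lra.
      - by move=> A /(subsetP MF)/links.
      apply: ler_sum => S; rewrite inE => /andP[_ capS].
      have /codeg_gt0[A AM SA] : (0 < codeg (M v) S)%N.
        rewrite -(ltr_nat R); apply: lt_le_trans capS; apply: mulr_gt0; first by clear; lra.
        exact: cap_gt0.
      have := subsetP MF _ AM; rewrite inE => /andP[vA _].
      by rewrite cardsU1 (contraNN (subsetP SA v) vA).
    apply: ler_wpM2l; first exact: ltW.
    apply: ler_wpM2r; first by rewrite invr_ge0; clear; lra.
    by apply: ler_wpM2l; apply: ltW => //; exact: gM.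
  have dd : d <= b / 8.
    have p1 : 1 <= 2 ^+ t :> R by rewrite exprn_ege1 // ler1n.
    rewrite /d ler_pdivrMr ?p2 // !exprS.
    by move: b0 (ler_wpM2l (ltW b0) p1); clear; lra.
  by move: c2 c3 dd K'd b0; clear; lra.
have [MF Mcap _] := HM v.
(* The cap of a set of full size is 1, so members of [L] are themselves saturated and never lie in a
   link; the sizes of [L] and [M v] therefore add. *)
have ML : L :&: M v = set0.
  apply/eqP; rewrite -subset0; apply/subsetP => A; rewrite inE => /andP[AL AM].
  have := subsetP MF _ AM; rewrite inE => /and4P[_ _ _ /forall_inP/(_ A)].
  have At := links _ _ (subsetP MF _ AM).
  have AS : A \in saturated q t 1 L.
    rewrite inE -card_gt0 At {1}tE /= /cap At subnn expr0 mulr1 ler1n.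
    by apply/card_gt0P; exists A; rewrite inE AL subxx.
  by move/(_ AS); rewrite subsetUr.
have a0 : (0 < a)%N by apply: leq_trans K'a; apply/card_gt0P; exists v.
have [|||||C1 [C11 C12 C13]] := IHm r.+1 a.-1 (K' :\ v) L.
- by clear -ra a0; lia.
- by rewrite (cardsD1 v K') vK' in K'a; clear -a0 K'a; lia.
- exact: subset_trans (subD1set _ _) K'K.
- by [].
- by [].
have [|||||C2 [C21 C22 C23]] := IHm r a K' (L :|: M v).
- by clear -ra; lia.
- by [].
- by [].
- split=> [A|S S0].
    rewrite inE => /orP[/Ls //|AM]; split; first exact: links (subsetP MF _ AM).
    have := subsetP MF _ AM; rewrite inE => /and4P[_ _ vAK' _].
    exact: subset_trans (subset_trans (subsetUr _ _) vAK') K'K.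
  have [M0|/codeg_gt0[A AM SA]] := posnP (codeg (M v) S).
    apply: le_trans (Lcap S S0); rewrite ler_nat.
    by apply: leq_trans (codegU _ _ _) _; rewrite M0 addn0.
  have SL : (codeg L S)%:R < cap q t S.
    have := subsetP MF _ AM; rewrite inE => /and4P[_ _ _ /forall_inP/(_ S)].
    rewrite inE S0 mul1r ltNge /= => satS; apply/negP => /satS.
    by rewrite (subset_trans SA) // subsetUr.
  have : (codeg (L :|: M v) S)%:R <= (codeg L S)%:R + (codeg (M v) S)%:R :> R.
    by rewrite -natrD ler_nat codegU.
  by move: (Mcap S S0) SL; rewrite -tE; clear; lra.
- rewrite cardsU ML cards0 subn0 natrD; move: Lg gM; rewrite -natr1; clear; lra.
exists (C1 :|: C2); split.
- apply: leq_trans (leq_card_setU _ _) _.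
  apply: leq_trans (leq_add C11 C21) _.
  rewrite -mulnDl leq_mul2r; apply/orP; right.
  rewrite prednK // [(a.+1 ^ r.+1)%N]expnS mulSn addnC leq_add2l expnS.
  by rewrite leq_mul2l leq_expl ?leqnSn ?orbT.
- move=> D; rewrite inE => /orP[/C12[DK ?]|/C22//]; split=> //.
  exact: subset_trans DK (subD1set _ _).
- move=> I IK' HI LI; case: (boolP (v \in I)) => vI.
    have [|D DC ID] := C23 I IK' HI.
      move=> A; rewrite inE => /orP[/LI//|AM].
      have := subsetP MF _ AM; rewrite inE => /and4P[_ vAH _ _].
      by have := HI _ vAH; rewrite subUset sub1set vI.
    by exists D; rewrite // inE DC orbT.
  have [|D DC ID] := C13 I _ HI LI.
    by rewrite subsetD1 IK' vI.
  by exists D; rewrite // inE DC.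
Qed.
End Containers.

(** * Iterating the container step down to small containers *)

Lemma bernoulli_inv (R : realFieldType) (x : R) n : 0 <= x <= 1 ->
  (1 - x) ^+ n * (1 + n%:R * x) <= 1.
Proof.
move=> /andP[x0 x1]; elim: n => [|n IHn]; first by rewrite expr0; lra.
apply: le_trans IHn; rewrite exprSr -mulrA.
apply: ler_wpM2l; first by rewrite exprn_ge0 // subr_ge0.
rewrite -natr1; have n0 : 0 <= n%:R :> R by apply: ler0n.
have := mulr_ge0 (mulr_ge0 n0 x0) x0; have := mulr_ge0 x0 x0; clear; nra.
Qed.

Lemma card_bigcup_le (T : finType) (V : finType) (C : {set T})
    (F : T -> {set V}) (N : nat) :
  (forall x, x \in C -> #|F x| <= N)%N -> (#|\bigcup_(x in C) F x| <= #|C| * N)%N.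
Proof.
move=> FN; apply: leq_trans (_ : \sum_(x in C) #|F x| <= _)%N.
  apply: (big_ind2 (fun (A : {set V}) n => #|A| <= n)%N) => //.
    by rewrite cards0.
  move=> A n B m An Bm; apply: leq_trans (leq_card_setU _ _) _.
  exact: leq_add.
by rewrite -sum_nat_const; apply: leq_sum.
Qed.

Section Iteration.
Variables (R : realFieldType) (V : finType).

(** With [q = m0 / |K|] and [b = |K| / B] the number [2 * m0] of additions does not depend on the
    size of [K], and a round removes the fixed fraction [x] from every set not yet below [kap].
    Sizes halve every [1 / x] rounds, so after [w] halvings a set still above [kap] would have less
    than one element. *)
Lemma small_containers s (H : {set {set V}}) (m0 B kap w : nat) :
  (0 < m0)%N -> (0 < B)%N -> (m0 <= kap)%N -> (#|V| < 2 ^ w)%N ->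
  {in H, forall A : {set V}, #|A| = s.+1} ->
  (forall K : {set V}, (kap <= #|K|)%N ->
     robust (m0%:R / #|K|%:R) (#|K|%:R / B%:R : R) [set A in H | A \subset K]) ->
  exists C : {set {set V}},
  [/\ (#|C| <= #|V|.+1 ^ (s * (2 * m0).+1 * (B * 2 ^ container_depth s * w)))%N,
      {in C, forall D : {set V}, (#|D| < kap)%N}
    & forall I : {set V}, indep H I -> exists2 D, D \in C & I \subset D].
Proof.
move=> m00 B0 mk Vw Hs Hr; have [e eE] : exists e, e = container_depth s by exists (container_depth s).
have He := @container_step R V s; rewrite -eE in He *.
pose x : R := (B * 2 ^ e)%:R^-1.
have x0 : 0 < x by rewrite invr_gt0 ltr0n muln_gt0 B0 expn_gt0.
have x1 : x <= 1.
  by rewrite invf_le1 ?ltr0n ?ler1n ?muln_gt0 ?B0 ?expn_gt0.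
pose Q := (#|V|.+1 ^ (s * (2 * m0).+1))%N.
have Q0 : (0 < Q)%N by rewrite expn_gt0.
pose P (D : {set V}) (F : {set {set V}}) := [/\ (#|F| <= Q)%N,
  {in F, forall E : {set V}, (#|E| < kap)%N \/ #|E|%:R <= (1 - x) * #|D|%:R}
  & forall I : {set V}, I \subset D -> indep H I -> exists2 E, E \in F & I \subset E].
have exF D : exists F, P D F.
  have [Dk|kD] := ltnP #|D| kap.
    exists [set D]; split; first by rewrite cards1.
      by move=> E /set1P ->; left.
    by move=> I ID _; exists D; rewrite ?set11.
  have D0 : 0 < #|D|%:R :> R by rewrite ltr0n (leq_trans m00) // (leq_trans mk).
  have [||||||F [F1 F2 F3]] := He (m0%:R / #|D|%:R) (#|D|%:R / B%:R) D
     [set A in H | A \subset D] (2 * m0)%N.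
  - by rewrite divr_gt0 // ltr0n.
  - by rewrite ler_pdivrMr // mul1r ler_nat (leq_trans mk).
  - by rewrite divr_gt0 // ltr0n.
  - by move=> A; rewrite inE => /andP[/Hs -> ->].
  - exact: Hr.
  - by rewrite mulrA divfK ?gt_eqF // natrM.
  exists F; split=> // [E /F2[_ EK]|I ID HI]; last first.
    by apply: F3 => // A; rewrite inE => /andP[/HI].
  right; apply: le_trans EK _; rewrite mulrBl mul1r lerD2l lerN2.
  by rewrite /x natrM natrX -mulrA -invfM mulrC.
have /fin_all_exists [F HF] := exF.
have iter i : exists C : {set {set V}}, [/\ (#|C| <= Q ^ i)%N,
    {in C, forall E : {set V}, (#|E| < kap)%N \/ #|E|%:R <= (1 - x) ^+ i * #|V|%:R}
    & forall I : {set V}, indep H I -> exists2 E, E \in C & I \subset E].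
  elim: i => [|i [C [C1 C2 C3]]].
    exists [set setT]; split; first by rewrite cards1.
      by move=> E /set1P ->; right; rewrite expr0 mul1r cardsT.
    by move=> I _; exists setT; rewrite ?set11.
  exists (\bigcup_(D in C) F D); split.
  - apply: leq_trans (_ : #|C| * Q <= _)%N; last by rewrite expnSr leq_mul2r C1 orbT.
    by apply: card_bigcup_le => D _; have [] := HF D.
  - move=> E /bigcupP[D DC EF]; have [_ F2 _] := HF D.
    case: (F2 _ EF) => [|ED]; first by left.
    case: (C2 _ DC) => [Dk|DV].
      left; rewrite (leq_ltn_trans _ Dk) // -(ler_nat R) (le_trans ED) //.
      have := ler0n R #|D|; move: x0 x1; clear; nra.
    right; apply: le_trans ED _; rewrite exprS -mulrA.
    by apply: ler_wpM2l => //; rewrite subr_ge0.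
  - move=> I HI; have [D DC ID] := C3 I HI; have [_ _ F3] := HF D.
    by have [E EF IE] := F3 I ID HI; exists E => //; apply/bigcupP; exists D.
have [C [C1 C2 C3]] := iter (B * 2 ^ e * w)%N; exists C; split=> //.
  by apply: (leq_trans C1); rewrite /Q -expnM.
move=> E /C2[//|EV]; apply: leq_trans (leq_trans m00 mk).
rewrite -(ltr_nat R); apply: le_lt_trans EV _.
have half : (1 - x) ^+ (B * 2 ^ e) <= 1 / 2.
  have /(bernoulli_inv (B * 2 ^ e)) : 0 <= x <= 1 by rewrite ltW.
  rewrite {2}/x mulfV; last by rewrite pnatr_eq0 -lt0n muln_gt0 B0 expn_gt0.
  by clear; lra.
rewrite exprM; apply: le_lt_trans (_ : (1 / 2) ^+ w * #|V|%:R < _).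
  apply: ler_wpM2r => //; apply: lerXn2r => //; rewrite ?nnegrE.
    by rewrite exprn_ge0 // subr_ge0.
  by clear; lra.
by rewrite div1r exprVn mulrC ltr_pdivrMr ?exprn_gt0 // mul1r -natrX ltr_nat.
Qed.

End Iteration.

(** * Closed walks in a weighted multigraph *)

Lemma cauchy_schwarz (R : realFieldType) (I : finType) (a b : I -> R) :
  (\sum_i a i * b i) ^+ 2 <= (\sum_i a i ^+ 2) * (\sum_i b i ^+ 2).
Proof.
have : 0 <= \sum_i \sum_j (a i * b j - a j * b i) ^+ 2.
  by apply: sumr_ge0 => i _; apply: sumr_ge0 => j _; apply: sqr_ge0.
have -> : \sum_i \sum_j (a i * b j - a j * b i) ^+ 2 =
   2 * ((\sum_i a i ^+ 2) * (\sum_i b i ^+ 2)) - 2 * (\sum_i a i * b i) ^+ 2.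
  set SA := \sum_i a i ^+ 2; set SB := \sum_i b i ^+ 2; set S := \sum_i a i * b i.
  transitivity (\sum_i (a i ^+ 2 * SB + b i ^+ 2 * SA - 2 * (a i * b i * S))).
    apply: eq_bigr => i _; rewrite !mulr_sumr -big_split /= -sumrB.
    by apply: eq_bigr => j _; ring.
  by rewrite sumrB big_split /= -mulr_sumr -!mulr_suml -/SA -/SB -/S; ring.
by clear; lra.
Qed.

(** The first value above [C] would exceed its predecessor; log-convexity would then keep the
    sequence increasing up to [r k], which is at most [C]. *)
Lemma log_convex_bound (R : realFieldType) (r : nat -> R) (k : nat) (C : R) :
  (forall i, 0 <= r i) -> r 1%N <= C -> r k <= C ->
  (forall i, (1 < i < k)%N -> r i ^+ 2 <= r i.-1 * r i.+1) ->
  forall i, (1 <= i <= k)%N -> r i <= C.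
Proof.
move=> r0 r1 rk rr i ik; apply: contraT; rewrite -ltNge => Ci.
have ex : exists i, (1 <= i <= k)%N && (C < r i) by exists i; rewrite ik.
case: (ex_minnP ex) => j /andP[/andP[j1 jk] Cj] jmin {i ik Ci ex}.
have j2 : (1 < j)%N.
  by rewrite ltn_neqAle j1 andbT; apply/eqP => jE; rewrite -jE ltNge r1 in Cj.
have rj : r j.-1 <= C.
  rewrite leNgt; apply/negP => Cj1; have := jmin j.-1.
  by rewrite Cj1 andbT; lia.
have step d : (j + d <= k)%N -> C < r (j + d)%N /\ r (j + d).-1 < r (j + d)%N.
  elim: d => [|d IHd] jd; first by rewrite addn0; split=> //; apply: le_lt_trans Cj.
  have [|C1 C2] := IHd; first by lia.
  have := rr (j + d)%N; rewrite addnS /= => rrd.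
  have {}rrd : r (j + d)%N ^+ 2 <= r (j + d).-1 * r (j + d).+1 by apply: rrd; lia.
  have p0 := r0 (j + d).-1; have p2 := r0 (j + d).+1.
  have lt : r (j + d)%N < r (j + d).+1 by move: rrd p0 p2 C2; clear; nra.
  by split=> //; apply: lt_trans lt.
have [] := step (k - j)%N; first by rewrite subnKC.
by rewrite subnKC // ltNge rk.
Qed.

Lemma le_half (R : realFieldType) (x y : R) : x <= x / 2 + y -> x / 2 <= y.
Proof. by lra. Qed.

Fixpoint allsq (T : Type) (X : seq T) n : seq (seq T) :=
  if n is n'.+1 then [seq x :: t | x <- X, t <- allsq X n'] else [:: [::]].

Lemma size_allsq (T : Type) (X : seq T) n : size (allsq X n) = (size X ^ n)%N.
Proof. by elim: n => //= n IHn; rewrite size_allpairs IHn expnS. Qed.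

Lemma mem_allsq (T : eqType) (X : seq T) n (t : seq T) :
  (t \in allsq X n) = (size t == n) && all (mem X) t.
Proof.
elim: n t => [|n IHn] [|x t] //=.
  by apply/negP => /allpairsP[[a b] [_ _]].
rewrite eqSS; apply/allpairsP/idP => [[[a b] /= [aX + [-> ->]]]|].
  by rewrite IHn aX andbC => /andP[-> ->].
by case/and3P=> st xX tX; exists (x, t); rewrite /= IHn st xX tX.
Qed.

Section Walks.
Variables (R : realFieldType) (v : nat) (Dt : finType) (src tgt : Dt -> 'I_v.+1).
Implicit Types (u w : 'I_v.+1) (t : seq Dt) (c : Dt -> R) (cs : seq (Dt -> R)).

Fixpoint walk u t w : bool :=
  if t is d :: t' then (src d == u) && walk (tgt d) t' w else u == w.

(** A separate weight for each step lets one product of matrices count the walks with conditions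
    imposed at chosen positions. *)
Fixpoint wt cs t : R :=
  match cs, t with c :: cs', d :: t' => c d * wt cs' t' | _, _ => 1 end.

Definition mat c : 'M[R]_v.+1 := \sum_d c d *: delta_mx (src d) (tgt d).

Lemma mulE (A B : 'M[R]_v.+1) u w : (A * B) u w = \sum_z A u z * B z w.
Proof. by rewrite -mulmxE mxE. Qed.

Lemma matE c u w : mat c u w = \sum_d c d * ((src d == u) && (tgt d == w))%:R.
Proof.
rewrite /mat summxE; apply: eq_bigr => d _.
by rewrite !mxE ![_ == u]eq_sym ![_ == w]eq_sym.
Qed.

Lemma mat_mulE c (A : 'M[R]_v.+1) u w :
  (mat c * A) u w = \sum_d c d * (src d == u)%:R * A (tgt d) w.
Proof.
rewrite mulE; under eq_bigr do rewrite matE mulr_suml.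
rewrite exchange_big; apply: eq_bigr => d _ /=.
rewrite (bigD1 (tgt d)) //= eqxx andbT big1 ?addr0 // => z.
by rewrite eq_sym => /negbTE->; rewrite andbF mulr0 mul0r.
Qed.

(** The transfer matrix method: summing over the first dart is multiplication by the matrix of its
    weight. *)
Lemma walk_sum cs u w :
  \sum_(t <- allsq (enum Dt) (size cs)) wt cs t * (walk u t w)%:R =
  (\prod_(c <- cs) mat c) u w.
Proof.
elim: cs u => [|c cs IHcs] u /=.
  by rewrite big_nil big_cons big_nil /= mul1r addr0 mxE.
rewrite big_cons big_allpairs_dep /= big_enum mat_mulE; apply: eq_bigr => d _ /=.
rewrite -IHcs mulr_sumr; apply: eq_bigr => t _.
by case: (src d == u); rewrite ?mulr1 ?mulr0 ?mul0r ?mulrA.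
Qed.

Lemma wt_cat cs1 cs2 t1 t2 : size cs1 = size t1 ->
  wt (cs1 ++ cs2) (t1 ++ t2) = wt cs1 t1 * wt cs2 t2.
Proof.
elim: cs1 t1 => [|c cs1 IH] [|d t1] //= => [_|[st]]; first by rewrite mul1r.
by rewrite IH // mulrA.
Qed.

Variable good : {set Dt}.
Hypothesis no_loop : forall d, src d != tgt d.

Definition ind (T : eqType) (f : Dt -> T) (x : T) : Dt -> R :=
  fun d => ((d \in good) && (f d == x))%:R.
Definition goodW : Dt -> R := fun d => (d \in good)%:R.
Let B := mat goodW.

Lemma B_ge0 u w : 0 <= B u w.
Proof. by rewrite matE; apply: sumr_ge0 => d _; rewrite mulr_ge0 ?ler0n. Qed.

Lemma mulmx_ge0 (A C : 'M[R]_v.+1) : (forall u w, 0 <= A u w) ->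
  (forall u w, 0 <= C u w) -> forall u w, 0 <= (A * C) u w.
Proof. by move=> A0 C0 u w; rewrite mulE; apply: sumr_ge0 => z _; apply: mulr_ge0. Qed.

Lemma expmx_ge0 (A : 'M[R]_v.+1) g : (forall u w, 0 <= A u w) ->
  forall u w, 0 <= (A ^+ g) u w.
Proof.
move=> A0; elim: g => [|g IHg] u w; first by rewrite expr0 mxE ler0n.
by rewrite exprS; apply: mulmx_ge0.
Qed.

Lemma sym_expmx (A : 'M[R]_v.+1) g : (forall u w, A u w = A w u) ->
  forall u w, (A ^+ g) u w = (A ^+ g) w u.
Proof.
move=> As; elim: g => [|g IHg] u w; first by rewrite expr0 !mxE eq_sym.
rewrite {1}exprS exprSr !mulE; apply: eq_bigr => z _.
by rewrite mulrC IHg As.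
Qed.

Lemma expmx_cs (A : 'M[R]_v.+1) a b u w : (forall u w, A u w = A w u) ->
  (A ^+ (a + b)) u w ^+ 2 <= (A ^+ a.*2) u u * (A ^+ b.*2) w w.
Proof.
move=> As; rewrite -!addnn !exprD !mulE.
apply: le_trans (cauchy_schwarz _ _) _; rewrite le_eqVlt; apply/orP; left; apply/eqP.
by congr (_ * _); apply: eq_bigr => z _; rewrite expr2; congr (_ * _);
  rewrite sym_expmx.
Qed.

Lemma matM_tr (A C : 'M[R]_v.+1) : \tr (A * C) = \tr (C * A).
Proof. by rewrite -!mulmxE mxtrace_mulC. Qed.

Lemma degE u : \sum_w B u w = \sum_d goodW d * (src d == u)%:R.
Proof.
under eq_bigr do rewrite matE; rewrite exchange_big; apply: eq_bigr => d _ /=.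
rewrite -mulr_sumr (bigD1 (tgt d)) //= eqxx andbT big1 ?addr0 // => z.
by rewrite eq_sym => /negbTE->; rewrite andbF.
Qed.

Lemma sum_deg : \sum_u \sum_w B u w = #|good|%:R.
Proof.
under eq_bigr do rewrite degE; rewrite exchange_big /=.
rewrite -sum1_card natr_sum [RHS]big_mkcond; apply: eq_bigr => d _ /=.
rewrite -mulr_sumr (bigD1 (src d)) //= eqxx big1 ?addr0 ?mulr1.
  by rewrite /goodW; case: (d \in good).
by move=> z; rewrite eq_sym => /negbTE->.
Qed.

Lemma prod_nseq n c : \prod_(c' <- nseq n c) mat c' = mat c ^+ n.
Proof. by elim: n => [|n IHn]; rewrite ?big_nil // big_cons IHn exprS. Qed.

(** * Closed walks on which a function of the dart repeats a value *)

Section Repeats.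
Variables (T : finType) (f : Dt -> T).

Definition reps (a b c : nat) (x : T) : seq (Dt -> R) :=
  nseq a goodW ++ ind f x :: nseq b goodW ++ ind f x :: nseq c goodW.

Lemma wt_good n t : size t = n -> all (mem good) t -> wt (nseq n goodW) t = 1.
Proof.
elim: n t => [|n IHn] [|d t] //= [st] /andP[dg tg].
by rewrite IHn // /goodW dg mulr1.
Qed.

Lemma wt_ge0 cs t : all (fun c : Dt -> R => [forall d, 0 <= c d]) cs ->
  0 <= wt cs t.
Proof.
elim: cs t => [|c cs IH] [|d t] //= /andP[/forallP c0 cs0].
by apply: mulr_ge0 => //; apply: IH.
Qed.

Lemma not_uniq_split t : ~~ uniq (map f t) ->
  exists t1 d1 t2 d2 t3, t = t1 ++ d1 :: t2 ++ d2 :: t3 /\ f d1 = f d2.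
Proof.
elim: t => //= d t IHt; rewrite negb_and negbK => /orP[/mapP[d2 d2t fd]|/IHt].
  by case/splitPr: d2t => t2 t3; exists [::], d, t2, d2, t3.
move=> [t1 [d1 [t2 [d2 [t3 [-> fd]]]]]].
by exists (d :: t1), d1, t2, d2, t3.
Qed.

Lemma reps_ge0 (a b c : nat) (x : T) t : 0 <= wt (reps a b c x) t.
Proof.
apply: wt_ge0; rewrite /reps !all_cat /= !all_cat /=.
have g0 : [forall d, 0 <= goodW d] by apply/forallP => d; rewrite ler0n.
have f0 : [forall d, 0 <= ind f x d] by apply/forallP => d; rewrite ler0n.
by rewrite !all_nseq g0 f0 !orbT.
Qed.

Lemma not_uniq_wt l t : size t = l -> all (mem good) t -> ~~ uniq (map f t) ->
  1 <= \sum_(a < l) \sum_(b < l | (a + b.+2 <= l)%N)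
         \sum_x wt (reps a b (l - (a + b.+2)) x) t.
Proof.
move=> tl tg /not_uniq_split[t1 [d1 [t2 [d2 [t3 [tE fd]]]]]].
have sE : (size t1 + (size t2).+2 + size t3)%N = l.
  by rewrite -tl tE !size_cat /= size_cat /=; lia.
have al : (size t1 < l)%N by lia.
have bl : (size t2 < l)%N by lia.
rewrite (bigD1 (Ordinal al)) //= (bigD1 (Ordinal bl)) /=; last by lia.
rewrite (bigD1 (f d1)) //=.
have -> : (l - (size t1 + (size t2).+2) = size t3)%N by lia.
have -> : wt (reps (size t1) (size t2) (size t3) (f d1)) t = 1.
  move: tg; rewrite tE /reps wt_cat ?size_nseq // all_cat /= all_cat /=.
  rewrite wt_cat ?size_nseq //= => /and5P[g1 g2 g3 g4 g5].
  by rewrite !wt_good // /ind g2 g4 -fd eqxx /= !mulr1.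
rewrite -!addrA lerDl !addr_ge0 //.
- by apply: sumr_ge0 => x _; apply: reps_ge0.
- by apply: sumr_ge0 => b _; apply: sumr_ge0 => x _; apply: reps_ge0.
- apply: sumr_ge0 => a _; apply: sumr_ge0 => b _; apply: sumr_ge0 => x _.
  exact: reps_ge0.
Qed.

(* Weight of the closed walks whose first step agrees under f with
   the step b.+1 later. *)
Definition rep_tr (b c : nat) : R :=
  \sum_x \tr (mat (ind f x) * B ^+ b * mat (ind f x) * B ^+ c).

(** Cyclic invariance of the trace moves the first [a] steps to the end, so only the two gaps
    between the repeated values matter. *)
Lemma reps_tr (a b c : nat) :
  \sum_x \sum_u \sum_(t <- allsq (enum Dt) (a + b.+2 + c)) wt (reps a b c x) t *
     (walk u t u)%:R = rep_tr b (c + a).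
Proof.
apply: eq_bigr => x _.
have sz : size (reps a b c x) = (a + b.+2 + c)%N.
  by rewrite /reps !size_cat /= !size_cat /= !size_nseq; lia.
under eq_bigr => u _ do rewrite -sz walk_sum.
rewrite -/(mxtrace _) /reps big_cat /= big_cons big_cat /= big_cons !prod_nseq.
by rewrite matM_tr exprD !mulrA.
Qed.

Lemma not_uniq_count l X : (forall b, (b.+2 <= l)%N -> rep_tr b (l - b.+2) <= X) ->
  0 <= X ->
  \sum_u \sum_(t <- allsq (enum Dt) l)
     [&& walk u t u, all (mem good) t & ~~ uniq (map f t)]%:R <= l%:R ^+ 2 * X.
Proof.
move=> HX X0.
pose c (a b : nat) := (l - (a + b.+2))%N.
have le1 : \sum_u \sum_(t <- allsq (enum Dt) l)
     [&& walk u t u, all (mem good) t & ~~ uniq (map f t)]%:R <=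
   \sum_u \sum_(t <- allsq (enum Dt) l)
      \sum_(a < l) \sum_(b < l | (a + b.+2 <= l)%N)
         \sum_x wt (reps a b (c a b) x) t * (walk u t u)%:R.
  apply: ler_sum => u _; rewrite big_seq [leRHS]big_seq; apply: ler_sum => t.
  rewrite mem_allsq => /andP[/eqP tl _].
  under eq_bigr do under eq_bigr do rewrite -mulr_suml.
  under eq_bigr do rewrite -mulr_suml.
  rewrite -mulr_suml; case: (walk u t u); rewrite ?mulr0 //= mulr1.
  case: (boolP (all _ t)) => //= tg; last first.
    by do 3 (apply: sumr_ge0 => ? _); apply: reps_ge0.
  case: (boolP (uniq _)) => //= tu; last exact: not_uniq_wt.
  by do 3 (apply: sumr_ge0 => ? _); apply: reps_ge0.
apply: (le_trans le1).
under eq_bigr do rewrite exchange_big /=.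
rewrite exchange_big /=.
have -> : l%:R ^+ 2 * X = \sum_(a < l) \sum_(b < l) X.
  by rewrite !sumr_const !card_ord -mulrnA -[in RHS]mulr_natl natrM expr2.
apply: ler_sum => a _.
under eq_bigr do rewrite exchange_big /=.
rewrite exchange_big /= [leRHS](bigID (fun b : 'I_l => a + b.+2 <= l)%N) /=.
apply: le_trans (_ : \sum_(b < l | (a + b.+2 <= l)%N) X <= _); last first.
  by rewrite lerDl; apply: sumr_ge0.
apply: ler_sum => b abl.
under eq_bigr do rewrite exchange_big /=.
rewrite exchange_big /=.
have lE : (a + b.+2 + c a b = l)%N by rewrite /c; lia.
rewrite -{1}lE reps_tr (_ : (c a b + a = l - b.+2)%N); last by rewrite /c; lia.
by apply: HX; lia.
Qed.

Lemma rep_tr_sym (b c : nat) : rep_tr b c = rep_tr c b.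
Proof.
apply: eq_bigr => x _; set A := mat _.
by rewrite -[A * B ^+ b * A * _]mulrA matM_tr !mulrA.
Qed.

Hypothesis Bsym : forall u w, B u w = B w u.
Hypothesis fsym : forall x u w, mat (ind f x) u w = mat (ind f x) w u.

Lemma ind_ge0 x u w : 0 <= mat (ind f x) u w.
Proof. by rewrite matE; apply: sumr_ge0 => d _; rewrite mulr_ge0 ?ler0n. Qed.

Let C (k p : nat) x : 'M[R]_v.+1 := B ^+ p * mat (ind f x) * B ^+ (k - p).

(** Cutting each of the two free arcs in two and transposing one of the halves, which symmetry of
    the matrices permits, exhibits the trace as an inner product of two vectors of the same
    family. *)
Lemma rep_tr_dot k p1 p2 : (p1 <= k)%N -> (p2 <= k)%N ->
  rep_tr (p1 + p2) (k.*2 - (p1 + p2)) =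
  \sum_(i : T * ('I_v.+1 * 'I_v.+1)) C k p1 i.1 i.2.1 i.2.2 * C k p2 i.1 i.2.1 i.2.2.
Proof.
move=> p1k p2k.
rewrite -(pair_bigA _ (fun x uw => C k p1 x uw.1 uw.2 * C k p2 x uw.1 uw.2)) /=.
apply: eq_bigr => x _.
rewrite -(pair_bigA _ (fun u w => C k p1 x u w * C k p2 x u w)) /=.
have -> : (k.*2 - (p1 + p2) = (k - p2) + (k - p1))%N by lia.
have trC u w : C k p1 x u w = (B ^+ (k - p1) * mat (ind f x) * B ^+ p1) w u.
  rewrite /C -[in RHS]mulrA !mulE.
  under [RHS]eq_bigr => z _ do rewrite mulE mulr_sumr.
  under [LHS]eq_bigr => z _ do rewrite mulE mulr_suml.
  apply: eq_bigr => z _; apply: eq_bigr => z' _.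
  rewrite (sym_expmx (k - p1) Bsym w z) (sym_expmx p1 Bsym z' u) (fsym x z z').
  by rewrite mulrC [_ * mat _ _ _]mulrC.
rewrite exchange_big /=.
under eq_bigr => w _ do under eq_bigr => u _ do rewrite trC.
under eq_bigr => w _ do rewrite -mulE.
rewrite -/(mxtrace _) /C; set A := mat _.
rewrite !exprD.
rewrite [in LHS](_ : A * (B ^+ p1 * B ^+ p2) * A * (B ^+ (k - p2) * B ^+ (k - p1)) =
  (A * B ^+ p1 * B ^+ p2 * A * B ^+ (k - p2)) * B ^+ (k - p1)); last first.
  by rewrite !mulrA.
by rewrite matM_tr !mulrA.
Qed.

Lemma rep_tr_ge0 (b c : nat) : 0 <= rep_tr b c.
Proof.
apply: sumr_ge0 => x _; apply: sumr_ge0 => u _.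
have B0 := expmx_ge0 _ B_ge0.
by do !(apply: mulmx_ge0 => //); move=> *; apply: ind_ge0.
Qed.

(** Let the maximum be attained at a gap [m], with [m <= k] by symmetry of the two gaps.
    Cauchy-Schwarz between positions 0 and [m] gives [F(m)^2 <= F(0) * F(2m) <= F(0) * F(m)]. Equal
    colours are thus most frequent on consecutive darts. *)
Lemma rep_tr_max k b : (b <= k.*2)%N ->
  rep_tr b (k.*2 - b) <= rep_tr 0 k.*2.
Proof.
pose F (b : 'I_(k.*2).+1) := rep_tr b (k.*2 - b).
suff Fmax (i : 'I_(k.*2).+1) : F i <= rep_tr 0 k.*2.
  by rewrite -ltnS => bk; exact: (Fmax (Ordinal bk)).
have [m _ mmax] := @arg_maxP _ _ _ (ord0 : 'I_(k.*2).+1) xpredT F isT.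
apply: le_trans (mmax i isT) _ => {i}.
wlog mk : m mmax / (m <= k)%N.
  move=> wl; have [|km] := leqP m k; first exact: wl.
  have mk : (k.*2 - m < (k.*2).+1)%N by lia.
  have FE : F m = F (Ordinal mk).
    by rewrite /F /= rep_tr_sym; congr rep_tr; have := ltn_ord m; lia.
  rewrite FE; apply: wl; last by rewrite /=; lia.
  by move=> j _; rewrite -FE; apply: mmax.
have m2 : (m + m < (k.*2).+1)%N by lia.
have [F0|F0] := leP (F m) 0; first by apply: le_trans F0 (rep_tr_ge0 _ _).
have cs : F m ^+ 2 <= rep_tr 0 k.*2 * F (Ordinal m2).
  have := cauchy_schwarz (fun i : T * ('I_v.+1 * 'I_v.+1) => C k 0 i.1 i.2.1 i.2.2)
    (fun i => C k m i.1 i.2.1 i.2.2).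
  rewrite -rep_tr_dot // add0n.
  have sq p : (p <= k)%N -> \sum_(i : T * ('I_v.+1 * 'I_v.+1)) C k p i.1 i.2.1 i.2.2 ^+ 2 =
     rep_tr (p + p) (k.*2 - (p + p)).
    by move=> pk; rewrite rep_tr_dot //; apply: eq_bigr => j _; rewrite expr2.
  by rewrite !sq // addn0 subn0.
have mm := mmax (Ordinal m2) isT.
rewrite -(ler_pM2r F0) -expr2; apply: le_trans cs _.
by apply: ler_wpM2l; rewrite ?rep_tr_ge0.
Qed.

(** At gap 0 there are [#|good|] choices of the first dart, then at most [N] of an adjacent dart of
    the same colour, and weight at most [Y] for closing up. *)
Lemma rep_tr0 g N Y : (forall x u, \sum_w mat (ind f x) u w <= N) ->
  (forall u w, (B ^+ g) u w <= Y) -> 0 <= Y -> 0 <= N ->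
  rep_tr 0 g <= Y * (N * #|good|%:R).
Proof.
move=> HN HY Y0 N0.
have HB : \sum_x \sum_u \sum_w mat (ind f x) u w = #|good|%:R.
  rewrite -sum_deg exchange_big; apply: eq_bigr => u _ /=.
  rewrite exchange_big; apply: eq_bigr => w _ /=.
  under eq_bigr do rewrite matE; rewrite exchange_big [in RHS]/B matE /=.
  apply: eq_bigr => d _; rewrite -mulr_suml; congr (_ * _).
  rewrite (bigD1 (f d)) //= /ind eqxx andbT big1 ?addr0 // => x.
  by rewrite eq_sym => /negbTE->; rewrite andbF.
rewrite mulrA -HB mulr_sumr; apply: ler_sum => x _; rewrite expr0 mulr1.
rewrite /mxtrace [leRHS]mulr_sumr; apply: ler_sum => u _.
rewrite -!mulrA mulE [leRHS]mulrA mulr_sumr; apply: ler_sum => z _.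
rewrite mulrC; apply: ler_wpM2r; first exact: ind_ge0.
rewrite mulE mulrC; apply: le_trans (_ : \sum_w mat (ind f x) z w * Y <= _).
  by apply: ler_sum => w _; apply: ler_wpM2l; rewrite ?ind_ge0.
by rewrite -mulr_suml ler_wpM2r.
Qed.

End Repeats.

Lemma delta_mulE x (A : 'M[R]_v.+1) u w :
  (delta_mx x x * A) u w = (u == x)%:R * A x w.
Proof.
rewrite mulE (bigD1 x) //= !mxE eqxx andbT big1 ?addr0 // => z zx.
by rewrite mxE (negbTE zx) andbF mul0r.
Qed.

Lemma mat_ind_src x : mat (ind src x) = delta_mx x x * B.
Proof.
apply/matrixP => u w; rewrite delta_mulE !matE mulr_sumr.
apply: eq_bigr => d _; rewrite /ind /goodW.
case: (d \in good) => /=; rewrite ?mul0r ?mulr0 // mul1r.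
case: (eqVneq (src d) x) => [->|_] /=; last by rewrite mul0r mulr0.
by rewrite mul1r [u == x]eq_sym; case: (x == u); rewrite ?mul1r ?mul0r.
Qed.

(** A repeated source cuts the closed walk into two closed walks at that vertex. *)
Lemma rep_tr_src (b c : nat) :
  rep_tr src b c = \sum_x (B ^+ b.+1) x x * (B ^+ c.+1) x x.
Proof.
apply: eq_bigr => x _; rewrite mat_ind_src.
rewrite -!mulrA -exprS [B * (B ^+ b * _)]mulrA -exprS.
rewrite /mxtrace (bigD1 x) //= delta_mulE eqxx mul1r big1 ?addr0; last first.
  by move=> u /negbTE ux; rewrite delta_mulE ux mul0r.
rewrite mulE (bigD1 x) //= delta_mulE eqxx mul1r big1 ?addr0 // => z /negbTE zx.
by rewrite delta_mulE zx mul0r mulr0.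
Qed.

(** * Walk counts from a uniform bound on the return weights *)

Section Bounds.
Variables (k : nat) (D Delta lam M : R).
Hypotheses (Bsym : forall u w, B u w = B w u) (k0 : (0 < k)%N).
Hypotheses (lam0 : 0 < lam) (D0 : 0 < D) (BD : forall u w, B u w <= D).
Let deg u := \sum_w B u w.
Hypotheses (degD : forall u, deg u <= Delta) (lamD : lam <= Delta).
Hypothesis (ME : M = D * lam ^+ k.*2).
Hypothesis HM : forall d, d \in good -> (B ^+ k.*2.+1) (tgt d) (src d) <= M.

Let Bge0 g u w : 0 <= (B ^+ g) u w.
Proof. exact: expmx_ge0 B_ge0 u w. Qed.

Let deg_ge0 u : 0 <= deg u.
Proof. by apply: sumr_ge0 => w _; apply: B_ge0. Qed.

Let lamX0 g : 0 < lam ^+ g.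
Proof. by rewrite exprn_gt0. Qed.

Lemma closed_top u : (B ^+ k.*2.+2) u u <= deg u * M.
Proof.
have -> : (B ^+ k.*2.+2) u u = (mat goodW * B ^+ k.*2.+1) u u by rewrite exprS.
rewrite mat_mulE /deg degE mulr_suml; apply: ler_sum => d _.
rewrite /goodW; case: (boolP (d \in good)) => dg; rewrite ?mul0r // mul1r.
have [<-|] := eqVneq (src d) u; rewrite ?mul0r // !mul1r.
exact: HM.
Qed.

(** Even closed walks are log-convex in their length. After rescaling by powers of [lam], the choice
    [M = D * lam^(2k)] gives the same bound [deg u * D * lam^(2k)] at both ends, lengths 2 and
    [2k+2], hence in between. *)
Lemma closed_even i u : (1 <= i <= k.+1)%N ->
  lam ^+ 2 * (B ^+ i.*2) u u <= deg u * D * lam ^+ i.*2.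
Proof.
move=> ik.
pose r j := (B ^+ j.*2) u u * lam ^+ (k.+1 - j).*2.
have : r i <= deg u * D * lam ^+ k.*2.
  apply: (log_convex_bound (r := r) (k := k.+1)) ik => [j|||j /andP[j1 jk]].
  - by rewrite mulr_ge0 // ltW.
  - rewrite /r subSS subn0 ler_pM2r // -addnn exprD !expr1 mulE mulr_suml.
    by apply: ler_sum => w _; rewrite ler_wpM2l ?B_ge0.
  - by rewrite /r subnn expr0 mulr1 (le_trans (closed_top u)) // ME mulrA.
  - rewrite /r exprMn [leRHS]mulrACA -exprM -exprD.
    have -> : ((k.+1 - j.-1).*2 + (k.+1 - j.+1).*2 = (k.+1 - j).*2 * 2)%N by lia.
    rewrite ler_pM2r //.
    have := expmx_cs j.-1 j.+1 u u Bsym.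
    by rewrite (_ : (j.-1 + j.+1 = j.*2)%N) //; lia.
rewrite /r => ri; rewrite -(ler_pM2r (lamX0 (k.+1 - i).*2)).
have lE : lam ^+ i.*2 * lam ^+ (k.+1 - i).*2 = lam ^+ 2 * lam ^+ k.*2.
  by rewrite -!exprD; congr (_ ^+ _); move: ik; clear; lia.
apply: le_trans (_ : lam ^+ 2 * (deg u * D * lam ^+ k.*2) <= _).
  by rewrite -(mulrA (lam ^+ 2)) (ler_pM2l (lamX0 2)).
by rewrite -[leRHS]mulrA lE mulrCA.
Qed.

(** Cauchy-Schwarz at the midpoint reduces a walk of any length to two even closed walks, of lengths
    [2 * floor(g/2)] and [2 * ceil(g/2)]. *)
Lemma walk_sq g u w : (2 <= g <= k.*2.+1)%N ->
  (lam ^+ 2 * (B ^+ g) u w) ^+ 2 <= (deg u * D * lam ^+ g) * (deg w * D * lam ^+ g).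
Proof.
move=> gk; rewrite exprMn.
have gE : (g = g./2 + uphalf g)%N by clear; lia.
have cs := expmx_cs g./2 (uphalf g) u w Bsym; rewrite -gE in cs.
have e1 : lam ^+ 2 * (B ^+ (g./2).*2) u u <= deg u * D * lam ^+ (g./2).*2.
  by apply: closed_even; move: gk; clear; lia.
have e2 : lam ^+ 2 * (B ^+ (uphalf g).*2) w w <= deg w * D * lam ^+ (uphalf g).*2.
  by apply: closed_even; move: gk; clear; lia.
apply: le_trans (_ : (lam ^+ 2 * (B ^+ (g./2).*2) u u) *
                     (lam ^+ 2 * (B ^+ (uphalf g).*2) w w) <= _).
  rewrite [leRHS]mulrACA -expr2; apply: ler_wpM2l => //.
  by rewrite exprn_ge0 // ltW.
apply: le_trans (ler_pM _ _ e1 e2) _.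
- by apply: mulr_ge0 => //; apply: ltW.
- by apply: mulr_ge0 => //; apply: ltW.
rewrite [leLHS]mulrACA [leRHS]mulrACA -!exprD.
by rewrite (_ : ((g./2).*2 + (uphalf g).*2 = g + g)%N) //; clear; lia.
Qed.

Lemma walk_le g u w : (1 <= g <= k.*2.+1)%N ->
  lam ^+ 2 * (B ^+ g) u w <= Delta * D * lam ^+ g.
Proof.
case: g => [|[|g]] // gk.
  rewrite !expr1 expr2 -mulrA [leRHS]mulrC ler_pM2l // ler_pM ?B_ge0 //.
  exact: ltW.
have De0 : 0 <= Delta by apply: le_trans (ltW lam0) lamD.
have c0 : 0 <= Delta * D * lam ^+ g.+2.
  exact: mulr_ge0 (mulr_ge0 De0 (ltW D0)) (ltW (lamX0 _)).
have gk2 : (2 <= g.+2 <= k.*2.+1)%N by [].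
have l0 : 0 <= lam ^+ 2 * (B ^+ g.+2) u w.
  exact: mulr_ge0 (ltW (lamX0 _)) (Bge0 _ _ _).
rewrite -(@ler_pXn2r _ 2) ?nnegrE //.
apply: le_trans (walk_sq u w gk2) _; rewrite expr2.
have le1 x : deg x * D * lam ^+ g.+2 <= Delta * D * lam ^+ g.+2.
  by rewrite (ler_pM2r (lamX0 _)) (ler_pM2r D0).
have ge1 x : 0 <= deg x * D * lam ^+ g.+2.
  exact: mulr_ge0 (mulr_ge0 (deg_ge0 _) (ltW D0)) (ltW (lamX0 _)).
exact: ler_pM.
Qed.

Lemma closed_le g u : (1 <= g <= k.*2.+1)%N ->
  lam ^+ 2 * (B ^+ g) u u <= deg u * D * lam ^+ g.
Proof.
case: g => [|[|g]] // gk.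
  rewrite expr1 /B matE big1 ?mulr0 ?mulr_ge0 ?(ltW D0) ?(ltW (lamX0 _)) //.
  move=> d _; have [su|] := eqVneq (src d) u; rewrite ?mulr0 //=.
  by rewrite -su eq_sym (negbTE (no_loop d)) mulr0.
have c0 : 0 <= deg u * D * lam ^+ g.+2.
  exact: mulr_ge0 (mulr_ge0 (deg_ge0 _) (ltW D0)) (ltW (lamX0 _)).
have gk2 : (2 <= g.+2 <= k.*2.+1)%N by [].
have l0 : 0 <= lam ^+ 2 * (B ^+ g.+2) u u.
  exact: mulr_ge0 (ltW (lamX0 _)) (Bge0 _ _ _).
rewrite -(@ler_pXn2r _ 2) ?nnegrE //.
by apply: le_trans (walk_sq u u gk2) _; rewrite expr2.
Qed.

(** Walks of length [g] between fixed ends weigh at most [F0 * lam^g]; repeated vertices are rare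
    when this prefactor is small. *)
Let F0 := Delta * D / lam ^+ 2.

Lemma walk_F0 g u w : (1 <= g <= k.*2.+1)%N -> (B ^+ g) u w <= F0 * lam ^+ g.
Proof.
move/(walk_le u w) => H; rewrite /F0 mulrAC ler_pdivlMr //.
by rewrite mulrC.
Qed.

Lemma F0_ge0 : 0 <= F0.
Proof.
by rewrite divr_ge0 ?(ltW (lamX0 _)) // mulr_ge0 ?(ltW D0) // (le_trans (ltW lam0)).
Qed.

Lemma rep_src_le b : (b <= k.*2)%N ->
  rep_tr src b (k.*2 - b) <= F0 * M * #|good|%:R.
Proof.
move=> bk; rewrite rep_tr_src.
apply: le_trans (_ : \sum_x F0 * lam ^+ b.+1 * (deg x * D * lam ^+ (k.*2 - b).+1 / lam ^+ 2) <= _).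
  apply: ler_sum => x _; apply: ler_pM => //.
    by apply: walk_F0; lia.
  by rewrite ler_pdivlMr // mulrC; apply: closed_le; lia.
rewrite -mulr_sumr -!mulr_suml sum_deg ME -[k.*2 in leRHS](subnKC bk) exprD !exprS.
rewrite le_eqVlt; apply/orP; left; apply/eqP; field.
by rewrite gt_eqF.
Qed.

Lemma rep_col_le (T : finType) (f : Dt -> T) N b : (b <= k.*2)%N ->
  (forall x u w, mat (ind f x) u w = mat (ind f x) w u) ->
  (forall x u, \sum_w mat (ind f x) u w <= N) -> 0 <= N ->
  rep_tr f b (k.*2 - b) <= F0 * lam ^+ k.*2 * (N * #|good|%:R).
Proof.
move=> bk fs fN N0; apply: le_trans (rep_tr_max Bsym fs bk) _.
apply: rep_tr0 => // [u w|]; first by apply: walk_F0; lia.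
by rewrite mulr_ge0 ?F0_ge0 // ltW.
Qed.

Hypothesis F01 : F0 <= 1.

(** In a specification of a walk, [Some d] prescribes the dart of a step and [None] leaves the step
    free. *)
Definition smat (o : option Dt) : 'M[R]_v.+1 :=
  if o is Some d then delta_mx (src d) (tgt d) else B.
Definition swt (o : option Dt) : Dt -> R :=
  if o is Some d then fun d' => (d' == d)%:R else goodW.
Definition free (s : seq (option Dt)) : nat := count (pred1 None) s.

Lemma mat_swt o : mat (swt o) = smat o.
Proof.
case: o => [d|] //=; rewrite /mat (bigD1 d) //= eqxx scale1r big1 ?addr0 //.
by move=> d' /negbTE->; rewrite scale0r.
Qed.

Lemma mul_deltaE (A C : 'M[R]_v.+1) a b u w :
  (A * delta_mx a b * C) u w = A u a * C b w.
Proof.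
rewrite mulE (bigD1 b) //= mulE (bigD1 a) //= !mxE !eqxx mulr1.
rewrite big1 => [|z /negbTE za]; last by rewrite mxE za mulr0.
rewrite big1 ?addr0 // => z /negbTE zb.
by rewrite mulE big1 ?mul0r // => y _; rewrite mxE zb andbF mulr0.
Qed.

(* Bound on the weight of a walk with n unspecified steps between fixed darts. *)
Definition fbound n : R := if n == 0%N then 1 else F0 * lam ^+ n.

Lemma fboundM m n : fbound m * fbound n <= fbound (m + n)%N.
Proof.
rewrite /fbound addn_eq0; case: eqP => [->|] /=; first by rewrite mul1r.
case: (eqVneq n 0%N) => [->|_] /=; first by rewrite addn0 mulr1.
move=> _; rewrite exprD mulrACA.
by apply: ler_wpM2r; rewrite ?ler_piMl ?F0_ge0 // ltW // mulr_gt0.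
Qed.

Lemma fbound_ge0 n : 0 <= fbound n.
Proof.
by rewrite /fbound; case: eqP => // _; rewrite mulr_ge0 ?F0_ge0 // ltW.
Qed.

Lemma expB_fbound g u w : (g <= k.*2.+1)%N -> (B ^+ g) u w <= fbound g.
Proof.
rewrite /fbound; case: eqP => [->|/eqP g0] gk.
  by rewrite expr0 mxE; case: eqP; rewrite ?ler01.
by apply: walk_F0; rewrite gk lt0n g0.
Qed.

Lemma spec_ge0 s u w : 0 <= (\prod_(o <- s) smat o) u w.
Proof.
elim: s u w => [|o s IHs] u w; first by rewrite big_nil mxE ler0n.
rewrite big_cons; apply: mulmx_ge0 => // {}u {}w.
by case: o => [d|]; rewrite /smat ?B_ge0 // mxE ler0n.
Qed.

(** The power [B ^+ i] accumulates free steps. A prescribed dart is a matrix unit, so the product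
    factors there into two entries, and [fbound] is supermultiplicative because [F0 <= 1]. *)
Lemma spec_entry s i u w : (i + free s <= k.*2.+1)%N ->
  (B ^+ i * \prod_(o <- s) smat o) u w <= fbound (i + free s)%N.
Proof.
elim: s i u w => [|[d|] s IHs] i u w; rewrite /free /= -?/(free s).
- by rewrite addn0 big_nil mulr1 => /expB_fbound; apply.
- rewrite add0n => isk; rewrite big_cons mulrA mul_deltaE.
  apply: le_trans (fboundM _ _).
  apply: ler_pM => //; rewrite ?spec_ge0 //.
    by apply: expB_fbound; apply: leq_trans isk; rewrite leq_addr.
  have := IHs 0%N (tgt d) w; rewrite expr0 mul1r add0n; apply.
  by apply: leq_trans isk; rewrite leq_addl.
- rewrite addnA addn1 => isk; rewrite big_cons mulrA -exprSr.
  exact: IHs.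
Qed.

Lemma free_cat s1 s2 : free (s1 ++ s2) = (free s1 + free s2)%N.
Proof. exact: count_cat. Qed.

Lemma free_nseq n : free (nseq n None) = n.
Proof. by rewrite /free count_nseq mul1n. Qed.

Lemma prod_smat_nseq n : \prod_(o <- nseq n None) smat o = B ^+ n.
Proof. by elim: n => [|n IHn]; rewrite ?big_nil // big_cons IHn exprS. Qed.

Lemma tr_delta a b (A : 'M[R]_v.+1) : \tr (delta_mx a b * A) = A b a.
Proof.
rewrite matM_tr /mxtrace (bigD1 b) //= mulE (bigD1 a) //= mxE !eqxx mulr1.
rewrite big1 => [|z /negbTE za]; last by rewrite mxE za mulr0.
rewrite addr0 big1 ?addr0 // => z /negbTE zb.
by rewrite mulE big1 // => y _; rewrite mxE zb andbF mulr0.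
Qed.

(** Rotating the walk to start just after a prescribed dart turns the trace into a single entry. *)
Lemma spec_trace s i : has isSome s -> (i + free s <= k.*2.+1)%N ->
  \tr (B ^+ i * \prod_(o <- s) smat o) <= fbound (i + free s)%N.
Proof.
elim: s i => [|[d|] s IHs] i //=; rewrite /free /= -?/(free s).
- move=> _; rewrite add0n => isk; rewrite big_cons mulrA matM_tr mulrA matM_tr.
  rewrite tr_delta -prod_smat_nseq -big_cat /=.
  have := @spec_entry (s ++ nseq i None) 0%N (tgt d) (src d).
  by rewrite expr0 mul1r add0n free_cat free_nseq addnC; apply.
- by move=> hs; rewrite addnA addn1 => isk; rewrite big_cons mulrA -exprSr IHs.
Qed.

Lemma spec_trace1 s i : count isSome s = 1%N -> all (oapp (mem good) true) s ->
  (i + free s = k.*2.+1)%N -> \tr (B ^+ i * \prod_(o <- s) smat o) <= M.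
Proof.
elim: s i => [|[d|] s IHs] i //=; rewrite /free /= -?/(free s).
- rewrite add0n => -[c0] /andP[dg _] isk.
  have sE : s = nseq (size s) None.
    by apply/all_pred1P; elim: s c0 {IHs isk} => [|[x|] s IH] //= /IH.
  rewrite big_cons mulrA matM_tr mulrA matM_tr tr_delta sE prod_smat_nseq -exprD.
  move: isk; rewrite {1}sE free_nseq addnC => ->.
  exact: HM.
- by move=> c1 sg; rewrite addnA addn1 => isk; rewrite big_cons mulrA -exprSr IHs.
Qed.

(** * The cost of covering the closed walks without repetitions *)

Section Cover.
Variables (Om X : finType) (edge : Dt -> Om) (col : Dt -> X).
Hypothesis edge2 : forall E : {set Om}, (#|[set d | edge d \in E]| <= 2 * #|E|)%N.
Hypothesis col_edge : forall d d', edge d = edge d' -> col d = col d'.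
Let l := k.*2.+2.

(** For one prescribed edge [fbound] would only give [M * Delta / lam]; the bound on return weights
    gives [M]. *)
Definition bnd (j : nat) : R := if j == 1%N then M else fbound (l - j)%N.

Lemma count_free (s : seq (option Dt)) : (count isSome s + free s = size s)%N.
Proof. by rewrite -(count_predC isSome s) /free; congr addn; apply: eq_count => -[]. Qed.

Lemma wt_spec (E : {set Om}) t : all (mem good) t ->
  wt (map swt [seq if edge d \in E then Some d else None | d <- t]) t = 1.
Proof.
elim: t => //= d t IHt /andP[dg tg]; rewrite IHt // mulr1.
by case: ifP => _; rewrite /= ?eqxx // /goodW dg.
Qed.

Lemma free_spec (E : {set Om}) t : uniq (map edge t) ->
  E \subset [set e in map edge t] ->
  free [seq if edge d \in E then Some d else None | d <- t] = (size t - #|E|)%N.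
Proof.
move=> ut Et.
have <- : size [seq e <- map edge t | e \in E] = #|E|.
  rewrite cardE; apply/eqP; rewrite eqn_leq; apply/andP; split.
    apply: uniq_leq_size; first exact: filter_uniq.
    by move=> e; rewrite mem_filter mem_enum => /andP[].
  apply: uniq_leq_size; first exact: enum_uniq.
  move=> e; rewrite mem_enum => eE; rewrite mem_filter eE.
  by have := subsetP Et e eE; rewrite inE.
rewrite size_filter count_map -(size_map (fun d => if edge d \in E then Some d else None) t).
rewrite -count_free count_map.
rewrite (_ : count _ t = count (preim edge (mem E)) t) ?addKn //.
by apply: eq_count => d /=; case: (edge d \in E).
Qed.

(** Each walk is charged to the specification that records its darts over [E] and frees the other
    steps. At most [2 * #|E|] darts lie over [E], so a position has at most [2 * l + 1]
    possibilities. *)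
Lemma cover_count (E : {set Om}) : (0 < #|E|)%N -> (#|E| <= l)%N ->
  \sum_u \sum_(t <- allsq (enum Dt) l) [&& walk u t u, all (mem good) t,
     uniq (map edge t) & E \subset [set e in map edge t]]%:R
  <= (2 * l + 1)%:R ^+ l * bnd #|E|.
Proof.
move=> E0 El.
pose Xs := None :: [seq Some d | d <- enum Dt & (d \in good) && (edge d \in E)].
pose specs := [seq s <- allsq Xs l | free s == (l - #|E|)%N].
have specsP s : s \in specs -> size s = l /\ all (oapp (mem good) true) s.
  rewrite mem_filter mem_allsq => /and3P[_ /eqP -> sX]; split=> //.
  apply: sub_all sX => -[d|] //=; rewrite inE /= => /mapP[d'].
  by rewrite mem_filter => /andP[/andP[d'g _] _] [->].
have le1 : \sum_u \sum_(t <- allsq (enum Dt) l) [&& walk u t u, all (mem good) t,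
     uniq (map edge t) & E \subset [set e in map edge t]]%:R <=
   \sum_u \sum_(t <- allsq (enum Dt) l) \sum_(s <- specs)
      wt (map swt s) t * (walk u t u)%:R.
  apply: ler_sum => u _; rewrite big_seq [leRHS]big_seq; apply: ler_sum => t.
  rewrite mem_allsq => /andP[/eqP tl _]; rewrite -mulr_suml.
  have ge0 s : 0 <= wt (map swt s) t.
    apply: wt_ge0; rewrite all_map; apply/allP => o _ /=.
    by apply/forallP => d; case: o => [d'|] /=; rewrite ler0n.
  case: (walk u t u); rewrite /= ?mulr0 // mulr1.
  case: (boolP [&& _, _ & _]) => [/and3P[tg tu tE]|_]; last exact: sumr_ge0.
  rewrite (big_rem [seq if edge d \in E then Some d else None | d <- t]) /=.
    by rewrite wt_spec // lerDl sumr_ge0.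
  rewrite mem_filter free_spec // tl eqxx mem_allsq size_map tl eqxx /=.
  apply/allP => o /mapP[d dt ->]; case: ifP => dE; rewrite inE //=.
  have dg : d \in good := allP tg d dt.
  by apply: map_f; rewrite mem_filter mem_enum dE dg.
apply: (le_trans le1).
under eq_bigr do rewrite exchange_big.
rewrite exchange_big.
have bnd0 : 0 <= bnd #|E|.
  by rewrite /bnd; case: ifP => _; rewrite ?fbound_ge0 // ME mulr_ge0 // ltW.
apply: le_trans (_ : \sum_(s <- specs) bnd #|E| <= _).
  rewrite big_seq [leRHS]big_seq; apply: ler_sum => s ss.
  have [sl sg] := specsP s ss.
  have walkE u : \sum_(t <- allsq (enum Dt) l) wt (map swt s) t * (walk u t u)%:R =
      (\prod_(o <- s) smat o) u u.
    rewrite -sl -(size_map swt s) walk_sum big_map.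
    by rewrite (eq_bigr _ (fun o _ => mat_swt o)).
  under eq_bigr do rewrite walkE.
  rewrite -/(mxtrace _).
  move: ss; rewrite mem_filter => /andP[/eqP fs _].
  have cf := count_free s; rewrite /bnd; case: eqP => [E1|E1].
    have := @spec_trace1 s 0; rewrite expr0 mul1r add0n; apply=> //.
      by move: cf; rewrite fs sl E1 /l; clear; lia.
    by rewrite fs E1 /l; clear; lia.
  have := @spec_trace s 0; rewrite expr0 mul1r add0n fs; apply.
    by rewrite has_count; move: cf; rewrite fs sl; move: E0 El; clear; lia.
  by move: E0 E1; rewrite /l; clear; lia.
rewrite big_const_seq count_predT iter_addr_0 -[leLHS]mulr_natl ler_wpM2r //.
rewrite -natrX ler_nat; rewrite size_filter; apply: leq_trans (count_size _ _) _.
rewrite size_allsq leq_expl // /Xs /= size_map.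
have h : (size [seq d <- enum Dt | (d \in good) && (edge d \in E)] <= 2 * #|E|)%N.
  apply: leq_trans (edge2 E); rewrite cardE; apply: uniq_leq_size.
    by rewrite filter_uniq // enum_uniq.
  by move=> d; rewrite mem_filter mem_enum inE => /andP[/andP[]].
by rewrite addn1 ltnS (leq_trans h) // leq_mul2l El.
Qed.

Variables (N A q : R) (G : seq {set Om}).
Hypotheses (N0 : 0 <= N) (q0 : 0 < q) (A1 : 1 <= A).
Hypothesis colsym : forall x u w, mat (ind col x) u w = mat (ind col x) w u.
Hypothesis colN : forall x u, \sum_w mat (ind col x) u w <= N.
Hypothesis C1 : Delta <= A * lam ^+ 2 * q.
Hypothesis C2 : 1 <= A ^+ l * M * q ^+ l.-1.
Hypothesis C3 : l%:R ^+ 2 * (F0 * M * #|good|%:R) +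
  l%:R ^+ 2 * (F0 * lam ^+ k.*2 * (N * #|good|%:R)) <= \tr (B ^+ l) / 2.
Hypothesis G0 : set0 \notin G.
Hypothesis Gcov : forall u t, size t = l -> walk u t u -> all (mem good) t ->
  uniq (map src t) -> uniq (map col t) ->
  exists2 E, E \in G & E \subset [set e in map edge t].

(** [C1] yields [F0 <= A * q * D] and, since [lam <= Delta], also [1 <= A * q * lam]: every further
    prescribed edge exchanges a factor [lam] for a factor [A * q]. When all [l] edges are prescribed
    the claim is [C2]. *)
Lemma bnd_le j : (0 < j <= l)%N -> bnd j <= A ^+ l * M * q ^+ j.-1.
Proof.
move=> /andP[j0 jl].
have A0 : 0 < A by apply: lt_le_trans A1.
have M0 : 0 < M by rewrite ME mulr_gt0.
have AlA n : (n <= l)%N -> A ^+ n <= A ^+ l by move=> nl; rewrite ler_weXn2l.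
rewrite /bnd; case: eqP => [->|j1].
  by rewrite expr0 mulr1 ler_peMl ?(ltW M0) // exprn_ege1.
move: jl; rewrite leq_eqVlt => /orP[/eqP ->|jl].
  by rewrite subnn /fbound eqxx.
have lj : (l - j != 0)%N by rewrite subn_eq0 -ltnNge.
rewrite /fbound (negbTE lj).
have F0q : F0 <= A * q * D.
  rewrite /F0 ler_pdivrMr ?lamX0 //.
  have -> : A * q * D * lam ^+ 2 = A * lam ^+ 2 * q * D by ring.
  by rewrite ler_pM2r.
have Aql : 1 <= A * q * lam.
  rewrite -(ler_pM2r lam0) mul1r; apply: le_trans (le_trans lamD C1) _.
  by rewrite expr2 le_eqVlt; apply/orP; left; apply/eqP; ring.
have Aq0 : 0 < A * q by rewrite mulr_gt0.
apply: le_trans (_ : A * q * D * lam ^+ (l - j) <= _).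
  by rewrite ler_pM2r ?lamX0.
have jE : j = (j - 2).+2 by move: j0 j1; clear; lia.
have := exprn_ege1 (j - 2) Aql; rewrite exprMn => le1.
apply: le_trans (_ : A * q * D * lam ^+ (l - j) * ((A * q) ^+ (j - 2) * lam ^+ (j - 2)) <= _).
  by rewrite ler_peMr // ltW // mulr_gt0 // mulr_gt0.
have -> : A * q * D * lam ^+ (l - j) * ((A * q) ^+ (j - 2) * lam ^+ (j - 2)) =
   (A * q) ^+ (j - 2).+1 * D * (lam ^+ (l - j) * lam ^+ (j - 2)).
  by rewrite exprS; ring.
rewrite -exprD (_ : (l - j + (j - 2) = k.*2)%N); last first.
  by move: jl jE; rewrite /l; clear; lia.
have -> : j.-1 = (j - 2).+1 by move: jE; clear; lia.
have -> : (A * q) ^+ (j - 2).+1 * D * lam ^+ k.*2 =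
          A ^+ (j - 2).+1 * (M * q ^+ (j - 2).+1) by rewrite ME exprMn; ring.
rewrite -[leRHS]mulrA ler_pM2r ?mulr_gt0 ?exprn_gt0 // AlA //.
by move: jl jE; clear; lia.
Qed.

(** A closed walk repeats a source, repeats a colour, or contains a member of [G]. By [C3] the first
    two kinds take at most half of the trace, and a member [E] accounts for at most a constant times
    [M * q^(|E|-1)]. *)
Lemma graph_cover :
  \tr (B ^+ l) / 2 <= (2 * l + 1)%:R ^+ l * (A ^+ l * M * cost q G).
Proof.
have A0 : 0 < A by apply: lt_le_trans A1.
have M0 : 0 < M by rewrite ME mulr_gt0.
(* A set of more than [l] edges lies in no closed walk of length [l]. *)
pose G' := [seq E : {set Om} <- G | (#|E| <= l)%N].
have trE : \tr (B ^+ l) = \sum_u \sum_(t <- allsq (enum Dt) l)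
    [&& walk u t u & all (mem good) t]%:R.
  rewrite /mxtrace; apply: eq_bigr => u _; rewrite -prod_nseq -walk_sum size_nseq.
  rewrite big_seq [RHS]big_seq; apply: eq_bigr => t; rewrite mem_allsq => /andP[/eqP tl _].
  case: (boolP (all _ t)) => tg; rewrite ?andbT ?andbF; first by rewrite wt_good // mul1r.
  rewrite [wt _ _](_ : _ = 0) ?mul0r //.
  elim: t (l) tl tg => [|d t IHt] n //= <- /=; rewrite negb_and => /orP[/negbTE dg|tg].
    by rewrite /goodW dg mul0r.
  by rewrite IHt ?mulr0.
have ptw u t : size t = l -> [&& walk u t u & all (mem good) t]%:R <=
    [&& walk u t u, all (mem good) t & ~~ uniq (map src t)]%:R +
    [&& walk u t u, all (mem good) t & ~~ uniq (map col t)]%:R +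
    \sum_(E <- G') [&& walk u t u, all (mem good) t,
     uniq (map edge t) & E \subset [set e in map edge t]]%:R :> R.
  move=> tl; case: (boolP (walk u t u)) => w1 /=; last first.
    by rewrite !add0r sumr_ge0.
  case: (boolP (all _ t)) => tg /=; last by rewrite !add0r sumr_ge0.
  case: (boolP (uniq (map src t))) => us /=; last first.
    by rewrite -addrA lerDl addr_ge0 ?ler0n ?sumr_ge0.
  case: (boolP (uniq (map col t))) => uc /=; last first.
    by rewrite add0r lerDl sumr_ge0.
  have [E EG Et] := Gcov tl w1 tg us uc.
  have EG' : E \in G'.
    rewrite mem_filter EG andbT; apply: leq_trans (subset_leq_card Et) _.
    by rewrite cardsE (leq_trans (card_size _)) // size_map tl.
  have ue : uniq (map edge t).
    elim: t uc {w1 tg us tl Et} => //= d t IHt /andP[dt /IHt ->]; rewrite andbT.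
    apply: contra dt => /mapP[d' d't /col_edge ->]; exact: map_f.
  by rewrite !add0r (big_rem E) //= ue Et lerDl sumr_ge0.
have S0 : 0 <= #|good|%:R :> R by rewrite ler0n.
have c1 := @not_uniq_count _ src l (F0 * M * #|good|%:R).
have c2 := @not_uniq_count _ col l (F0 * lam ^+ k.*2 * (N * #|good|%:R)).
have Z1 : 0 <= F0 * M * #|good|%:R by exact: mulr_ge0 (mulr_ge0 F0_ge0 (ltW M0)) S0.
have Z2 : 0 <= F0 * lam ^+ k.*2 * (N * #|good|%:R).
  exact: mulr_ge0 (mulr_ge0 F0_ge0 (ltW (lamX0 _))) (mulr_ge0 N0 S0).
have c3 : \sum_(E <- G') \sum_u \sum_(t <- allsq (enum Dt) l) [&& walk u t u,
     all (mem good) t, uniq (map edge t) & E \subset [set e in map edge t]]%:R <=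
     (2 * l + 1)%:R ^+ l * (A ^+ l * M * cost q G).
  rewrite /cost !mulr_sumr.
  apply: le_trans (_ : \sum_(E <- G') (2 * l + 1)%:R ^+ l * (A ^+ l * M * q ^+ #|E|.-1) <= _).
    rewrite big_seq [leRHS]big_seq; apply: ler_sum => E.
    rewrite mem_filter => /andP[El EG].
    have E0 : (0 < #|E|)%N by rewrite card_gt0; apply: contraNneq G0 => <-.
    apply: le_trans (cover_count E0 El) _.
    by apply: ler_wpM2l; rewrite ?exprn_ge0 // bnd_le // E0.
  rewrite big_filter [leRHS](bigID (fun E : {set Om} => #|E| <= l)%N) /= lerDl.
  apply: sumr_ge0 => E _.
  apply: mulr_ge0; first exact: exprn_ge0 (ler0n _ _).
  exact: mulr_ge0 (mulr_ge0 (exprn_ge0 _ (ltW A0)) (ltW M0)) (exprn_ge0 _ (ltW q0)).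
have trle : \tr (B ^+ l) <= l%:R ^+ 2 * (F0 * M * #|good|%:R) +
  l%:R ^+ 2 * (F0 * lam ^+ k.*2 * (N * #|good|%:R)) +
  (2 * l + 1)%:R ^+ l * (A ^+ l * M * cost q G).
  rewrite trE; apply: le_trans (lerD (lerD (c1 _ Z1) (c2 _ Z2)) c3).
  - move: ptw; move: (l) => L ptw.
    rewrite [X in _ + X]exchange_big /= -!big_split /=; apply: ler_sum => u _.
    rewrite [X in _ + X]exchange_big /= -!big_split /=.
    rewrite big_seq [leRHS]big_seq; apply: ler_sum => t.
    by rewrite mem_allsq => /andP[/eqP tl _]; apply: ptw.
  - by move=> b bl; rewrite /l !subSS; apply: rep_src_le.
  - by move=> b bl; rewrite /l !subSS; apply: rep_col_le.
by apply: le_half; apply: le_trans trle (lerD C3 (lexx _)).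
Qed.

End Cover.
End Bounds.
End Walks.

(** * Regularization of systems of triples *)

Section Fibers.
Variables (Om : finType).
Implicit Types (K : {set Om}).

Definition fib (S : finType) (f : Om -> S) K (s : S) : nat :=
  #|[set e in K | f e == s]|.

Lemma fib_sub (S : finType) (f : Om -> S) K K' s :
  K' \subset K -> (fib f K' s <= fib f K s)%N.
Proof.
move=> K'K; apply: subset_leq_card; apply/subsetP => e.
by rewrite !inE => /andP[/(subsetP K'K) -> ->].
Qed.

Lemma sum_fib (S : finType) (f : Om -> S) K :
  #|K| = (\sum_(s in f @: K) fib f K s)%N.
Proof.
rewrite -sum1_card (partition_big_imset f) /=; apply: eq_bigr => s _.
by rewrite /fib -sum1_card; apply: eq_bigl => e; rewrite inE.
Qed.

(* Keep the most popular dyadic range of fibre sizes. *)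
Lemma dyadic (S : finType) (f : Om -> S) K w : (#|K| < 2 ^ w)%N ->
  exists K', [/\ K' \subset K, (#|K| <= w * #|K'|)%N &
    forall s, (fib f K' s * #|f @: K'| <= 2 * #|K'|)%N].
Proof.
move=> Kw.
have [->|/card_gt0P[e0 e0K]] := posnP #|K|.
  exists set0; rewrite sub0set cards0; split=> // s.
  by rewrite imset0 cards0 muln0.
have w0 : (0 < w)%N.
  case: w Kw => //; rewrite expn0 ltnS leqn0 => /eqP/cards0_eq K0.
  by rewrite K0 inE in e0K.
have [w' wE] : exists w', w = w'.+1 by exists w.-1; rewrite prednK.
subst w; pose lev e := trunc_log 2 (fib f K (f e)).
pose Ki (i : 'I_w'.+1) := [set e in K | lev e == i].
have levw e : e \in K -> (lev e < w'.+1)%N.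
  move=> eK; have fe0 : (0 < fib f K (f e))%N.
    by apply/card_gt0P; exists e; rewrite inE eK eqxx.
  rewrite -(ltn_exp2l _ _ (isT : 1 < 2)%N); apply: leq_ltn_trans Kw.
  apply: leq_trans (trunc_logP _ fe0) _ => //.
  by apply: subset_leq_card; apply/subsetP => e'; rewrite inE => /andP[].
have KE : #|K| = (\sum_(i < w'.+1) #|Ki i|)%N.
  rewrite -sum1_card (partition_big (fun e => inord (lev e) : 'I_w'.+1) xpredT) //=.
  apply: eq_bigr => i _; rewrite -sum1_card; apply: eq_bigl => e.
  rewrite !inE; case: (boolP (e \in K)) => //= eK.
  by rewrite -val_eqE /= inordK ?levw.
have [i _ imax] := @arg_maxnP _ (Ordinal w0) xpredT (fun i => #|Ki i|) isT.
have fibE e : e \in Ki i -> fib f (Ki i) (f e) = fib f K (f e).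
  rewrite inE => /andP[eK /eqP le]; apply: eq_card => e'; rewrite !inE.
  case: (boolP (e' \in K)) => //= e'K; case: (eqVneq (f e') (f e)) => [fe|_]; rewrite ?andbF //.
  by rewrite andbT /lev fe -/(lev e) le eqxx.
exists (Ki i); split.
- by apply/subsetP => e; rewrite inE => /andP[].
- rewrite KE; apply: leq_trans (_ : \sum_(j < w'.+1) #|Ki i| <= _)%N.
    by apply: leq_sum => j _; apply: imax.
  by rewrite sum_nat_const card_ord.
- move=> s; have [sK|sK] := boolP (s \in f @: Ki i); last first.
    rewrite (_ : fib f (Ki i) s = 0%N) ?mul0n //; apply/eqP; rewrite cards_eq0 -subset0.
    apply/subsetP => e; rewrite inE => /andP[eK /eqP fe].
    by move: sK; rewrite -fe imset_f.
  have low s' : s' \in f @: Ki i -> (2 ^ i <= fib f (Ki i) s' < 2 ^ i.+1)%N.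
    move=> /imsetP[e eK ->]; rewrite fibE //.
    have : (0 < fib f K (f e))%N.
      by apply/card_gt0P; exists e; move: eK; rewrite !inE eqxx => /andP[->].
    move: eK; rewrite inE => /andP[eK /eqP <-] f0.
    exact: trunc_log_bounds.
  have /andP[_ up] := low s sK.
  apply: leq_trans (_ : 2 ^ i.+1 * #|f @: Ki i| <= _)%N.
    by rewrite leq_mul2r ltnW ?orbT.
  rewrite expnS -mulnA leq_mul2l /= (sum_fib f (Ki i)) mulnC -sum_nat_const.
  by apply: leq_sum => s' /low/andP[].
Qed.

(* Count pairs (e, e') with p2 e = p2 e': Cauchy-Schwarz bounds them from below,
   and each fibre of p1 contributes at most one pair for every e' with the same
   value of rho. *)
Lemma codeg_product (S1 S2 T : finType) (p1 : Om -> S1) (p2 : Om -> S2)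
    (rho : Om -> T) K (D1 D2 Dr X : nat) :
  {in K &, forall e e', p1 e = p1 e' -> p2 e = p2 e' -> e = e'} ->
  {in K &, forall e e', p1 e = p1 e' -> rho e = rho e'} ->
  {in K &, forall e e', p2 e = p2 e' -> rho e = rho e'} ->
  (forall s, fib rho K s <= Dr)%N ->
  (D1 * #|p1 @: K| <= X)%N -> (D2 * #|p2 @: K| <= X)%N ->
  (D1 * D2 * #|K| ^ 2 <= X ^ 2 * Dr)%N.
Proof.
move=> inj r1 r2 Hr H1 H2.
have low : (#|K| ^ 2 <= #|p2 @: K| * \sum_(e in K) fib p2 K (p2 e))%N.
  have -> : (\sum_(e in K) fib p2 K (p2 e) = \sum_(s in p2 @: K) fib p2 K s ^ 2)%N.
    rewrite (partition_big_imset p2) /=; apply: eq_bigr => s _.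
    rewrite -mulnn {1}/fib -sum_nat_const; apply: eq_big => [e|e /andP[_ /eqP ->]] //.
    by rewrite inE.
  pose a (s : S2) : rat := (s \in p2 @: K)%:R.
  pose b (s : S2) : rat := a s * (fib p2 K s)%:R.
  have := cauchy_schwarz a b; rewrite -(ler_nat rat) natrM natrX natr_sum.
  have -> : \sum_i a i ^+ 2 = #|p2 @: K|%:R.
    rewrite -sum1_card natr_sum [RHS]big_mkcond; apply: eq_bigr => s _.
    by rewrite /a; case: ifP => _; rewrite ?expr1n ?expr0n.
  have -> : \sum_i a i * b i = #|K|%:R.
    rewrite (sum_fib p2) natr_sum [RHS]big_mkcond; apply: eq_bigr => s _.
    by rewrite /b /a; case: ifP => _; rewrite ?mul1r ?mul0r.
  have -> // : \sum_i b i ^+ 2 = \sum_(s in p2 @: K) (fib p2 K s ^ 2)%:R.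
  rewrite [RHS]big_mkcond; apply: eq_bigr => s _.
  by rewrite /b /a; case: ifP => _; rewrite ?mul1r ?mul0r ?expr0n // natrX.
have up : (\sum_(e in K) fib p2 K (p2 e) <= #|p1 @: K| * Dr)%N.
  rewrite (partition_big_imset p1) /= -sum_nat_const; apply: leq_sum => s.
  move=> /imsetP[e0 e0K ->]; apply: leq_trans (Hr (rho e0)).
  rewrite /fib; under eq_bigr do rewrite -sum1_card.
  rewrite (exchange_big_dep (mem [set e in K | rho e == rho e0])) /=; last first.
    move=> e e' /andP[eK /eqP p1e]; rewrite !inE => /andP[e'K /eqP p2e].
    by rewrite e'K (r2 _ _ e'K eK p2e) (r1 _ _ eK e0K p1e) eqxx.
  rewrite -sum1_card; apply: leq_sum => e'; rewrite inE => /andP[e'K _].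
  rewrite sum1dep_card; apply/card_le1_eqP => e1 e2; rewrite !inE.
  move=> /andP[/andP[e1K /eqP q1] /andP[_ /eqP q1']].
  move=> /andP[/andP[e2K /eqP q2] /andP[_ /eqP q2']].
  by apply: inj => //; rewrite ?q1 ?q2 // -q1' -q2'.
apply: leq_trans (_ : D1 * D2 * (#|p2 @: K| * (#|p1 @: K| * Dr)) <= _)%N.
  by rewrite leq_mul2l (leq_trans low) ?orbT // leq_mul2l up orbT.
rewrite -mulnn !mulnA leq_mul2r; apply/orP; right.
have := leq_mul H1 H2; nia.
Qed.

End Fibers.

(** * A lower bound for the number of closed walks *)

Lemma le_mean (R : realFieldType) (a b c : R) :
  0 <= a -> 0 <= b -> 0 <= c -> a ^+ 2 <= b * c -> a <= (b + c) / 2.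
Proof.
move=> a0 b0 c0 h; have bc0 : 0 <= (b + c) / 2 by lra.
rewrite -(@ler_pXn2r _ 2) ?nnegrE //; apply: le_trans h _.
by have := sqr_ge0 (b - c); rewrite !expr2; nra.
Qed.

Section Powers.
Variables (R : realFieldType) (v : nat).
Implicit Types (A B : 'M[R]_v.+1).

Lemma expmx_le A B g : (forall u w, 0 <= A u w <= B u w) ->
  forall u w, (A ^+ g) u w <= (B ^+ g) u w.
Proof.
move=> AB; elim: g => [|g IHg] u w; first by rewrite !expr0.
rewrite !exprS !mulE; apply: ler_sum => z _; have /andP[A0 AB'] := AB u z.
by apply: ler_pM => //; apply: expmx_ge0 => a b; case/andP: (AB a b).
Qed.

Lemma expmx_degree B D Delta g : (forall u w, 0 <= B u w <= D) -> 0 <= D ->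
  (forall u, \sum_w B u w <= Delta) ->
  forall u w, (B ^+ g.+1) u w <= D * Delta ^+ g.
Proof.
move=> BD D0 deg; elim: g => [|g IHg] u w.
  by rewrite expr1 expr0 mulr1; case/andP: (BD u w).
have De0 : 0 <= Delta.
  by apply: le_trans (deg u); apply: sumr_ge0 => z _; case/andP: (BD u z).
rewrite exprS mulE; apply: le_trans (_ : \sum_z B u z * (D * Delta ^+ g) <= _).
  by apply: ler_sum => z _; apply: ler_wpM2l; [case/andP: (BD u z)|].
rewrite -mulr_suml exprS [leRHS]mulrCA; apply: ler_wpM2r => //.
by rewrite mulr_ge0 ?exprn_ge0.
Qed.

(** Sidorenko's inequality for even cycles. The numbers [p i] of walks of length [2i] with both ends
    in [U] are log-convex, [p 0 = |U|], and [p 1 >= S^2 / |U'|] since steps from [U] end in [U'];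
    hence [p (k+1) >= p(1)^(k+1) / p(0)^k]. Conversely an entry of an even power is at most the mean
    of two diagonal ones, so [p (k+1)] is at most [|U|] times the trace. *)
Lemma trace_lower B (U U' : {set 'I_v.+1}) k S : (forall u w, 0 <= B u w) ->
  (forall u w, B u w = B w u) -> (0 < #|U|)%N ->
  (forall u w, u \in U -> w \notin U' -> B u w = 0) ->
  S = \sum_(u in U) \sum_w B u w ->
  (S ^+ 2) ^+ k.+1 <= (#|U|%:R * #|U'|%:R) ^+ k.+1 * \tr (B ^+ k.+1.*2).
Proof.
move=> B0 Bs U0 BU SE.
pose h g w := \sum_(u in U) (B ^+ g) u w.
pose m i := \sum_w h i w ^+ 2.
have hdot a b : \sum_w h a w * h b w = \sum_(u in U) \sum_(u' in U) (B ^+ (a + b)) u u'.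
  under eq_bigr do rewrite /h big_distrlr /=.
  rewrite exchange_big; apply: eq_bigr => u _ /=.
  rewrite exchange_big; apply: eq_bigr => u' _ /=.
  rewrite exprD mulE; apply: eq_bigr => w _; congr (_ * _).
  exact: sym_expmx.
pose p i := \sum_(u in U) \sum_(u' in U) (B ^+ i.*2) u u'.
have mE i : m i = p i.
  by rewrite /m; under eq_bigr do rewrite expr2; rewrite hdot addnn.
have pcs i : p i.+1 ^+ 2 <= p i * p i.+2.
  have := cauchy_schwarz (h i) (h i.+2).
  rewrite hdot (_ : (i + i.+2 = i.+1.*2)%N); last by rewrite !addnS addnn.
  by rewrite -/(p i.+1) -/(m i) -/(m i.+2) !mE.
have p0 : p 0%N = #|U|%:R.
  rewrite /p -sum1_card natr_sum; apply: eq_bigr => u uU.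
  rewrite (bigD1 u) //= expr0 mxE eqxx big1 ?addr0 // => u' /andP[_ /negbTE uu'].
  by rewrite mxE eq_sym uu'.
have p1 : S ^+ 2 <= #|U'|%:R * p 1%N.
  rewrite -mE /m.
  have -> : S = \sum_w (w \in U')%:R * h 1%N w.
    rewrite SE exchange_big; apply: eq_bigr => w _ /=; rewrite /h expr1.
    case: (boolP (w \in U')) => wU; rewrite ?mul1r // mul0r big1 // => u uU.
    exact: BU.
  have := cauchy_schwarz (fun w => (w \in U')%:R : R) (h 1%N).
  rewrite [X in _ <= X * _ -> _](_ : _ = #|U'|%:R) // -sum1_card natr_sum.
  rewrite [RHS]big_mkcond; apply: eq_bigr => w _; case: ifP => _.
    by rewrite expr1n.
  by rewrite expr0n.
have pge0 i : 0 <= p i by rewrite -mE; apply: sumr_ge0 => w _; apply: sqr_ge0.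
have trk : p k.+1 <= #|U|%:R * \tr (B ^+ k.+1.*2).
  have Bk u u' : (B ^+ k.+1.*2) u u' <=
      ((B ^+ k.+1.*2) u u + (B ^+ k.+1.*2) u' u') / 2.
    have Bg g a b : 0 <= (B ^+ g) a b by apply: expmx_ge0.
    have := expmx_cs k.+1 k.+1 u u' Bs; rewrite addnn.
    exact: le_mean.
  have Bd u : 0 <= (B ^+ k.+1.*2) u u by apply: expmx_ge0.
  apply: le_trans (_ : \sum_(u in U) \sum_(u' in U) ((B ^+ k.+1.*2) u u + (B ^+ k.+1.*2) u' u') / 2 <= _).
    by apply: ler_sum => u _; apply: ler_sum => u' _.
  have -> : \sum_(u in U) \sum_(u' in U) ((B ^+ k.+1.*2) u u + (B ^+ k.+1.*2) u' u') / 2 =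
     #|U|%:R * \sum_(u in U) (B ^+ k.+1.*2) u u.
    pose T := \sum_(u in U) (B ^+ k.+1.*2) u u; have half u :
        \sum_(u' in U) ((B ^+ k.+1.*2) u u + (B ^+ k.+1.*2) u' u') / 2 =
        (#|U|%:R * (B ^+ k.+1.*2) u u + T) / 2.
      by rewrite -mulr_suml big_split /= sumr_const -/T -[_ *+ #|U|]mulr_natl.
    under eq_bigr do rewrite half.
    rewrite -mulr_suml big_split /= sumr_const -[_ *+ #|U|]mulr_natl -mulr_sumr -/T.
    by field.
  apply: ler_wpM2l => //; rewrite /mxtrace [leRHS](bigID (mem U)) /= lerDl.
  exact: sumr_ge0.
have U0' : 0 < #|U|%:R :> R by rewrite ltr0n.
have [p10|p10] := ler0P (p 1%N).
  have S0 : S ^+ 2 <= 0.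
    by apply: le_trans p1 _; rewrite mulr_ge0_le0.
  have -> : S ^+ 2 = 0 by apply/le_anti; rewrite S0 sqr_ge0.
  rewrite expr0n /= mulr_ge0 ?exprn_ge0 ?mulr_ge0 //.
  by apply: sumr_ge0 => u _; apply: expmx_ge0.
have step i : 0 < p i.+1 /\ p i * p 1%N <= p i.+1 * p 0%N.
  elim: i => [|i [pi pi1]]; first by rewrite mulrC.
  have pi0 : 0 < p i.
    rewrite lt_neqAle pge0 andbT; apply/eqP => pi0.
    by have := pcs i; rewrite -pi0 mul0r leNgt exprn_gt0.
  have h1 : p i.+1 * p 1%N <= p i.+2 * p 0%N.
    rewrite -(ler_pM2l pi0) -(ler_pM2l pi).
    have := ler_wpM2l (ltW pi) (ler_wpM2r (pge0 0%N) (pcs i)).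
    have := ler_wpM2l (mulr_ge0 (ltW pi) (ltW pi)) pi1.
    move: (p i) (p i.+1) (p i.+2) (p 1%N) (p 0%N) => a b c d e; clear; nra.
  split=> //; rewrite lt_neqAle pge0 andbT; apply/eqP => p2.
  by move: h1; rewrite -p2 mul0r leNgt mulr_gt0.
have pk i : p 1%N ^+ i.+1 <= p 0%N ^+ i * p i.+1.
  elim: i => [|i IHi]; first by rewrite expr1 expr0 mul1r.
  have [_ h1] := step i.+1.
  rewrite exprSr; apply: le_trans (ler_wpM2r (ltW p10) IHi) _.
  by rewrite -mulrA exprSr -mulrA ler_wpM2l ?exprn_ge0 // [_ 0%N * _]mulrC.
apply: le_trans (_ : (#|U'|%:R * p 1%N) ^+ k.+1 <= _).
  by apply: lerXn2r => //; rewrite nnegrE ?sqr_ge0 // mulr_ge0.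
rewrite !exprMn [_ ^+ k.+1 * #|U'|%:R ^+ _]mulrC -mulrA.
apply: ler_wpM2l; first by rewrite exprn_ge0.
apply: le_trans (pk k) _; rewrite p0 exprSr -mulrA.
by apply: ler_wpM2l; rewrite ?exprn_ge0.
Qed.

End Powers.

(** * The bipartite multigraph of a set of triples *)

Section Triples.
Variables (R : realFieldType) (Om X Y Z : finType).
Variables (x : Om -> X) (y : Om -> Y) (z : Om -> Z).
Implicit Types (K E : {set Om}) (d : Om * bool).

(** Square matrices form a ring in positive dimension, hence one spare index beyond the vertices of
    [Y + Z]. *)
Definition vtx (t : Y + Z) : 'I_#|{: Y + Z}|.+1 := widen_ord (leqnSn _) (enum_rank t).
Definition srcT d : Y + Z := if d.2 then inr (z d.1) else inl (y d.1).
Definition tgtT d : Y + Z := if d.2 then inl (y d.1) else inr (z d.1).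
Definition src d := vtx (srcT d).
Definition tgt d := vtx (tgtT d).
(** Every triple contributes both orientations, which makes the adjacency matrix symmetric. *)
Definition darts K : {set Om * bool} := [set d : Om * bool | d.1 \in K].
Definition adj K : 'M[R]_(#|{: Y + Z}|.+1) := mat src tgt (goodW R (darts K)).

Lemma vtx_inj : injective vtx.
Proof. by move=> a b /(congr1 val) /= /val_inj/enum_rank_inj. Qed.

Lemma no_loop d : src d != tgt d.
Proof. by rewrite /src /tgt (inj_eq vtx_inj); case: d => e []. Qed.

Lemma matnE (P : pred (Om * bool)) u w :
  mat src tgt (fun d => (P d)%:R : R) u w =
  #|[set d | [&& P d, src d == u & tgt d == w]]|%:R.
Proof.
rewrite matE -sum1_card natr_sum [RHS]big_mkcond; apply: eq_bigr => d _ /=.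
by rewrite inE; case: (P d); rewrite ?mul0r // mul1r /=; case: andP.
Qed.

Lemma matn_row (P : pred (Om * bool)) u :
  \sum_w mat src tgt (fun d => (P d)%:R : R) u w =
  #|[set d | P d && (src d == u)]|%:R.
Proof.
under eq_bigr do rewrite matnE.
rewrite -natr_sum -[in RHS]sum1_card (partition_big tgt xpredT) //=.
congr _%:R; apply: eq_bigr => w _; rewrite -sum1_card.
by apply: eq_bigl => d; rewrite !inE andbA.
Qed.

Lemma matn_sym (P : pred (Om * bool)) : (forall e b, P (e, b) = P (e, ~~ b)) ->
  forall u w, mat src tgt (fun d => (P d)%:R : R) u w =
              mat src tgt (fun d => (P d)%:R : R) w u.
Proof.
move=> Ps u w; rewrite !matnE; congr _%:R.
have inv : injective (fun d : Om * bool => (d.1, ~~ d.2)).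
  by move=> [e b] [e' b'] [-> /negb_inj ->].
rewrite -(card_imset _ inv); apply: eq_card => -[e b]; rewrite inE.
apply/imsetP/idP => [[[e' b']]|].
  rewrite inE => /and3P[P1 s1 t1] [-> ->] /=; rewrite -Ps P1 /=.
  by move: s1 t1; rewrite /src /tgt /srcT /tgtT /=; case: b' {P1} => /= -> ->.
move=> /and3P[P1 s1 t1]; exists (e, ~~ b); rewrite ?negbK //= inE -Ps P1 /=.
by move: s1 t1; rewrite /src /tgt /srcT /tgtT /=; case: b {P1} => /= -> ->.
Qed.

Lemma adj_sym K u w : adj K u w = adj K w u.
Proof. by apply: (matn_sym (P := mem (darts K))) => e b; rewrite /= !inE. Qed.

Lemma adj_ge0 K u w : 0 <= adj K u w.
Proof. exact: B_ge0. Qed.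

Lemma adj_le K K' u w : K' \subset K -> adj K' u w <= adj K u w.
Proof.
move=> K'K; rewrite /adj /goodW !matnE ler_nat; apply: subset_leq_card.
by apply/subsetP => d; rewrite !inE => /and3P[/(subsetP K'K) -> -> ->].
Qed.

Lemma card_darts K : #|darts K| = (2 * #|K|)%N.
Proof.
rewrite (_ : darts K = setX K setT) ?cardsX ?cardsT ?card_bool 1?mulnC //.
by apply/setP => -[e b]; rewrite !inE andbT.
Qed.

Lemma adj_codeg K D : (forall s, fib (fun e => (y e, z e)) K s <= D)%N ->
  forall u w, adj K u w <= D%:R.
Proof.
move=> KD u w; rewrite /adj /goodW matnE ler_nat.
set S := [set d | _]; have [->|/card_gt0P[[e0 b0]]] := posnP #|S|; first by [].
rewrite !inE /= => /and3P[e0K /eqP su /eqP tw].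
apply: leq_trans (KD (y e0, z e0)).
rewrite /fib -[leqRHS](card_imset _ (_ : injective (fun e => (e, b0)))); last by move=> e e' [].
apply: subset_leq_card; apply/subsetP => -[e b].
rewrite !inE /= -su -tw /src /tgt !(inj_eq vtx_inj) /srcT /tgtT /=.
move=> /and3P[eK h1 h2]; apply/imsetP; exists e.
  rewrite inE eK xpair_eqE /=; move: h1 h2.
  by case: b; case: b0 {su tw} => //= /eqP[->] /eqP[->]; rewrite !eqxx.
by congr pair; clear su tw h2; move: h1; case: b; case: b0.
Qed.

Lemma row_le (P : pred (Om * bool)) N :
  (forall b, #|[set e | P (e, false) && (y e == b)]| <= N)%N ->
  (forall c, #|[set e | P (e, true) && (z e == c)]| <= N)%N ->
  forall u, \sum_w mat src tgt (fun d => (P d)%:R : R) u w <= N%:R.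
Proof.
move=> Py Pz u; rewrite matn_row ler_nat.
set S := [set d | _]; have [->|/card_gt0P[[e0 b0]]] := posnP #|S|; first by [].
rewrite inE /= => /andP[P0 /eqP su].
have pinj : injective (fun e : Om => (e, b0)) by move=> e e' [].
case: b0 P0 su pinj => P0 su pinj.
  apply: leq_trans (Pz (z e0)); rewrite -(card_imset _ pinj).
  apply: subset_leq_card; apply/subsetP => -[e b].
  rewrite inE -su /src (inj_eq vtx_inj) /srcT /= => /andP[Pe h].
  apply/imsetP; exists e; case: b Pe h => // Pe /eqP[ze].
  by rewrite inE Pe ze eqxx.
apply: leq_trans (Py (y e0)); rewrite -(card_imset _ pinj).
apply: subset_leq_card; apply/subsetP => -[e b].
rewrite inE -su /src (inj_eq vtx_inj) /srcT /= => /andP[Pe h].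
apply/imsetP; exists e; case: b Pe h => // Pe /eqP[ze].
by rewrite inE Pe ze eqxx.
Qed.

Lemma adj_deg K N : (forall s, fib y K s <= N)%N -> (forall s, fib z K s <= N)%N ->
  forall u, \sum_w adj K u w <= N%:R.
Proof.
move=> Ky Kz; apply: row_le => s.
  by apply: leq_trans (Ky s); apply: subset_leq_card; apply/subsetP => e; rewrite !inE.
by apply: leq_trans (Kz s); apply: subset_leq_card; apply/subsetP => e; rewrite !inE.
Qed.

Lemma color_deg K N : (forall s, fib (fun e => (x e, y e)) K s <= N)%N ->
  (forall s, fib (fun e => (x e, z e)) K s <= N)%N ->
  forall a u, \sum_w mat src tgt (ind R (darts K) (fun d => x d.1) a) u w <= N%:R.
Proof.
move=> Ky Kz a; apply: row_le => s.
  apply: leq_trans (Ky (a, s)); apply: subset_leq_card; apply/subsetP => e.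
  by rewrite !inE xpair_eqE andbA.
apply: leq_trans (Kz (a, s)); apply: subset_leq_card; apply/subsetP => e.
by rewrite !inE xpair_eqE andbA.
Qed.

Lemma color_sym K a u w : mat src tgt (ind R (darts K) (fun d => x d.1) a) u w =
  mat src tgt (ind R (darts K) (fun d => x d.1) a) w u.
Proof.
by apply: (matn_sym (P := fun d => (d \in darts K) && (x d.1 == a))) => e b;
  rewrite !inE.
Qed.

Lemma adj_trace_lower K k : K != set0 ->
  ((#|K|%:R : R) ^+ 2) ^+ k.+1 <=
  (#|y @: K|%:R * #|z @: K|%:R) ^+ k.+1 * \tr (adj K ^+ k.+1.*2).
Proof.
move=> K0.
pose U := [set vtx (inl b) | b in y @: K]; pose U' := [set vtx (inr c) | c in z @: K].
have Ui : injective (fun b : Y => vtx (inl b)) by move=> b b' /vtx_inj [].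
have Ui' : injective (fun b : Z => vtx (inr b)) by move=> b b' /vtx_inj [].
rewrite -(card_imset _ Ui) -(card_imset (z @: K) Ui') -/U -/U'.
apply: trace_lower => [u w|u w||u w /imsetP[b bK ->] wU|].
- exact: adj_ge0.
- exact: adj_sym.
- by rewrite (card_imset _ Ui) card_gt0; apply: contraNneq K0 => /eqP;
    rewrite imset_eq0.
- rewrite /adj /goodW matnE (_ : #|_| = 0%N) //; apply/eqP; rewrite cards_eq0 -subset0.
  apply/subsetP => -[e c]; rewrite !inE /= /src /tgt (inj_eq vtx_inj) /srcT /tgtT /=.
  case: c => /=; first by rewrite andbF.
  move=> /and3P[eK _ /eqP tw]; move: wU; rewrite -tw => /imsetP[].
  by exists (z e) => //; apply: imset_f.
- rewrite (big_imset _ (in2W Ui)) /= (sum_fib y) natr_sum; apply: eq_bigr => b _.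
  rewrite /adj /goodW (matn_row (mem (darts K))); congr _%:R.
  rewrite /fib -(card_imset _ (_ : injective (fun e => (e, false)))); last by move=> e e' [].
  apply: eq_card => -[e c]; rewrite [RHS]inE /= /src (inj_eq vtx_inj) /srcT inE.
  apply/imsetP/andP => [[e']|]; first by rewrite inE => /andP[e'K /eqP <-] [-> ->] /=; rewrite e'K eqxx.
  case: c => /= [[_ /eqP]|[eK /eqP[ye]]] //.
  by exists e => //; rewrite inE eK ye eqxx.
Qed.

(** Running back and forth along the edge of [d] is already one such walk. *)
Lemma adj_back K d i : d \in darts K -> 1 <= (adj K ^+ i.*2.+1) (tgt d) (src d).
Proof.
move=> dK.
have b1 : 1 <= adj K (src d) (tgt d).
  rewrite /adj /goodW matnE ler1n; apply/card_gt0P; exists d.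
  by rewrite !inE !eqxx; move: dK; rewrite inE => ->.
have b2 : 1 <= adj K (tgt d) (src d) by rewrite adj_sym.
elim: i => [|i IHi]; first by rewrite expr1.
rewrite doubleS 2!exprS mulE (bigD1 (src d)) //=.
rewrite -[leLHS]addr0 lerD //; last first.
  apply: sumr_ge0 => u _; rewrite mulr_ge0 ?adj_ge0 //.
  by apply: mulmx_ge0 => *; rewrite ?adj_ge0 //; apply: expmx_ge0 => *; apply: adj_ge0.
rewrite -[leLHS]mulr1 ler_pM // mulE (bigD1 (tgt d)) //=.
rewrite -[leLHS]addr0 lerD //; last first.
  apply: sumr_ge0 => u _; rewrite mulr_ge0 ?adj_ge0 //.
  by apply: expmx_ge0 => *; apply: adj_ge0.
by rewrite -[leLHS]mulr1 ler_pM.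
Qed.

Lemma adj_trace K g :
  \tr (adj K ^+ g.+1) = \sum_(d in darts K) (adj K ^+ g) (tgt d) (src d).
Proof.
rewrite /mxtrace exprS; under eq_bigr do rewrite {1}/adj mat_mulE.
rewrite exchange_big [RHS]big_mkcond; apply: eq_bigr => d _ /=.
rewrite /goodW; case: (d \in darts K); last first.
  by rewrite big1 // => u _; rewrite !mul0r.
rewrite (bigD1 (src d)) //= eqxx !mul1r big1 ?addr0 // => u.
by rewrite eq_sym => /negbTE->; rewrite mulr0 mul0r.
Qed.

(* While too much weight is missing, the darts with return weight above t^j form
   less than half of K; discarding them lowers the bound by a factor t. *)
Lemma stabilize k (t : R) j K : 1 <= t ->
  {in darts K, forall d, (adj K ^+ k.*2.+1) (tgt d) (src d) <= t ^+ j} ->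
  exists K' (M : R), [/\ K' \subset K, (#|K| <= 2 ^ j * #|K'|)%N, 0 < M,
    {in darts K', forall d, (adj K' ^+ k.*2.+1) (tgt d) (src d) <= M}
    & #|K'|%:R * M <= 2 * t * \tr (adj K' ^+ k.*2.+2)].
Proof.
move=> t1; elim: j K => [|j IHj] K HK.
  exists K, 1; split; rewrite ?mul1n // mulr1 adj_trace.
  have : \sum_(d in darts K) 1 <= \sum_(d in darts K) (adj K ^+ k.*2.+1) (tgt d) (src d) :> R.
    by apply: ler_sum => d dK; apply: adj_back.
  rewrite sumr_const card_darts natrM => h.
  have K0 : 0 <= #|K|%:R :> R by [].
  apply: le_trans (_ : 2 * #|K|%:R <= _); first by rewrite mulr_natl mulr2n lerDl.
  apply: le_trans h _; rewrite ler_peMl //; last by rewrite -[leLHS]mulr1 ler_pM // ler1n.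
  by apply: sumr_ge0 => d dK; apply: le_trans (adj_back _ dK).
have t0 : 0 < t by apply: lt_le_trans t1.
have [done|bad] := lerP (#|K|%:R * t ^+ j.+1) (2 * t * \tr (adj K ^+ k.*2.+2)).
  exists K, (t ^+ j.+1); split=> //; last by rewrite exprn_gt0.
  by rewrite leq_pmull // expn_gt0.
pose W d := (adj K ^+ k.*2.+1) (tgt d) (src d).
pose K1 := [set e in K | (W (e, false) <= t ^+ j) && (W (e, true) <= t ^+ j)].
have K1K : K1 \subset K by apply/subsetP => e; rewrite inE => /andP[].
have rem : (2 * #|K :\: K1| <= #|K|)%N.
  have W0 d : 0 <= W d by apply: expmx_ge0 => *; apply: adj_ge0.
  have h : #|K :\: K1|%:R * t ^+ j <= \tr (adj K ^+ k.*2.+2).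
    rewrite adj_trace -/W (eq_bigl (fun d => (d.1 \in K) && true)); last first.
      by move=> d; rewrite inE andbT.
    rewrite -(pair_big (mem K) xpredT (fun e b => W (e, b))) /=.
    rewrite mulr_natl -sumr_const [leRHS](big_setID K1) /= addrC.
    rewrite (setIidPr K1K) -[leLHS]addr0; apply: lerD; last first.
      by apply: sumr_ge0 => e _; apply: sumr_ge0.
    apply: ler_sum => e; rewrite !inE negb_and => /andP[h eK].
    rewrite big_bool /=; move: h; rewrite eK /= negb_and -!ltNge => /orP[h|h].
      by rewrite -[leLHS]add0r lerD // ltW.
    by rewrite -[leLHS]addr0 lerD // ltW.
  have tj : 0 < t ^+ j.+1 by rewrite exprn_gt0.
  rewrite -(ler_nat R) natrM -(ler_pM2r tj) ltW //.
  apply: le_lt_trans bad; rewrite exprS -!mulrA ler_pM2l // mulrCA ler_pM2l //.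
have {}rem : (#|K| <= 2 * #|K1|)%N.
  by move: rem; rewrite cardsD (setIidPr K1K); clear; lia.
have [d|K' [M [K'K KK' M0 HM HT]]] := IHj K1.
  move=> dK1; apply: le_trans (_ : W d <= _).
    by apply: expmx_le => u w; rewrite adj_ge0 adj_le.
  by move: dK1; case: d => e b; rewrite !inE /= => /and3P[_ h1 h2]; case: b.
exists K', M; split=> //; first exact: subset_trans K'K K1K.
by rewrite expnS -mulnA (leq_trans rem) // leq_mul2l KK' orbT.
Qed.

End Triples.

(** * Supersaturation *)

Lemma twice_le (R : realFieldType) (t : R) : 2 * t <= t / 4 * 8.
Proof. lra. Qed.

Lemma quarters_le (R : realFieldType) (t : R) : t / 4 + t / 4 <= t / 2.
Proof. lra. Qed.

(** * Comparing degrees, return weight and the scale of the weights *)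

Section Numeric.
Variables (R : realFieldType) (k : nat) (rho kap b c D M m0 N q : R).
Hypotheses (k0 : (0 < k)%N) (rho1 : 1 <= rho) (kap0 : 0 < kap).
Hypotheses (b0 : 0 < b) (c0 : 0 < c) (D0 : 0 < D) (m00 : 0 < m0) (q0 : 0 < q).
Hypotheses (M0 : 0 < M) (bN : b <= N) (cN : c <= N).
Hypothesis HT : (kap ^+ 2) ^+ k.+1 <= (b * c) ^+ k.+1 * (2 * kap * M).
Hypothesis Hm : m0 <= rho * kap * q.

Let rho0 : 0 < rho := lt_le_trans ltr01 rho1.
Let P := rho ^+ k.
Let P0 : 0 < P := exprn_gt0 k rho0.
Let B0 : 0 < b ^+ k := exprn_gt0 k b0.
Let C0 : 0 < c ^+ k := exprn_gt0 k c0.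
Let K0 : 0 < kap ^+ k := exprn_gt0 k kap0.
Let q'0 : 0 < q ^+ k := exprn_gt0 k q0.
Let m'0 : 0 < m0 ^+ k := exprn_gt0 k m00.
Let N0 : 0 < N := lt_le_trans b0 bN.
Let N'0 : 0 < N ^+ k := exprn_gt0 k N0.

Let HT' : kap * (kap ^+ k) ^+ 2 <= 2 * (b * b ^+ k * (c * c ^+ k)) * M.
Proof.
have e1 : (kap ^+ 2) ^+ k.+1 = kap * (kap * (kap ^+ k) ^+ 2).
  by rewrite exprS exprAC; ring.
have e2 : (b * c) ^+ k.+1 * (2 * kap * M) =
    kap * (2 * (b * b ^+ k * (c * c ^+ k)) * M).
  by rewrite exprS exprMn; ring.
by move: HT; rewrite e1 e2 ler_pM2l.
Qed.

Let X0 (x : R) : x ^+ k.*2 = (x ^+ k) ^+ 2.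
Proof. by rewrite -muln2 exprM. Qed.

Let X1 (x : R) : x ^+ k.*2.+1 = x * (x ^+ k) ^+ 2.
Proof. by rewrite exprS X0. Qed.

Let X2 (x : R) : x ^+ k.*2.+2 = x * (x * (x ^+ k) ^+ 2).
Proof. by rewrite exprS X1. Qed.

Let X3 (x : R) : x ^+ k.*2.+3 = x * (x * (x * (x ^+ k) ^+ 2)).
Proof. by rewrite exprS X2. Qed.

Let Hm' : m0 ^+ k <= P * kap ^+ k * q ^+ k.
Proof.
by rewrite /P -!exprMn; apply: lerXn2r Hm; rewrite nnegrE ?ltW // !mulr_gt0.
Qed.

(** Up to powers of [rho], the degrees are at most [kap / b] and [kap / c], [D] is at most the root
    of the second, and [HT] bounds [M] below by [kap^(2k+1) / (b*c)^(k+1)]. Taking the [k]-th power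
    of the claim and substituting [lam^(2k) = M / D] leaves [b^2 * c^(2k+1) <= kap * m0^(2k)], which
    follows from [b, c <= N]. *)
Lemma degree_le_scale D1 D2 lam : 0 <= D1 -> 0 < lam ->
  b * D1 <= rho * kap -> c * D2 <= rho * kap -> D ^+ 2 <= rho * D2 ->
  M = D * lam ^+ k.*2 -> N ^+ k.*2.+3 <= rho * kap * m0 ^+ k.*2 ->
  D1 <= 4 * rho ^+ 4 * lam ^+ 2 * q.
Proof.
move=> D10 lam0 HD1 HD2 HD ME HN.
have A0 : 0 < 4 * rho ^+ 4 by rewrite mulr_gt0 // exprn_gt0.
have rhs0 : 0 <= 4 * rho ^+ 4 * lam ^+ 2 * q.
  by apply: ltW; rewrite !mulr_gt0 // exprn_gt0.
rewrite -(ler_pXn2r k0) ?nnegrE //.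
have -> : (4 * rho ^+ 4 * lam ^+ 2 * q) ^+ k =
    4 ^+ k * rho ^+ 4 ^+ k * lam ^+ k.*2 * q ^+ k.
  by rewrite 3!exprMn -[lam ^+ 2 ^+ k]exprM mul2n.
have lamE : lam ^+ k.*2 = M / D by rewrite ME mulrC mulKf // gt_eqF.
rewrite lamE -(ler_pM2r D0).
have -> : 4 ^+ k * rho ^+ 4 ^+ k * (M / D) * q ^+ k * D =
          4 ^+ k * rho ^+ 4 ^+ k * M * q ^+ k.
  by field; rewrite gt_eqF.
have -> : rho ^+ 4 ^+ k = P ^+ 4 by rewrite exprAC.
set a := 4 ^+ k; set d1 := D1 ^+ k.
have a1 : 4 <= a by rewrite /a -{1}[4]expr1 ler_weXn2l ?ler1n.
have d10 : 0 <= d1 by rewrite exprn_ge0.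
have rhoP : rho <= P by rewrite /P -{1}[rho]expr1 ler_weXn2l.
have Bd : b ^+ k * d1 <= P * kap ^+ k.
  by rewrite /d1 /P -!exprMn; apply: lerXn2r HD1; rewrite nnegrE mulr_ge0 // ltW.
move: HN; rewrite X3 X0 => HN.
move: (HT') (Hm') Bd HN K0 C0 B0 q'0 m'0 P0 N'0.
set x := kap ^+ k; set y := b ^+ k; set z := c ^+ k; set m := m0 ^+ k.
set Q := q ^+ k; set n := N ^+ k => h1 h2 h3 h4 x0 z0 y0 Q0 m0' P0' n0.
(* Squaring removes the root in the bound on [D], and the factor [W] lets the squares of [HT'] and
   of the degree bounds enter without denominators. *)
pose W := 4 * (b * c * y * z) ^+ 2 * P ^+ 2.
have W0 : 0 < W.
  by rewrite /W !mulr_gt0 ?exprn_gt0 // !mulr_gt0.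
pose mid := 4 * P ^+ 4 * rho ^+ 3 * kap ^+ 2 * x ^+ 2 * m ^+ 2.
have LW : (d1 * D) ^+ 2 * W <= mid.
  have D2c : D ^+ 2 * c <= rho ^+ 2 * kap.
    apply: le_trans (_ : rho * D2 * c <= _); first by rewrite ler_pM2r.
    have -> : rho * D2 * c = rho * (c * D2) by ring.
    have -> : rho ^+ 2 * kap = rho * (rho * kap) by ring.
    by rewrite ler_pM2l.
  have yd : (y * d1) ^+ 2 <= (P * x) ^+ 2.
    by apply: lerXn2r h3; rewrite nnegrE mulr_ge0 // ltW.
  have zn : z <= n by apply: lerXn2r cN; rewrite nnegrE ltW.
  have bcz : b ^+ 2 * c * z ^+ 2 <= rho * kap * m ^+ 2.
    apply: le_trans h4.
    have -> : N * (N * (N * n ^+ 2)) = N ^+ 2 * N * n ^+ 2 by ring.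
    apply: ler_pM.
    - by apply: ltW; rewrite mulr_gt0 // exprn_gt0.
    - by apply: ltW; rewrite exprn_gt0.
    - apply: ler_pM => //; try by apply: ltW; rewrite ?exprn_gt0.
      by apply: lerXn2r bN; rewrite nnegrE ltW.
    - by apply: lerXn2r zn; rewrite nnegrE ltW.
  have -> : (d1 * D) ^+ 2 * W =
     4 * P ^+ 2 * ((D ^+ 2 * c) * (y * d1) ^+ 2 * (b ^+ 2 * c * z ^+ 2)).
    by rewrite /W; ring.
  have -> : mid = 4 * P ^+ 2 * ((rho ^+ 2 * kap) * (P * x) ^+ 2 * (rho * kap * m ^+ 2)).
    by rewrite /mid; ring.
  apply: ler_wpM2l; first by apply: ltW; rewrite mulr_gt0 // exprn_gt0.
  have p1 : 0 <= D ^+ 2 * c by apply: ltW; rewrite mulr_gt0 // exprn_gt0.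
  have p2 : 0 <= (y * d1) ^+ 2 by rewrite sqr_ge0.
  apply: ler_pM => //; first exact: mulr_ge0.
    by apply: ltW; rewrite !mulr_gt0 // exprn_gt0.
  exact: ler_pM.
have RW : mid <= (a * P ^+ 4 * M * Q) ^+ 2 * W.
  have s1 : (kap * x ^+ 2) ^+ 2 <= (2 * (b * y * (c * z)) * M) ^+ 2.
    by apply: lerXn2r h1; rewrite nnegrE ltW // ?mulr_gt0 ?exprn_gt0.
  have s2 : m ^+ 2 <= (P * x * Q) ^+ 2.
    by apply: lerXn2r h2; rewrite nnegrE ltW // !mulr_gt0.
  have x2 : 0 < x ^+ 2 by rewrite exprn_gt0.
  rewrite -(ler_pM2r x2).
  have -> : (a * P ^+ 4 * M * Q) ^+ 2 * W * x ^+ 2 =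
     (a * P ^+ 4) ^+ 2 * ((2 * (b * y * (c * z)) * M) ^+ 2 * (P * x * Q) ^+ 2).
    by rewrite /W; ring.
  have -> : mid * x ^+ 2 = (4 * (P ^+ 4 * rho ^+ 3)) * ((kap * x ^+ 2) ^+ 2 * m ^+ 2).
    by rewrite /mid; ring.
  apply: ler_pM.
  - by apply: ltW; rewrite !mulr_gt0 // exprn_gt0.
  - by rewrite mulr_ge0 // sqr_ge0.
  - have -> : (a * P ^+ 4) ^+ 2 = (a * a) * (P ^+ 4 * P ^+ 4) by ring.
    apply: ler_pM => //; first by apply: ltW; rewrite mulr_gt0 // exprn_gt0.
      by rewrite -[leLHS]mulr1 ler_pM // (le_trans _ a1) // ler1n.
    rewrite ler_pM2l ?exprn_gt0 //.
    apply: le_trans (_ : P ^+ 3 <= _).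
      by apply: lerXn2r rhoP; rewrite nnegrE ltW.
    by apply: ler_weXn2l => //; apply: le_trans rhoP.
  - by apply: ler_pM; rewrite ?sqr_ge0.
have fin := le_trans LW RW; rewrite (ler_pM2r W0) in fin.
have a0 : 0 < a by apply: lt_le_trans a1.
by rewrite -(@ler_pXn2r _ 2) ?nnegrE // ?(mulr_ge0 d10 (ltW D0)) // ltW // !mulr_gt0 // exprn_gt0.
Qed.

(** Up to powers of [rho], [HT] and [Hm] give [M * q^(2k+1) >= m0^(2k+1) / (b*c)^(k+1)], and
    [b, c <= N]. *)
Lemma one_le_return : N ^+ k.*2.+2 <= rho * m0 ^+ k.*2.+1 ->
  1 <= (4 * rho ^+ 4) ^+ k.*2.+2 * M * q ^+ k.*2.+1.
Proof.
rewrite !X2 !X1.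
have -> : (4 * rho ^+ 4) ^+ k = 4 ^+ k * P ^+ 4 by rewrite exprMn exprAC.
have rhoP : rho <= P by rewrite /P -{1}[rho]expr1 ler_weXn2l.
have a1 : 4 <= 4 ^+ k :> R by rewrite -{1}[4]expr1 ler_weXn2l ?ler1n.
move: (HT') (Hm') K0 C0 B0 q'0 m'0 P0 N'0 a1.
have cC : c ^+ k <= N ^+ k by apply: lerXn2r cN; rewrite nnegrE ltW.
have bB : b ^+ k <= N ^+ k by apply: lerXn2r bN; rewrite nnegrE ltW.
move: cC bB.
set x := kap ^+ k; set y := b ^+ k; set z := c ^+ k; set m := m0 ^+ k.
set Q := q ^+ k; set n := N ^+ k; set a := 4 ^+ k.
move=> zn yn h1 h2 x0 z0 y0 Q0 m0' P0' n0 a1 HN.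
have e1 : kap * x ^+ 2 <= 2 * M * (N * (N * n ^+ 2)).
  apply: le_trans h1 _.
  have -> : 2 * (b * y * (c * z)) * M = 2 * M * ((b * c) * (y * z)) by ring.
  have -> : N * (N * n ^+ 2) = (N * N) * (n * n) by ring.
  apply: ler_wpM2l; first by rewrite mulr_ge0 // ltW.
  apply: ler_pM; try by apply: ltW; rewrite mulr_gt0.
    by apply: ler_pM => //; apply: ltW.
  by apply: ler_pM => //; apply: ltW.
have e2 : m0 * m ^+ 2 <= rho * kap * q * (P * x * Q) ^+ 2.
  apply: ler_pM => //; rewrite ?sqr_ge0 //; first exact: ltW.
  by apply: lerXn2r h2; rewrite nnegrE ltW // !mulr_gt0.
pose T := N * (N * n ^+ 2).
have T0 : 0 < T by rewrite /T !mulr_gt0 // exprn_gt0.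
have e3 : T <= 2 * rho ^+ 2 * P ^+ 2 * (M * (q * Q ^+ 2)) * T.
  apply: le_trans HN _; apply: le_trans (_ : rho * (rho * kap * q * (P * x * Q) ^+ 2) <= _).
    by rewrite ler_pM2l.
  have -> : rho * (rho * kap * q * (P * x * Q) ^+ 2) =
    rho ^+ 2 * P ^+ 2 * (q * Q ^+ 2) * (kap * x ^+ 2) by ring.
  have -> : 2 * rho ^+ 2 * P ^+ 2 * (M * (q * Q ^+ 2)) * T =
    rho ^+ 2 * P ^+ 2 * (q * Q ^+ 2) * (2 * M * T) by ring.
  by rewrite ler_pM2l // !mulr_gt0 // exprn_gt0.
rewrite -{1}[T]mul1r ler_pM2r // in e3.
apply: le_trans e3 _.
have -> : 4 * rho ^+ 4 * (4 * rho ^+ 4 * (a * P ^+ 4) ^+ 2) * M * (q * Q ^+ 2) =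
   4 * rho ^+ 4 * (4 * rho ^+ 4 * (a * P ^+ 4) ^+ 2) * (M * (q * Q ^+ 2)) by ring.
rewrite ler_pM2r; last by rewrite !mulr_gt0 // exprn_gt0.
have -> : 4 * rho ^+ 4 * (4 * rho ^+ 4 * (a * P ^+ 4) ^+ 2) =
   (2 * rho ^+ 2 * P ^+ 2) * (8 * rho ^+ 6 * a ^+ 2 * P ^+ 6) by ring.
rewrite ler_peMr //; first by apply: ltW; rewrite !mulr_gt0 // exprn_gt0.
have P1 : 1 <= P by apply: le_trans rhoP.
rewrite -[leLHS]mulr1 ler_pM ?exprn_ege1 // -[leLHS]mulr1 ler_pM ?exprn_ege1 //.
  rewrite -[leLHS]mulr1 ler_pM ?exprn_ege1 //; lra.
by rewrite ler1n.
Qed.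

End Numeric.

(** * Covers of cycles when a fixed coordinate is forgotten *)

Section Supersaturation.
Variables (R : realFieldType) (Om X Y Z : finType).
Variables (x : Om -> X) (y : Om -> Y) (z : Om -> Z).
Hypothesis root : forall (a : R) n, 0 < a -> (0 < n)%N ->
  exists2 b, 0 < b & b ^+ n = a.
Implicit Types (K E : {set Om}) (d : Om * bool).

(* A dart (e, b) traverses the edge {y e, z e} of the bipartite multigraph K; the
   coordinate x e acts as its colour. *)
Definition cyc l K (t : seq (Om * bool)) :=
  [&& size t == l, all (fun d => d.1 \in K) t, uniq (map (srcT y z) t),
      uniq (map (fun d => x d.1) t)
    & cycle (fun d d' => srcT y z d' == tgtT y z d) t].

Lemma walk_cycle t u : walk (src y z) (tgt y z) u t u ->
  cycle (fun d d' => srcT y z d' == tgtT y z d) t.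
Proof.
case: t => // d t /= /andP[/eqP su].
have aux d' w : walk (src y z) (tgt y z) (tgt y z d') t w =
    path (fun d d' => srcT y z d' == tgtT y z d) d' t && (tgt y z (last d' t) == w).
  elim: t d' => [|d1 t IHt] d' //=.
  by rewrite IHt andbA /src /tgt (inj_eq (@vtx_inj Y Z)).
rewrite aux rcons_path => /andP[-> /eqP tw] /=.
by move: tw; rewrite -su /src /tgt => /vtx_inj ->.
Qed.

(** On the stabilized part [K2] the trace is comparable to [#|K2| * M], while a cover accounts for
    at most about [M] times its cost; the unknown [M] cancels. *)
Lemma supersat_dir k w m0 N K1 (D DY DZ T J : nat) (G : seq {set Om}) :
  let l := k.*2.+2 in
  let A : R := 4 * (w%:R ^+ 15) ^+ 4 in
  (0 < k)%N -> (2 ^ J <= w)%N -> (0 < w)%N -> (0 < m0)%N -> (0 < D)%N ->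
  K1 != set0 ->
  (#|Om| * #|Om| ^ k.*2 <= w ^ J)%N ->
  (forall s, fib y K1 s <= DY)%N -> (#|y @: K1| * DY <= w ^ 7 * #|K1|)%N ->
  (forall s, fib z K1 s <= DZ)%N -> (#|z @: K1| * DZ <= w ^ 7 * #|K1|)%N ->
  (forall s, fib (fun e => (y e, z e)) K1 s <= D)%N ->
  (forall s, fib (fun e => (x e, y e)) K1 s <= N)%N ->
  (forall s, fib (fun e => (x e, z e)) K1 s <= N)%N ->
  (D <= N)%N -> (D <= #|Om|)%N -> (DY <= #|Om|)%N -> (DZ <= #|Om|)%N ->
  (D ^ 2 <= w ^ 15 * DY)%N -> (D ^ 2 <= w ^ 15 * DZ)%N ->
  (#|y @: K1| <= N)%N -> (#|z @: K1| <= N)%N ->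
  (#|K1| <= T)%N -> (T <= w ^ 6 * #|K1|)%N ->
  (N ^ k.*2.+3 <= w * T * m0 ^ k.*2)%N -> (N ^ k.*2.+2 <= w * m0 ^ k.*2.+1)%N ->
  16 * l%:R ^+ 2 * A * w%:R * N%:R * m0%:R <= T%:R :> R ->
  set0 \notin G ->
  (forall t, cyc l K1 t -> exists2 E, E \in G & E \subset [set e in map fst t]) ->
  T%:R <= 4 * w%:R ^+ 8 * (2 * l + 1)%:R ^+ l * A ^+ l * cost (m0%:R / T%:R : R) G.
Proof.
move=> l A k0 Jw w0 m00 D0 K10 HJ HDY HY HDZ HZ HD HxyN HxzN DN DO DYO DZO DDY DDZ.
move=> yN zN K1T TK1 HN1 HN2 Hsm G0 Gcov.
have w1 : 1 <= w%:R :> R by rewrite ler1n.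
have wgt0 : 0 < w%:R :> R by apply: lt_le_trans w1.
pose Dl := maxn DY DZ.
have adjD K : K \subset K1 -> forall u v, adj R y z K u v <= D%:R.
  by move=> KK; apply: adj_codeg => s; apply: leq_trans (fib_sub _ _ KK) (HD s).
have adjDl K : K \subset K1 -> forall u, \sum_v adj R y z K u v <= Dl%:R.
  move=> KK; apply: adj_deg => s; rewrite leq_max; apply/orP; [left|right].
    by apply: leq_trans (fib_sub _ _ KK) (HDY s).
  by apply: leq_trans (fib_sub _ _ KK) (HDZ s).
have adjM K : K \subset K1 -> forall u v, (adj R y z K ^+ k.*2.+1) u v <= D%:R * Dl%:R ^+ k.*2.
  move=> KK; apply: expmx_degree => // [u v|]; last exact: adjDl.
  by rewrite adj_ge0 adjD.
(* The trivial bound [D * Dl^(2k) <= w^J] limits stabilization with ratio [w] to [J] rounds, which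
   lose a factor [2^J <= w]. *)
have [|K2 [M' [K2K K2c M'0 HM' HT]]] := @stabilize R Om Y Z y z k w%:R J K1 w1.
  move=> d dK; apply: le_trans (adjM K1 (subxx _) _ _) _.
  rewrite -!natrX -natrM ler_nat; apply: leq_trans HJ.
  by rewrite leq_mul // leq_expl // geq_max DYO.
have K2c' : (#|K1| <= w * #|K2|)%N.
  by apply: leq_trans K2c _; rewrite leq_mul2r Jw orbT.
have K10' : (0 < #|K1|)%N by rewrite card_gt0.
have K20' : (0 < #|K2|)%N by move: K10' K2c'; case: #|K2| => //; rewrite muln0; case: #|K1|.
have K20 : K2 != set0 by rewrite -card_gt0.
have Dl0 : (0 < Dl)%N.
  rewrite /Dl leq_max; move: DDY; case: DY {HDY HY DYO Dl adjDl adjM} => //.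
  by rewrite muln0 leqn0 expn_eq0 /= andbT eqn0Ngt D0.
(* The minimum with the trivial bound forces [lam <= Dl] without weakening either estimate on the
   return weights. *)
pose M : R := Num.min M' (D%:R * Dl%:R ^+ k.*2).
have M0 : 0 < M by rewrite lt_min M'0 mulr_gt0 ?exprn_gt0 ?ltr0n.
have HM d : d \in darts K2 -> (adj R y z K2 ^+ k.*2.+1) (tgt y z d) (src y z d) <= M.
  by move=> dK; rewrite le_min HM' // adjM.
pose kap : R := #|K2|%:R.
have kap0 : 0 < kap by rewrite ltr0n.
pose tr := \tr (adj R y z K2 ^+ l).
have trM : tr <= 2 * kap * M.
  rewrite /tr adj_trace; apply: le_trans (ler_sum _ (fun d => HM d)) _.
  by rewrite sumr_const card_darts -[leLHS]mulr_natl natrM.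
have Mtr : kap * M <= 2 * w%:R * tr.
  by apply: le_trans HT; rewrite ler_pM2l // ge_min lexx.
have TK2 : (T <= w ^ 7 * #|K2|)%N.
  by apply: leq_trans TK1 _; rewrite (expnSr w 6) -mulnA leq_mul2l K2c' orbT.
have T0 : (0 < T)%N by apply: leq_trans K1T.
have K2T : (#|K2| <= T)%N by apply: leq_trans K1T; apply: subset_leq_card.
pose q : R := m0%:R / T%:R.
have q0 : 0 < q by rewrite divr_gt0 ?ltr0n.
(* This dominates all losses at once: [w^7] and [w^8] in sizes and degrees, and [w^15] in the
   comparison of [D ^ 2] with the degrees. *)
pose rho : R := w%:R ^+ 15.
have rho1 : 1 <= rho by rewrite exprn_ege1.
have rhoX n : (n <= 15)%N -> w%:R ^+ n <= rho by move=> n15; rewrite ler_weXn2l.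
have Hm : m0%:R <= rho * kap * q.
  have -> : m0%:R = T%:R * q by rewrite /q mulrCA mulfV ?mulr1 // gt_eqF ?ltr0n.
  rewrite ler_pM2r //; apply: le_trans (_ : w%:R ^+ 7 * kap <= _).
    by rewrite /kap -natrX -natrM ler_nat.
  by rewrite ler_pM2r // rhoX.
pose b : R := #|y @: K2|%:R; pose c : R := #|z @: K2|%:R.
have imf (S : finType) (f : Om -> S) : 0 < #|f @: K2|%:R :> R.
  by rewrite ltr0n card_gt0 imset_eq0.
have b0 : 0 < b by apply: imf. have c0 : 0 < c by apply: imf.
have HY2 : b * DY%:R <= rho * kap.
  apply: le_trans (_ : w%:R ^+ 8 * kap <= _); last by rewrite ler_pM2r // rhoX.
  rewrite /kap /b -natrX -!natrM ler_nat.
  apply: leq_trans (_ : #|y @: K1| * DY <= _)%N.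
    by rewrite leq_mul2r subset_leq_card ?orbT // imsetS.
  by apply: leq_trans HY _; rewrite (expnSr w 7) -mulnA leq_mul2l K2c' orbT.
have HZ2 : c * DZ%:R <= rho * kap.
  apply: le_trans (_ : w%:R ^+ 8 * kap <= _); last by rewrite ler_pM2r // rhoX.
  rewrite /kap /c -natrX -!natrM ler_nat.
  apply: leq_trans (_ : #|z @: K1| * DZ <= _)%N.
    by rewrite leq_mul2r subset_leq_card ?orbT // imsetS.
  by apply: leq_trans HZ _; rewrite (expnSr w 7) -mulnA leq_mul2l K2c' orbT.
have bN : b <= N%:R.
  by rewrite ler_nat (leq_trans _ yN) // subset_leq_card // imsetS.
have cN : c <= N%:R.
  by rewrite ler_nat (leq_trans _ zN) // subset_leq_card // imsetS.
have HTr : (kap ^+ 2) ^+ k.+1 <= (b * c) ^+ k.+1 * (2 * kap * M).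
  apply: le_trans (@adj_trace_lower R Om Y Z y z K2 k K20) _.
  by apply: ler_wpM2l; rewrite ?exprn_ge0 // ?mulr_ge0.
have D0' : 0 < D%:R :> R by rewrite ltr0n.
have [||lam lam0 lamE] := @root (M / D%:R) k.*2.
- by rewrite divr_gt0.
- by rewrite double_gt0.
have ME : M = D%:R * lam ^+ k.*2 by rewrite lamE mulrCA mulfV ?mulr1 // gt_eqF.
have m00' : 0 < m0%:R :> R by rewrite ltr0n.
have HN1' : N%:R ^+ k.*2.+3 <= rho * kap * m0%:R ^+ k.*2.
  apply: le_trans (_ : w%:R ^+ 8 * kap * m0%:R ^+ k.*2 <= _); last first.
    by rewrite ler_pM2r ?exprn_gt0 // ler_pM2r // rhoX.
  rewrite /kap -!natrX -!natrM ler_nat; apply: leq_trans HN1 _.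
  by rewrite leq_mul2r (expnS w 7) -mulnA leq_mul2l TK2 !orbT.
have C1 : Dl%:R <= A * lam ^+ 2 * q.
  rewrite /Dl; case: (leqP DY DZ) => _.
    have HT2 : (kap ^+ 2) ^+ k.+1 <= (c * b) ^+ k.+1 * (2 * kap * M) by rewrite [c * b]mulrC.
    apply: (degree_le_scale k0 rho1 kap0 c0 b0 D0' m00' q0 M0 cN bN HT2 Hm _ lam0 HZ2 HY2 _ ME HN1').
      exact: ler0n.
    by rewrite /rho -!natrX -natrM ler_nat.
  apply: (degree_le_scale k0 rho1 kap0 b0 c0 D0' m00' q0 M0 bN cN HTr Hm _ lam0 HY2 HZ2 _ ME HN1').
    exact: ler0n.
  by rewrite /rho -!natrX -natrM ler_nat.
have C2 : 1 <= A ^+ l * M * q ^+ l.-1.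
  apply: (@one_le_return _ k rho kap b c M m0%:R N%:R q) => //.
  apply: le_trans (_ : w%:R * m0%:R ^+ k.*2.+1 <= _).
    by rewrite -!natrX -natrM ler_nat.
  rewrite ler_pM2r ?exprn_gt0 //; have := @rhoX 1%N isT; by rewrite expr1.
have lamDl : lam <= Dl%:R.
  rewrite -(@ler_pXn2r _ k.*2) ?double_gt0 ?nnegrE ?(ltW lam0) //.
  by rewrite lamE ler_pdivrMr // mulrC ge_min lexx orbT.
have A1 : 1 <= A.
  by rewrite /A -[leLHS]mulr1 ler_pM ?ler1n // exprn_ege1.
have A0 : 0 < A by apply: lt_le_trans A1.
have l1 : 1 <= l%:R :> R by rewrite ler1n.
have small : 16 * l%:R ^+ 2 * w%:R * (A * q * N%:R) <= 1.
  have -> : 16 * l%:R ^+ 2 * w%:R * (A * q * N%:R) =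
    (16 * l%:R ^+ 2 * A * w%:R * N%:R * m0%:R) / T%:R by rewrite /q; ring.
  by rewrite ler_pdivrMr ?ltr0n // mul1r.
have N0 : 0 < N%:R :> R by rewrite ltr0n (leq_trans D0).
have AqN0 : 0 < A * q * N%:R by apply: mulr_gt0 N0; apply: mulr_gt0.
have F0N : Dl%:R * D%:R / lam ^+ 2 <= A * q * N%:R.
  rewrite ler_pdivrMr ?exprn_gt0 //.
  have -> : A * q * N%:R * lam ^+ 2 = (A * lam ^+ 2 * q) * N%:R by ring.
  by apply: ler_pM => //; rewrite ler_nat.
have F01 : Dl%:R * D%:R / lam ^+ 2 <= 1.
  apply: le_trans F0N _; apply: le_trans small.
  rewrite ler_peMl ?(ltW AqN0) //.
  rewrite -[leLHS]mulr1 ler_pM // -[leLHS]mulr1 ler_pM ?exprn_ege1 //; lra.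
have tr0 : 0 <= tr by apply: sumr_ge0 => u _; apply: expmx_ge0 => *; apply: adj_ge0.
have dartE : #|darts K2|%:R = 2 * kap :> R by rewrite card_darts natrM.
(* Each of the two terms is at most [2 * l^2 * kap * (A * q * N * M)], which [small] and [Mtr] bound
   by a quarter of the trace. *)
have C3 : l%:R ^+ 2 * (Dl%:R * D%:R / lam ^+ 2 * M * #|darts K2|%:R) +
    l%:R ^+ 2 * (Dl%:R * D%:R / lam ^+ 2 * lam ^+ k.*2 * (N%:R * #|darts K2|%:R)) <= tr / 2.
  have e1 : Dl%:R * D%:R / lam ^+ 2 * M <= A * q * N%:R * M by rewrite ler_pM2r.
  have e2 : Dl%:R * D%:R / lam ^+ 2 * lam ^+ k.*2 * N%:R <= A * q * N%:R * M.
    have -> : Dl%:R * D%:R / lam ^+ 2 * lam ^+ k.*2 * N%:R = Dl%:R / lam ^+ 2 * (N%:R * M).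
      by rewrite ME; ring.
    have -> : A * q * N%:R * M = A * q * (N%:R * M) by ring.
    rewrite ler_pM2r ?mulr_gt0 // ler_pdivrMr ?exprn_gt0 //.
    by apply: le_trans C1 _; rewrite le_eqVlt; apply/orP; left; apply/eqP; ring.
  have l20 : 0 <= l%:R ^+ 2 * (2 * kap) :> R by rewrite mulr_ge0 ?exprn_ge0 ?mulr_ge0 ?ltW.
  have := ler_wpM2l l20 e1; have := ler_wpM2l l20 e2; rewrite !dartE.
  have s2 := ler_wpM2r (mulr_ge0 (ltW kap0) (ltW M0)) small.
  have s3 : 16 * l%:R ^+ 2 * (A * q * N%:R) * (kap * M) <= 2 * tr.
    rewrite -(ler_pM2l wgt0); apply: le_trans (_ : kap * M <= _).
      apply: le_trans (_ : 16 * l%:R ^+ 2 * w%:R * (A * q * N%:R) * (kap * M) <= _).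
        by rewrite le_eqVlt; apply/orP; left; apply/eqP; ring.
      by apply: le_trans s2 _; rewrite mul1r.
    by apply: le_trans Mtr _; rewrite le_eqVlt; apply/orP; left; apply/eqP; ring.
  set a1 := Dl%:R * D%:R / lam ^+ 2 * M.
  set a2 := Dl%:R * D%:R / lam ^+ 2 * lam ^+ k.*2 * N%:R.
  have -> : l%:R ^+ 2 * (a1 * (2 * kap)) = l%:R ^+ 2 * (2 * kap) * a1 by ring.
  have -> : l%:R ^+ 2 * (Dl%:R * D%:R / lam ^+ 2 * lam ^+ k.*2 * (N%:R * (2 * kap))) =
     l%:R ^+ 2 * (2 * kap) * a2 by rewrite /a2; ring.
  have e3 : l%:R ^+ 2 * (2 * kap) * (A * q * N%:R * M) <= tr / 4.
    have -> : l%:R ^+ 2 * (2 * kap) * (A * q * N%:R * M) =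
      (16 * l%:R ^+ 2 * (A * q * N%:R) * (kap * M)) / 8 by field.
    by rewrite ler_pdivrMr //; apply: le_trans s3 _; apply: twice_le.
  move=> h2 h1; apply: le_trans (lerD (le_trans h1 e3) (le_trans h2 e3)) _.
  exact: quarters_le.
have := @graph_cover R _ _ (src y z) (tgt y z) (darts K2) (@no_loop Om Y Z y z) k D%:R Dl%:R
  lam M (@adj_sym R Om Y Z y z K2) k0 lam0 D0' (adjD K2 K2K) (adjDl K2 K2K) lamDl ME HM F01
  Om X fst (fun d => x d.1).
move=> gc.
have {}gc : tr / 2 <= (2 * l + 1)%:R ^+ l * (A ^+ l * M * cost q G).
  apply: (gc _ _ N%:R A q G) => //.
  - move=> E; rewrite (_ : [set d | _] = darts E) ?card_darts //.
  - by move=> d d' ->.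
  - exact: color_sym.
  - by apply: color_deg => s; apply: leq_trans (fib_sub _ _ K2K) _.
  - move=> u t tl wt tg us uc; apply: Gcov; rewrite /cyc tl eqxx uc (walk_cycle wt).
    rewrite !andbT /=; apply/andP; split.
      by apply: sub_all tg => d; rewrite /= inE => /(subsetP K2K).
    by move: us; rewrite (map_comp (@vtx Y Z)) (map_inj_uniq (@vtx_inj Y Z)).
have fin : kap <= 4 * w%:R * ((2 * l + 1)%:R ^+ l * A ^+ l * cost q G).
  rewrite -(ler_pM2r M0); apply: le_trans Mtr _.
  have -> : 4 * w%:R * ((2 * l + 1)%:R ^+ l * A ^+ l * cost q G) * M =
    4 * w%:R * ((2 * l + 1)%:R ^+ l * (A ^+ l * M * cost q G)) by ring.
  apply: le_trans (_ : 4 * w%:R * (tr / 2) <= _).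
    by rewrite le_eqVlt; apply/orP; left; apply/eqP; field.
  by rewrite ler_pM2l // mulr_gt0.
apply: le_trans (_ : w%:R ^+ 7 * kap <= _).
  by rewrite /kap -natrX -natrM ler_nat.
apply: le_trans (ler_wpM2l (exprn_ge0 7 (ltW wgt0)) fin) _.
by rewrite le_eqVlt; apply/orP; left; apply/eqP; ring.
Qed.

End Supersaturation.

Lemma muln_pos (m n : nat) : (0 < m)%N -> (0 < n)%N -> (0 < m * n)%N.
Proof. by rewrite muln_gt0 => -> ->. Qed.

(* w^8 pays for the regularization, 4 * w^60 for the constant A of supersat_dir. *)
Definition loss (l w : nat) : nat := (4 * w ^ 8 * (2 * l + 1) ^ l * (4 * w ^ 60) ^ l)%N.

Lemma loss_gt0 l w : (0 < w)%N -> (0 < loss l w)%N.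
Proof. by move=> w0; rewrite /loss !(muln_gt0, expn_gt0) w0 addn1. Qed.

(** * Regularizing all projections simultaneously *)

Section MaxFiber.
Variable Om : finType.
Implicit Types (K : {set Om}) (S : finType).

Definition maxfib S (f : Om -> S) K := (\max_s fib f K s)%N.

Lemma fib_max S (f : Om -> S) K s : (fib f K s <= maxfib f K)%N.
Proof. exact: leq_bigmax. Qed.

Lemma maxfib_le S (f : Om -> S) K m :
  (forall s, fib f K s <= m)%N -> (maxfib f K <= m)%N.
Proof. by move=> h; apply/bigmax_leqP => s _. Qed.

Lemma fib_card S (f : Om -> S) K s : (fib f K s <= #|Om|)%N.
Proof. exact: max_card. Qed.

Lemma fib_image S (f : Om -> S) K e : e \in K -> (0 < fib f K (f e))%N.
Proof. by move=> eK; apply/card_gt0P; exists e; rewrite inE eK eqxx. Qed.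

Lemma maxfib_gt0 S (f : Om -> S) K : K != set0 -> (0 < maxfib f K)%N.
Proof.
by case/set0Pn => e eK; apply: leq_trans (fib_max _ _ (f e)); apply: fib_image.
Qed.

Lemma maxfib_image S (f : Om -> S) K m : K != set0 ->
  (forall s, fib f K s * #|f @: K| <= m)%N -> (#|f @: K| * maxfib f K <= m)%N.
Proof.
case/set0Pn => e _ h; rewrite mulnC /maxfib.
by have [|s ->] := @bigop.eq_bigmax _ (fib f K); rewrite ?h //; apply/card_gt0P; exists (f e).
Qed.

Lemma maxfib_swap (S1 S2 : finType) (f : Om -> S1) (g : Om -> S2) K :
  maxfib (fun e => (f e, g e)) K = maxfib (fun e => (g e, f e)) K.
Proof.
have sw (T1 T2 : finType) (p : Om -> T1) (q : Om -> T2) :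
    (maxfib (fun e => (p e, q e)) K <= maxfib (fun e => (q e, p e)) K)%N.
  apply: maxfib_le => -[a b]; apply: leq_trans (fib_max _ _ (b, a)).
  by apply: subset_leq_card; apply/subsetP => e; rewrite !inE !xpair_eqE [(q e == b) && _]andbC.
by apply/eqP; rewrite eqn_leq !sw.
Qed.

Lemma image_swap (S1 S2 : finType) (f : Om -> S1) (g : Om -> S2) K :
  #|(fun e => (f e, g e)) @: K| = #|(fun e => (g e, f e)) @: K|.
Proof.
have sw : injective (fun p : S1 * S2 => (p.2, p.1)) by move=> [a b] [c d] [-> ->].
by rewrite -(card_imset _ sw) -imset_comp.
Qed.

(** Regularity obtained for earlier maps survives a later restriction: fibres and images only
    shrink, and the size drops by a factor of at most [w]. *)
Lemma dyadic_all (fs : seq {S : finType & Om -> S}) K w :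
  (0 < w)%N -> (#|Om| < 2 ^ w)%N ->
  exists K', [/\ K' \subset K, (#|K| <= w ^ size fs * #|K'|)%N &
    forall F, List.In F fs -> forall s,
      (fib (projT2 F) K' s * #|projT2 F @: K'| <= 2 * w ^ size fs * #|K'|)%N].
Proof.
move=> w0 Omw; elim: fs => [|F fs [K1 [K1K KK1 reg]]] /=.
  by exists K; rewrite subxx mul1n.
have [|K2 [K21 K1K2 reg2]] := @dyadic Om _ (projT2 F) K1 w.
  exact: leq_ltn_trans (max_card _) Omw.
exists K2; split; first exact: subset_trans K21 K1K.
  by rewrite (leq_trans KK1) // expnSr -mulnA leq_mul2l K1K2 orbT.
move=> F' [<-|F'fs] s.
  by rewrite (leq_trans (reg2 s)) // leq_mul2r leq_pmulr ?orbT // expn_gt0 w0.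
apply: leq_trans (_ : 2 * w ^ size fs * #|K1| <= _)%N.
  by apply: leq_trans (reg F' F'fs s); rewrite leq_mul ?fib_sub // subset_leq_card ?imsetS.
by rewrite expnSr -!mulnA !leq_mul2l K1K2 !orbT.
Qed.

End MaxFiber.

Section Supersaturation.
Variables (R : realFieldType) (Om X Y Z : finType).
Variables (x : Om -> X) (y : Om -> Y) (z : Om -> Z).
Hypothesis root : forall (a : R) n, 0 < a -> (0 < n)%N ->
  exists2 b, 0 < b & b ^+ n = a.
Hypothesis inj : forall e e', x e = x e' -> y e = y e' -> z e = z e' -> e = e'.
Implicit Types (K E : {set Om}) (d : Om * bool).

(** The maximal fibre is at most [w^7] times the average one; the power absorbs the factor [2 * w^6]
    left by six regularizations. *)
Definition regular (w : nat) (S : finType) (f : Om -> S) K :=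
  (#|f @: K| * maxfib f K <= w ^ 7 * #|K|)%N.

Lemma regular_swap w (S1 S2 : finType) (f : Om -> S1) (g : Om -> S2) K :
  regular w (fun e => (f e, g e)) K = regular w (fun e => (g e, f e)) K.
Proof. by rewrite /regular image_swap maxfib_swap. Qed.

Lemma regular_product w (S1 S2 T : finType) (p1 : Om -> S1) (p2 : Om -> S2)
    (p : Om -> T) K : K != set0 ->
  (forall e e', p1 e = p1 e' -> p2 e = p2 e' -> e = e') ->
  (forall e e', p1 e = p1 e' -> p e = p e') ->
  (forall e e', p2 e = p2 e' -> p e = p e') ->
  regular w p1 K -> regular w p2 K ->
  (maxfib p1 K * maxfib p2 K <= w ^ 14 * maxfib p K)%N.
Proof.
move=> K0 i r1 r2 h1 h2; rewrite /regular ![(#|_ @: _| * _)%N]mulnC in h1 h2.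
have := @codeg_product Om S1 S2 T p1 p2 p K _ _ (maxfib p K) _
  (in2W i) (in2W r1) (in2W r2) (fib_max p K) h1 h2.
have -> : ((w ^ 7 * #|K|) ^ 2 * maxfib p K = w ^ 14 * maxfib p K * #|K| ^ 2)%N.
  by rewrite expnMn -expnM mulnAC.
rewrite leq_pmul2r //.
by rewrite expn_gt0 card_gt0 K0.
Qed.

Variables (k w m0 N J : nat).
Let l := k.*2.+2.
Let A : R := 4 * (w%:R ^+ 15) ^+ 4.
Hypotheses (k0 : (0 < k)%N) (Jw : (2 ^ J <= w)%N) (w0 : (0 < w)%N) (m00 : (0 < m0)%N).
Hypothesis HJ : (#|Om| * #|Om| ^ k.*2 <= w ^ J)%N.
Hypotheses (XN : (#|X| <= N)%N) (YN : (#|Y| <= N)%N) (ZN : (#|Z| <= N)%N).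
Hypothesis HN2 : (N ^ k.*2.+2 <= w * m0 ^ k.*2.+1)%N.

Lemma maxfib_pair (S1 S2 S3 : finType) (f : Om -> S1) (g : Om -> S2) (h : Om -> S3) K :
  (forall e e', f e = f e' -> g e = g e' -> h e = h e' -> e = e') ->
  (maxfib (fun e => (f e, g e)) K <= #|S3|)%N.
Proof.
move=> fgh; apply: maxfib_le => -[a b].
rewrite /fib -(card_in_imset (f := h)) ?max_card // => e e'.
rewrite !inE !xpair_eqE => /and3P[_ /eqP fe /eqP ge] /and3P[_ /eqP fe' /eqP ge'].
by apply: fgh; rewrite ?fe ?ge.
Qed.

(** Minimality of the codegree [D] of [(y, z)] gives [D^2 <= D * maxfib (x, y) <= w^14 * maxfib y],
    and likewise for [z]; this is the comparison of codegree and degree that the forgotten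
    coordinate must provide. *)
Lemma supersat_min (K1 : {set Om}) (T : nat) (G : seq {set Om}) :
  K1 != set0 -> regular w y K1 -> regular w z K1 ->
  regular w (fun e => (x e, y e)) K1 -> regular w (fun e => (x e, z e)) K1 ->
  regular w (fun e => (y e, z e)) K1 ->
  (maxfib (fun e => (y e, z e)) K1 <= maxfib (fun e => (x e, y e)) K1)%N ->
  (maxfib (fun e => (y e, z e)) K1 <= maxfib (fun e => (x e, z e)) K1)%N ->
  (#|K1| <= T)%N -> (T <= w ^ 6 * #|K1|)%N ->
  (N ^ k.*2.+3 <= w * T * m0 ^ k.*2)%N ->
  16 * l%:R ^+ 2 * A * w%:R * N%:R * m0%:R <= T%:R :> R ->
  set0 \notin G ->
  (forall t, cyc x y z l K1 t -> exists2 E, E \in G & E \subset [set e in map fst t]) ->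
  T%:R <= 4 * w%:R ^+ 8 * (2 * l + 1)%:R ^+ l * A ^+ l * cost (m0%:R / T%:R : R) G.
Proof.
move=> K0 ry rz rxy rxz ryz mxy mxz K1T TK1 HN1 Hsm G0 Gcov.
have ww : (w ^ 14 <= w ^ 15)%N by apply: leq_pexp2l.
have le_card (S : finType) (f : Om -> S) : (maxfib f K1 <= #|Om|)%N.
  by apply: maxfib_le => s; apply: fib_card.
apply: (@supersat_dir R Om X Y Z x y z root k w m0 N K1 (maxfib (fun e => (y e, z e)) K1)
  (maxfib y K1) (maxfib z K1) T J G) => //.
- exact: maxfib_gt0.
- exact: fib_max.
- exact: fib_max.
- exact: fib_max.
- move=> s; apply: leq_trans (fib_max _ _ _) (leq_trans (maxfib_pair (h := z) _ _) ZN).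
  exact: inj.
- move=> s; apply: leq_trans (fib_max _ _ _) (leq_trans (maxfib_pair (h := y) _ _) YN).
  by move=> e e' xe ze ye; apply: inj.
- apply: leq_trans (maxfib_pair (h := x) _ _) XN.
  by move=> e e' ye ze xe; apply: inj.
- rewrite -mulnn; apply: leq_trans (leq_mul (leqnn _) mxy) _.
  apply: leq_trans (_ : w ^ 14 * maxfib y K1 <= _)%N; last by rewrite leq_mul2r ww orbT.
  apply: regular_product => // [e e' [ye ze] [xe _]|e e' []|e e' []] //.
  exact: inj.
- rewrite -mulnn; apply: leq_trans (leq_mul (leqnn _) mxz) _.
  apply: leq_trans (_ : w ^ 14 * maxfib z K1 <= _)%N; last by rewrite leq_mul2r ww orbT.
  apply: regular_product => // [e e' [ye ze] [xe _]|e e' []|e e' []] //.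
  exact: inj.
- exact: leq_trans (max_card _) YN.
- exact: leq_trans (max_card _) ZN.
Qed.

End Supersaturation.

Section Cycles.
Variables (R : realFieldType) (Om X Y Z : finType).
Variables (x : Om -> X) (y : Om -> Y) (z : Om -> Z).
Hypothesis root : forall (a : R) n, 0 < a -> (0 < n)%N ->
  exists2 b, 0 < b & b ^+ n = a.
Hypothesis inj : forall e e', x e = x e' -> y e = y e' -> z e = z e' -> e = e'.

(** All three choices of the colour coordinate are included, since the suitable one varies with the
    set of triples. *)
Definition cycles l : {set {set Om}} :=
  [set [set e in map fst (val t)] | t : l.-tuple (Om * bool) &
    [|| cyc x y z l setT t, cyc y x z l setT t | cyc z x y l setT t]].

Lemma card_cycle (X' Y' Z' : finType) (x' : Om -> X') (y' : Om -> Y') (z' : Om -> Z')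
    l t : cyc x' y' z' l setT t -> #|[set e in map fst t]| = l.
Proof.
case/and5P => /eqP <- _ _ ut _; rewrite -(size_map fst) cardsE; apply/card_uniqP.
by rewrite (map_comp x' fst) in ut; apply: map_uniq ut.
Qed.

Lemma cycles_uniform l : {in cycles l, forall E : {set Om}, #|E| = l}.
Proof. by move=> _ /imsetP[t + ->]; rewrite inE => /or3P[]/card_cycle. Qed.

Lemma cyc_setT (X' Y' Z' : finType) (x' : Om -> X') (y' : Om -> Y') (z' : Om -> Z')
    l (K : {set Om}) t : cyc x' y' z' l K t -> cyc x' y' z' l setT t.
Proof.
by case/and5P => sz _ ut ux cy; apply/and5P; split=> //; apply/allP => d _; rewrite inE.
Qed.

Lemma cyc_sub (X' Y' Z' : finType) (x' : Om -> X') (y' : Om -> Y') (z' : Om -> Z')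
    l (K : {set Om}) t : cyc x' y' z' l K t -> [set e in map fst t] \subset K.
Proof.
case/and5P => _ /allP tK _ _ _; apply/subsetP => e.
by rewrite inE => /mapP[d /tK dK ->].
Qed.

Theorem supersaturation l k w m0 N J (K : {set Om}) :
  l = k.*2.+2 ->
  (0 < k)%N -> (2 ^ J <= w)%N -> (2 <= w)%N -> (0 < m0)%N ->
  (#|Om| < 2 ^ w)%N -> (#|Om| ^ l.-1 <= w ^ J)%N ->
  (#|X| <= N)%N -> (#|Y| <= N)%N -> (#|Z| <= N)%N ->
  (N ^ l <= w * m0 ^ l.-1)%N ->
  (N ^ l.+1 <= w * #|K| * m0 ^ l.-2)%N ->
  (16 * l ^ 2 * (4 * w ^ 60) * w * N * m0 <= #|K|)%N ->
  (0 < N)%N ->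
  robust (m0%:R / #|K|%:R : R) (#|K|%:R / (loss l w)%:R) [set E in cycles l | E \subset K].
Proof.
move=> -> k0 Jw w2 m00 Omw; pose l' := k.*2.+2; rewrite -/l'.
rewrite [(#|Om| ^ _)%N]expnS => HJ XN YN ZN HN2 HN1 Hsm N0 G G0 Gcov.
have w0 : (0 < w)%N by apply: ltnW.
have K0 : (0 < #|K|)%N.
  apply: leq_trans Hsm.
  by do ?[exact: m00 | exact: N0 | by rewrite expn_gt0 w0 | apply: muln_pos].
(* All six projections are regularized beforehand, because the pair of smallest codegree is known
   only on the regularized set. *)
pose fs : seq {S : finType & Om -> S} :=
  [:: existT (fun S : finType => Om -> S) X x;
      existT (fun S : finType => Om -> S) Y y;
      existT (fun S : finType => Om -> S) Z z;
      existT (fun S : finType => Om -> S) (X * Y)%type (fun e => (x e, y e));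
      existT (fun S : finType => Om -> S) (X * Z)%type (fun e => (x e, z e));
      existT (fun S : finType => Om -> S) (Y * Z)%type (fun e => (y e, z e))].
have [K1 [K1K KK1 reg]] := @dyadic_all Om fs K w w0 Omw.
have K10 : K1 != set0.
  by rewrite -card_gt0; move: K0 KK1; case: #|K1| => //; rewrite muln0; case: #|K|.
have {}reg (S : finType) (f : Om -> S) :
    List.In (existT (fun S : finType => Om -> S) S f) fs -> regular w f K1.
  move=> hf; apply: leq_trans (maxfib_image K10 (reg _ hf)) _.
  by rewrite leq_mul2r /= (expnS w 6) leq_mul2r w2 !orbT.
have rx : regular w x K1 by apply: reg; left.
have ry : regular w y K1 by apply: reg; right; left.
have rz : regular w z K1 by apply: reg; do 2 right; left.
have rxy : regular w (fun e => (x e, y e)) K1 by apply: reg; do 3 right; left.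
have rxz : regular w (fun e => (x e, z e)) K1 by apply: reg; do 4 right; left.
have ryz : regular w (fun e => (y e, z e)) K1 by apply: reg; do 5 right; left.
have ryx := rxy; rewrite regular_swap in ryx.
have rzx := rxz; rewrite regular_swap in rzx.
have rzy := ryz; rewrite regular_swap in rzy.
have K1T : (#|K1| <= #|K|)%N by apply: subset_leq_card.
pose A : R := 4 * (w%:R ^+ 15) ^+ 4.
have AE : A = (4 * w ^ 60)%:R by rewrite natrM natrX /A -exprM.
have BE : (loss l' w)%:R = 4 * w%:R ^+ 8 * (2 * l' + 1)%:R ^+ l' * A ^+ l' :> R.
  by rewrite AE -!natrX -!natrM.
have Hsm' : 16 * l'%:R ^+ 2 * A * w%:R * N%:R * m0%:R <= #|K|%:R :> R.
  by rewrite AE -natrX -!natrM ler_nat.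
suff : #|K|%:R <= 4 * w%:R ^+ 8 * (2 * l' + 1)%:R ^+ l' * A ^+ l' *
    cost (m0%:R / #|K|%:R : R) G by rewrite ler_pdivrMr ?ltr0n ?loss_gt0 // -BE mulrC.
have cov (X' Y' Z' : finType) (x' : Om -> X') (y' : Om -> Y') (z' : Om -> Z') t :
    (forall t, cyc x' y' z' l' setT t ->
      [|| cyc x y z l' setT t, cyc y x z l' setT t | cyc z x y l' setT t]) ->
    cyc x' y' z' l' K1 t -> exists2 E, E \in G & E \subset [set e in map fst t].
  move=> imp ct; apply: Gcov; rewrite inE (subset_trans (cyc_sub ct) K1K) andbT.
  have sz : size t == l' by case/and5P: ct.
  by apply/imsetP; exists (Tuple sz); rewrite ?inE //; apply: imp; apply: cyc_setT ct.
pose mxy := maxfib (fun e => (x e, y e)) K1.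
pose mxz := maxfib (fun e => (x e, z e)) K1.
pose myz := maxfib (fun e => (y e, z e)) K1.
have [/andP[h1 h2]|yz] := boolP ((myz <= mxy) && (myz <= mxz))%N.
  apply: (supersat_min root inj k0 Jw w0 m00 HJ XN YN ZN HN2 K10) => // t.
  by apply: cov => {}t ->.
have [/andP[h1 h2]|xz] := boolP ((mxz <= mxy) && (mxz <= myz))%N.
  apply: (@supersat_min R Om Y X Z y x z root _ k w m0 N J k0 Jw w0 m00 HJ _ _ _ HN2 K1) => //.
  - by move=> e e' ye xe; apply: inj.
  - by rewrite [maxfib (fun e => (y e, x e)) _]maxfib_swap.
  - by move=> t; apply: cov => {}t ->; rewrite orbT.
have [h1 h2] : (mxy <= mxz)%N /\ (mxy <= myz)%N by move: yz xz; clear; lia.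
apply: (@supersat_min R Om Z X Y z x y root _ k w m0 N J k0 Jw w0 m00 HJ _ _ _ HN2 K1) => //.
- by move=> e e' ze xe ye; apply: inj.
- by rewrite [maxfib (fun e => (z e, x e)) _]maxfib_swap.
- by rewrite [maxfib (fun e => (z e, y e)) _]maxfib_swap.
- by move=> t; apply: cov => {}t ->; rewrite !orbT.
Qed.

End Cycles.

(** * Loose cycles from cycles of triples *)

Section LooseCopies.
Local Open Scope nat_scope.

Lemma cycle_nth (T : Type) (e : rel T) (x0 : T) (s : seq T) i :
  cycle e s -> i < size s -> e (nth x0 s i) (nth x0 s (i.+1 %% size s)).
Proof.
case: s => // d s /(pathP x0) /= h ils.
have := h i; rewrite size_rcons => /(_ ils).
rewrite -[d :: rcons s d]/(rcons (d :: s) d) !nth_rcons /= ils.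
case: (ltnP i (size s)) => [lt|ge].
  by rewrite modn_small.
have -> : i = size s by apply/eqP; rewrite eqn_leq ge -ltnS ils.
by rewrite eqxx modnn.
Qed.

Section Copy.
Variables (Om X Y Z V : finType) (r l : nat).
Variables (x : Om -> X) (y : Om -> Y) (z : Om -> Z).
Variables (vx : X -> V) (vyz : Y + Z -> V) (vp : Om * 'I_(r - 3) -> V).
Hypotheses (vx_inj : injective vx) (vyz_inj : injective vyz) (vp_inj : injective vp).
Hypotheses (x_yz : forall a b, vx a != vyz b) (x_p : forall a b, vx a != vp b).
Hypothesis yz_p : forall a b, vyz a != vp b.
Hypotheses (r3 : 3 <= r) (l0 : 0 < l).

Definition private e : {set V} := [set vp (e, j) | j : 'I_(r - 3)].

(* Vertex (i, 0) goes to the source of the i-th dart, (i, 1) to its colour and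
   (i, j.+2) to the j-th private vertex of its edge. *)
Lemma copy_of_cycle (H : {set {set V}}) (K : {set Om}) t :
  cyc x y z l K t ->
  {in K, forall e, [set vx (x e); vyz (inl (y e)); vyz (inr (z e))] :|: private e \in H} ->
  contains_copy (loose_cycle l r) H.
Proof.
case/and5P => /eqP tl /allP tK us ux ct KH.
have [d0 _] : exists d0 : Om * bool, True by case: t tl {tK us ux ct} l0 => [<-|d ?] //; exists d.
pose D i := nth d0 t i.
pose f := [ffun p : 'I_l * 'I_r.-1 =>
  if p.2 == 0 :> nat then vyz (srcT y z (D p.1))
  else if p.2 == 1 :> nat then vx (x (D p.1).1)
  (* The default is never reached: here [2 <= p.2 < r - 1], so [p.2 - 2 < r - 3]. *)
  else match insub (p.2 - 2) with Some j => vp ((D p.1).1, j) | None => vx (x (D p.1).1) end].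
have Dx (i j : 'I_l) : x (D i).1 = x (D j).1 -> i = j.
  move=> h; apply/val_inj/eqP; rewrite -(nth_uniq (x d0.1) _ _ ux) ?size_map ?tl ?ltn_ord //.
  by rewrite !(nth_map d0) ?tl ?ltn_ord //; apply/eqP.
have De (i j : 'I_l) : (D i).1 = (D j).1 -> i = j by move=> h; apply: Dx; rewrite h.
have Ds (i j : 'I_l) : srcT y z (D i) = srcT y z (D j) -> i = j.
  move=> h; apply/val_inj/eqP; rewrite -(nth_uniq (srcT y z d0) _ _ us) ?size_map ?tl ?ltn_ord //.
  by rewrite !(nth_map d0) ?tl ?ltn_ord //; apply/eqP.
have Dn (i : 'I_l) : srcT y z (D (ordS i)) = tgtT y z (D i).
  apply/eqP; have := @cycle_nth _ _ d0 t i ct; rewrite tl; exact.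
have r20 : 0 < r.-1 by lia. have r21 : 1 < r.-1 by lia.
have f0 (i : 'I_l) (h : 0 < r.-1) : f (i, Ordinal h) = vyz (srcT y z (D i)) by rewrite ffunE.
have f1 (i : 'I_l) (h : 1 < r.-1) : f (i, Ordinal h) = vx (x (D i).1) by rewrite ffunE.
have f2P (j : 'I_(r - 3)) : j.+2 < r.-1 by case: j => j /=; lia.
have f2 (i : 'I_l) (j : 'I_(r - 3)) : f (i, Ordinal (f2P j)) = vp ((D i).1, j).
  by rewrite ffunE /= subn2 /= valK.
have jP (j : 'I_r.-1) : [\/ j = Ordinal r20, j = Ordinal r21 | exists j', j = Ordinal (f2P j')].
  case: j => -[|[|j]] h; [constructor 1|constructor 2|constructor 3]; try exact: val_inj.
  have h' : j < r - 3 by lia.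
  by exists (Ordinal h'); apply: val_inj.
have fE i : f @: loose_edge r i = [set vx (x (D i).1); vyz (inl (y (D i).1)); vyz (inr (z (D i).1))] :|: private (D i).1.
  have yz v (p : bool) : [|| v == vyz (inl (y (D i).1)), v == vyz (inr (z (D i).1)) | p] =
     [|| v == vyz (srcT y z (D i)), v == vyz (tgtT y z (D i)) | p].
    by rewrite /srcT /tgtT; case: (D i).2; rewrite // orbCA.
  apply/setP => v; rewrite !in_setU !in_set1 -!orbA yz.
  apply/imsetP/idP => [[[a j]]|].
    rewrite inE /= => /orP[/eqP ->|/andP[/eqP -> /eqP j0]] ->.
      case: (jP j) => [->|->|[j' ->]]; rewrite ?f0 ?f1 ?f2 ?eqxx ?orbT //.
      by rewrite (_ : _ \in private _) ?orbT //; apply: imset_f.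
    have -> : j = Ordinal r20 by apply: val_inj.
    by rewrite f0 Dn eqxx !orbT.
  case/or4P => [/eqP ->|/eqP ->|/eqP ->|/imsetP[j _ ->]].
  - by exists (i, Ordinal r21); rewrite ?f1 // inE /= eqxx.
  - by exists (i, Ordinal r20); rewrite ?f0 // inE /= eqxx.
  - by exists (ordS i, Ordinal r20); rewrite ?f0 ?Dn // inE /= eqxx orbT.
  - by exists (i, Ordinal (f2P j)); rewrite ?f2 // inE /= eqxx.
apply/existsP; exists f; apply/andP; split.
  apply/injectiveP => -[i j] [i' j'].
  have N (a b : V) : a != b -> a = b -> False by move=> /eqP.
  case: (jP j) => [->|->|[j1 ->]]; case: (jP j') => [->|->|[j2 ->]]; rewrite ?f0 ?f1 ?f2.
  - by move=> /vyz_inj/Ds ->.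
  - by move=> /esym/(N _ _ (x_yz _ _)).
  - by move=> /(N _ _ (yz_p _ _)).
  - by move=> /(N _ _ (x_yz _ _)).
  - by move=> /vx_inj/Dx ->.
  - by move=> /(N _ _ (x_p _ _)).
  - by move=> /esym/(N _ _ (yz_p _ _)).
  - by move=> /esym/(N _ _ (x_p _ _)).
  - by move=> /vp_inj[/De -> ->].
apply/forall_inP => _ /imsetP[i _ ->]; rewrite fE; apply: KH; apply: tK.
by rewrite mem_nth // tl.
Qed.

End Copy.

(** * From linear triple systems to linear r-graphs *)

Section Padding.
Variables (Om X Y Z : finType) (r l n : nat).
Variables (x : Om -> X) (y : Om -> Y) (z : Om -> Z).
Hypotheses (r3 : 3 <= r) (l0 : 0 < l) (n0 : 0 < n) (Xn : #|X| <= n) (Yn : #|Y| <= n).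

Let V : finType := (X + (Y + Z) + Om * 'I_(r - 3))%type.
Let vx a : V := inl (inl a).
Let vy b : V := inl (inr (inl b)).
Let vz c : V := inl (inr (inr c)).
Let vp p : V := inr p.

Definition pad e : {set V} := [set vx (x e); vy (y e); vz (z e)] :|: private vp e.

Lemma card_pad e : #|pad e| = r.
Proof.
rewrite cardsU (_ : _ :&: private vp e = set0); last first.
  apply/eqP; rewrite -subset0; apply/subsetP => v; rewrite inE => /andP[+ /imsetP[j _ vE]].
  by rewrite vE !inE -!orbA; case/or3P.
by rewrite cards0 subn0 card_imset => [|i j [->]] //; rewrite setUC cardsU1 cards2 card_ord !inE /=; lia.
Qed.

Lemma mem_pad e v : v \in pad e =
  match v with
  | inl (inl a) => a == x e
  | inl (inr (inl b)) => b == y e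
  | inl (inr (inr c)) => c == z e
  | inr p => p.1 == e
  end.
Proof.
rewrite !inE; case: v => [[a|[b|c]]|[e' j]]; rewrite /= ?orbF.
- by rewrite (_ : _ \in _ = false) ?orbF //; apply/imsetP => -[].
- by rewrite (_ : _ \in _ = false) ?orbF //; apply/imsetP => -[].
- by rewrite (_ : _ \in _ = false) ?orbF //; apply/imsetP => -[].
- apply/imsetP/eqP => [[j' _ [-> _]]|->] //=; by exists j.
Qed.

Variable F : {set Om}.
Hypothesis xyF : {in F &, forall e e', x e = x e' -> y e = y e' -> e = e'}.
Hypothesis xzF : {in F &, forall e e', x e = x e' -> z e = z e' -> e = e'}.
Hypothesis yzF : {in F &, forall e e', y e = y e' -> z e = z e' -> e = e'}.

Lemma pad_inj : {in F &, injective pad}.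
Proof.
move=> e e' eF e'F ee; apply: xyF => //; apply/eqP.
  by apply: etrans (esym (mem_pad e' (vx (x e)))) _; rewrite -ee mem_pad /= eqxx.
by apply: etrans (esym (mem_pad e' (vy (y e)))) _; rewrite -ee mem_pad /= eqxx.
Qed.

(** A vertex fixes one coordinate, after which an [X] or [Y] coordinate determines the triple in
    [F]; the degree is therefore at most [n] even at vertices of [Z], whatever the size of [Z]. A
    subgraph is the padding of a set of triples, and a cycle of triples in that set yields a loose
    cycle whichever coordinate is its colour. *)
Lemma padded : exists (V : finType) (H : {set {set V}}),
  [/\ is_rgraph r H, is_linear H, #|H| = #|F|, max_degree H <= n &
   forall m, (forall I : {set Om}, I \subset F -> indep (cycles x y z l) I -> #|I| <= m) ->
   turan H (loose_cycle l r) <= m].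
Proof.
exists V, (pad @: F); split.
- by move=> _ /imsetP[e _ ->]; apply: card_pad.
- move=> _ _ /imsetP[e eF ->] /imsetP[e' e'F ->] ee.
  have {}ee : e != e' by apply: contraNneq ee => ->.
  apply/card_le1_eqP => u v.
  rewrite !in_setI !mem_pad.
  have xy : x e == x e' -> y e == y e' -> False.
    by move=> /eqP h1 /eqP h2; move: ee; rewrite (xyF eF e'F h1 h2) eqxx.
  have xz : x e == x e' -> z e == z e' -> False.
    by move=> /eqP h1 /eqP h2; move: ee; rewrite (xzF eF e'F h1 h2) eqxx.
  have yz : y e == y e' -> z e == z e' -> False.
    by move=> /eqP h1 /eqP h2; move: ee; rewrite (yzF eF e'F h1 h2) eqxx.
  have npv (p : Om * 'I_(r - 3)) : (p.1 == e) && (p.1 == e') -> False.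
    by move=> /andP[/eqP -> h]; rewrite h in ee.
  case: u => [[a|[b|c]]|p]; last by move/npv.
  + move=> /andP[/eqP -> xe]; case: v => [[a'|[b'|c']]|p'] /andP[/eqP ->] //.
    * by move=> /(xy xe).
    * by move=> /(xz xe).
    * by move=> h; rewrite h in ee.
  + move=> /andP[/eqP -> ye]; case: v => [[a'|[b'|c']]|p'] /andP[/eqP ->] //.
    * by move=> /xy/(_ ye).
    * by move=> /(yz ye).
    * by move=> h; rewrite h in ee.
  + move=> /andP[/eqP -> ze]; case: v => [[a'|[b'|c']]|p'] /andP[/eqP ->] //.
    * by move=> /xz/(_ ze).
    * by move=> /yz/(_ ze).
    * by move=> h; rewrite h in ee.
- by rewrite card_in_imset //; apply: pad_inj.
- apply/bigmax_leqP => v _; rewrite /degree.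
  have sub : [set A in pad @: F | v \in A] \subset pad @: [set e in F | v \in pad e].
    by apply/subsetP => A; rewrite inE => /andP[/imsetP[e eF ->] vA]; apply: imset_f; rewrite inE eF.
  apply: leq_trans (subset_leq_card sub) _; apply: leq_trans (leq_imset_card _ _) _.
  have inj_le (S : finType) (f : Om -> S) (K : {set Om}) :
      {in K &, injective f} -> #|S| <= n -> #|K| <= n.
    by move=> fi Sn; rewrite -(card_in_imset fi); apply: leq_trans (max_card _) Sn.
  case: v {sub} => [[a|[b|c]]|p].
  + apply: (inj_le _ y) => // e e'; rewrite inE mem_pad => /andP[eF /eqP h].
    by rewrite inE mem_pad => /andP[e'F /eqP h'] ye; apply: xyF; rewrite -?h -?h'.
  + apply: (inj_le _ x) => // e e'; rewrite inE mem_pad => /andP[eF /eqP h].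
    by rewrite inE mem_pad => /andP[e'F /eqP h'] ye; apply: xyF; rewrite -?h -?h'.
  + apply: (inj_le _ x) => // e e'; rewrite inE mem_pad => /andP[eF /eqP h].
    by rewrite inE mem_pad => /andP[e'F /eqP h'] ye; apply: xzF; rewrite -?h -?h'.
  + apply: leq_trans n0; apply/card_le1_eqP => e e'; rewrite inE mem_pad => /andP[_ /eqP <-].
    by rewrite inE mem_pad => /andP[_ /eqP].
- move=> m Im; apply/bigmax_leqP => G /andP[GH noC].
  pose I := [set e in F | pad e \in G].
  have -> : #|G| = #|I|.
    rewrite -(card_in_imset (f := pad)).
      apply: eq_card => A; apply/idP/imsetP => [AG|[e]].
        by have /imsetP[e eF Ae] := subsetP GH A AG; exists e; rewrite // inE eF -Ae.
      by rewrite inE => /andP[_ eG] ->.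
    by move=> e e'; rewrite !inE => /andP[eF _] /andP[e'F _]; apply: pad_inj.
  apply: Im; first by apply/subsetP => e; rewrite inE => /andP[].
  move=> A AC; apply/negP => AI; move/negP: noC; apply.
  have sub (X' Y' Z' : finType) (x' : Om -> X') (y' : Om -> Y') (z' : Om -> Z') t :
      cyc x' y' z' l setT t -> A = [set e in map fst t] -> cyc x' y' z' l I t.
    case/and5P => sz _ us ux ct At; apply/and5P; split=> //; apply/allP => d dt.
    by apply: (subsetP AI); rewrite At inE map_f.
  have pv v p : (inl v : V) != vp p by [].
  have edge e : e \in I -> pad e \in G by rewrite inE => /andP[].
  case/imsetP: AC => t; rewrite inE => /or3P[] ct At.
  + apply: (copy_of_cycle (vx := vx) (vyz := fun s => inl (inr s)) (vp := vp)
      _ _ _ _ _ _ r3 l0 (sub _ _ _ _ _ _ _ ct At)) => //.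
    * by move=> a b [].
    * by move=> a b [].
    * by move=> a b [].
  + apply: (copy_of_cycle (vx := vy) (vyz := fun s => match s with inl a => vx a | inr c => vz c end) (vp := vp)
      _ _ _ _ _ _ r3 l0 (sub _ _ _ _ _ _ _ ct At)) => //.
    * by move=> a b [].
    * by move=> [a|a] [b|b] // [->].
    * by move=> a b [].
    * by move=> a [b|b].
    * by move=> [b|b].
    * by move=> e /edge; rewrite /pad [[set vx _; vy _]]setUC.
  + apply: (copy_of_cycle (vx := vz) (vyz := fun s => match s with inl a => vx a | inr b => vy b end) (vp := vp)
      _ _ _ _ _ _ r3 l0 (sub _ _ _ _ _ _ _ ct At)) => //.
    * by move=> a b [].
    * by move=> [a|a] [b|b] // [->].
    * by move=> a b [].
    * by move=> a [b|b].
    * by move=> [b|b].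
    * by move=> e /edge; rewrite /pad [[set vx _; vy _; vz _]]setUC setUA.
Qed.

End Padding.

End LooseCopies.

(** * Random linear triple systems *)

Section RandomFunction.
Variables (R : realType) (P Z : finType).
Implicit Types (phi : {ffun P -> Z}) (D : {set P * Z}) (p : P).

Definition graph phi : {set P * Z} := [set e | phi e.1 == e.2].

Lemma card_graph D phi : #|D :&: graph phi| = (\sum_p ((p, phi p) \in D))%N.
Proof.
pose f p := (p, phi p); have fi : injective f by move=> p p' [].
have -> : D :&: graph phi = f @: [set p | f p \in D].
  apply/setP => -[p z]; rewrite !inE /=; apply/andP/imsetP => [[pD /eqP pz]|[p']].
    by exists p; rewrite ?inE /f pz.
  by rewrite inE => p'D [-> ->]; rewrite /f p'D.
rewrite card_imset // -sum1_card big_mkcond; apply: eq_bigr => p _.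
by rewrite inE; case: (f p \in D).
Qed.

(** The values of [phi] at different points are independent, so the moment factors over [p], with
    factors [1 + c p / |Z|] bounded by exponentials. *)
Lemma exp_moment D : (0 < #|Z|)%N ->
  \sum_phi 2 ^+ #|D :&: graph phi| <= #|Z|%:R ^+ #|P| * expR (#|D|%:R / #|Z|%:R) :> R.
Proof.
move=> Z0; pose c p := (\sum_z ((p, z) \in D))%N.
have Z0' : 0 < #|Z|%:R :> R by rewrite ltr0n.
have -> : \sum_phi 2 ^+ #|D :&: graph phi| =
    \sum_(phi : {ffun P -> Z}) \prod_p (2 ^+ ((p, phi p) \in D) : R).
  by apply: eq_bigr => phi _; rewrite card_graph expr_sum.
rewrite -(bigA_distr_bigA (fun p z => 2 ^+ ((p, z) \in D) : R)).
have -> : #|D| = (\sum_p c p)%N.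
  rewrite pair_big -sum1_card big_mkcond; apply: eq_bigr => -[p z] _ /=.
  by case: ifP.
rewrite natr_sum mulr_suml expR_sum -[#|P|]cardsT.
have -> : #|Z|%:R ^+ #|[set: P]| = \prod_(p : P) (#|Z|%:R : R).
  by rewrite prodr_const; congr (_ ^+ _); apply: eq_card => p; rewrite inE.
rewrite -big_split; apply: ler_prod => p _ /=.
rewrite sumr_ge0 => [|z _]; last by rewrite exprn_ge0.
have -> : \sum_z (2 ^+ ((p, z) \in D) : R) = #|Z|%:R * (1 + (c p)%:R / #|Z|%:R).
  rewrite mulrDr mulr1 mulrCA mulfV ?gt_eqF // mulr1 /c natr_sum -sum1_card natr_sum.
  rewrite -big_split /=; apply: eq_bigr => z _.
  by case: ((p, z) \in D); rewrite ?expr1 ?expr0 ?addr0 // -natr1.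
by rewrite ler_pM2l // expR_ge1Dx.
Qed.

(** Markov's inequality for [2^|D :&: graph phi|]. The exponent of the moment bound is at most
    [q / 4], and [exp (1/4) <= 4/3 <= 2]. *)
Lemma large_intersection D m q : (0 < #|Z|)%N -> (4 * #|D| <= q * #|Z|)%N ->
  (\sum_phi (m <= #|D :&: graph phi|)%N)%:R * 2 ^+ m <= #|Z|%:R ^+ #|P| * 2 ^+ q :> R.
Proof.
move=> Z0 Dq; have Z0' : 0 < #|Z|%:R :> R by rewrite ltr0n.
apply: le_trans (_ : \sum_phi 2 ^+ #|D :&: graph phi| <= _).
  rewrite natr_sum mulr_suml; apply: ler_sum => phi _.
  case: leqP => h; rewrite ?mul1r ?mul0r ?exprn_ge0 //.
  by rewrite ler_weXn2l // ler1n.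
apply: le_trans (exp_moment _ Z0) _; apply: ler_wpM2l; first by rewrite exprn_ge0.
apply: le_trans (_ : expR (q%:R * 4^-1) <= _).
  rewrite ler_expR ler_pdivrMr // mulrAC ler_pdivlMr // -!natrM ler_nat mulnC.
  by [].
rewrite expRM_natl; apply: lerXn2r; rewrite ?nnegrE ?expR_ge0 //.
have := expR_ge1Dx (- 4^-1 : R); rewrite expRN => h.
have e0 : 0 < expR (4^-1 : R) by apply: expR_gt0.
have h2 : (1 - 4^-1) * expR (4^-1 : R) <= 1.
  by rewrite -ler_pdivlMr // div1r.
move: (expR _) h2 => E; lra.
Qed.

(* Overwriting phi p by an arbitrary value is injective on the colliding phi. *)
Lemma collision p p' : p != p' ->
  (#|Z| * (\sum_(phi : {ffun P -> Z}) (phi p == phi p')) <= #|Z| ^ #|P|)%N.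
Proof.
move=> pp'.
pose up (zphi : Z * {ffun P -> Z}) := [ffun a => if a == p then zphi.1 else zphi.2 a].
pose A := setX [set: Z] [set phi : {ffun P -> Z} | phi p == phi p'].
have -> : (#|Z| * (\sum_(phi : {ffun P -> Z}) (phi p == phi p')) = #|A|)%N.
  rewrite cardsX cardsT -[in RHS]sum1_card [in RHS]big_mkcond; congr muln.
  by apply: eq_bigr => phi _; rewrite inE; case: (phi p == phi p').
rewrite -card_ffun -(card_in_imset (f := up) (D := A)) ?max_card //.
move=> [a phi] [b psi]; rewrite !inE /= => /eqP h1 /eqP h2 e.
have ev x := congr1 (fun f : {ffun P -> Z} => f x) e.
have := ev p; rewrite !ffunE eqxx /= => ->; congr pair.
have ne x : x != p -> phi x = psi x.
  by move=> /negbTE xp; have := ev x; rewrite !ffunE xp.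
apply/ffunP => x; have [->|] := eqVneq x p; last exact: ne.
by rewrite h1 h2 ne // eq_sym.
Qed.

End RandomFunction.

(** * Cleaning the random graph and avoiding all containers *)

Section RandomSystem.
Variables (R : realType) (n : nat).
Hypothesis n0 : (0 < n)%N.
Local Notation P := ('I_n * 'I_n)%type.
Local Notation Z := 'I_(4 * n).

Definition near (p p' : P) := (p != p') && ((p.1 == p'.1) || (p.2 == p'.2)).
Definition clean (phi : {ffun P -> Z}) p := [forall p', near p p' ==> (phi p != phi p')].

Lemma card_near p : (#|[set p' | near p p']| <= 2 * n)%N.
Proof.
have sub : [set p' | near p p'] \subset
    [set (p.1, j) | j : 'I_n] :|: [set (i, p.2) | i : 'I_n].
  apply/subsetP => -[i j]; rewrite !inE /near /= => /andP[_ /orP[]/eqP <-].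
    by apply/orP; left; apply: imset_f.
  by apply/orP; right; apply: (imset_f (fun i => (i, p.2))).
apply: leq_trans (subset_leq_card sub) _; rewrite cardsU.
apply: leq_trans (leq_subr _ _) _; rewrite mul2n -addnn.
by apply: leq_add; apply: leq_trans (leq_imset_card _ _) _; rewrite card_ord.
Qed.

(** At most [2 * n] pairs share a line with [p], and each collides with it with probability at most
    [1 / (4 * n)], so [p] is clean with probability at least one half. This explains the range of
    size [4 * n]. *)
Lemma clean_often p :
  (#|{ffun P -> Z}| <= 2 * \sum_phi clean phi p)%N.
Proof.
have un : (4 * n * \sum_phi ~~ clean phi p <= 2 * n * #|{ffun P -> Z}|)%N.
  apply: leq_trans (_ : 4 * n * \sum_(p' in [set p' | near p p']) \sum_(phi : {ffun P -> Z}) (phi p == phi p') <= _)%N.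
    rewrite leq_mul2l exchange_big; apply/orP; right; apply: leq_sum => phi _ /=.
    case: (boolP (clean phi p)) => //; rewrite negb_forall => /existsP[p'].
    rewrite negb_imply negbK => /andP[np' pp'].
    by rewrite (bigD1 p') ?inE //= pp'.
  rewrite big_distrr /=; apply: leq_trans (_ : \sum_(p' in [set p' | near p p']) #|{ffun P -> Z}| <= _)%N.
    apply: leq_sum => p'; rewrite inE => /andP[pp' _].
    by have := collision Z pp'; rewrite card_ord card_ffun card_ord.
  by rewrite sum_nat_const leq_mul2r card_near orbT.
have tot : (\sum_phi clean phi p + \sum_phi ~~ clean phi p = #|{ffun P -> Z}|)%N.
  rewrite -big_split -sum1_card; apply: eq_bigr => phi _ /=.
  by case: (clean phi p).
have : (2 * \sum_phi ~~ clean phi p <= #|{ffun P -> Z}|)%N.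
  rewrite -(@leq_pmul2l (2 * n)) ?muln_gt0 ?n0 // (leq_trans _ un) //.
  by rewrite mulnA [(2 * n * 2)%N]mulnAC.
move: tot; set a := (\sum_phi _)%N; set b := (\sum_phi _)%N; set c := #|_|; lia.
Qed.

Lemma random_system (C : {set {set P * Z}}) (m q : nat) :
  (4 * #|C| * 2 ^ q <= 2 ^ m)%N -> {in C, forall D : {set P * Z}, (#|D| <= q * n)%N} ->
  exists F : {set P * Z},
  [/\ (n ^ 2 <= 4 * #|F|)%N, {in C, forall D : {set P * Z}, (#|D :&: F| < m)%N},
      {in F &, forall e e', e.1.1 = e'.1.1 -> e.1.2 = e'.1.2 -> e = e'},
      {in F &, forall e e', e.1.1 = e'.1.1 -> e.2 = e'.2 -> e = e'}
    & {in F &, forall e e', e.1.2 = e'.1.2 -> e.2 = e'.2 -> e = e'}].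
Proof.
move=> Cm CD.
pose F (phi : {ffun P -> Z}) := [set e in graph phi | clean phi e.1].
have FE phi : #|F phi| = (\sum_p clean phi p)%N.
  have -> : F phi = [set e | clean phi e.1] :&: graph phi.
    by apply/setP => e; rewrite !inE andbC.
  by rewrite card_graph; apply: eq_bigr => p _; rewrite inE.
have Fle phi : (#|F phi| <= n ^ 2)%N.
  rewrite FE; apply: leq_trans (_ : \sum_(p : P) 1 <= _)%N.
    by apply: leq_sum => p _; case: (clean _ _).
  by rewrite sum1_card card_prod card_ord mulnn.
pose Q := #|{ffun P -> Z}|.
have Q0 : (0 < Q)%N.
  apply/card_gt0P; have z0 : (0 < 4 * n)%N by rewrite muln_gt0.
  by exists [ffun => Ordinal z0].
have sF : (n ^ 2 * Q <= 2 * \sum_phi #|F phi|)%N.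
  have -> : (\sum_phi #|F phi| = \sum_p \sum_phi clean phi p)%N.
    by rewrite exchange_big; apply: eq_bigr => phi _; rewrite FE.
  rewrite big_distrr /=; apply: leq_trans (_ : \sum_(p : P) Q <= _)%N.
    by rewrite sum_nat_const card_prod card_ord mulnn.
  by apply: leq_sum => p _; apply: clean_often.
pose bad phi := (\sum_(D in C) (m <= #|D :&: graph phi|))%N.
have sB : (4 * \sum_phi bad phi <= Q)%N.
  rewrite /bad exchange_big -(ler_nat R) natrM natr_sum.
  have h (D : {set P * Z}) : D \in C ->
      (\sum_phi (m <= #|D :&: graph phi|)%N)%:R * 2 ^+ m <= Q%:R * 2 ^+ q :> R.
    move=> DC; apply: le_trans (@large_intersection R P Z D m q _ _) _.
    - by rewrite card_ord muln_gt0.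
    - by rewrite card_ord mulnCA leq_mul2l /= CD.
    - by rewrite /Q card_ffun natrX.
  have m0 : 0 < 2 ^+ m :> R by rewrite exprn_gt0.
  rewrite -(ler_pM2r m0) -mulrA mulr_suml.
  apply: le_trans (_ : 4 * \sum_(D in C) (Q%:R * 2 ^+ q) <= _).
    by rewrite ler_pM2l //; apply: ler_sum.
  rewrite sumr_const -mulr_natr; have := Cm; rewrite -(ler_nat R) !natrM !natrX => Cm'.
  apply: le_trans (ler_wpM2l (ler0n R Q) Cm'); rewrite le_eqVlt; apply/orP; left; apply/eqP; ring.
(* On average [#|F phi|] is at least [n^2 / 2] and [bad] at most [1/4], so some [phi] satisfies the
   inequality. A positive [bad phi] would force [4 * #|F phi| >= 5 * n^2], against
   [#|F phi| <= n^2]. *)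
have [phi hphi] : exists phi, (n ^ 2 + 4 * n ^ 2 * bad phi <= 4 * #|F phi|)%N.
  apply/existsP; apply: contraT; rewrite negb_exists => /forallP h.
  have lt : (\sum_phi (4 * #|F phi|).+1 <= \sum_phi (n ^ 2 + 4 * n ^ 2 * bad phi))%N.
    by apply: leq_sum => phi _; rewrite ltnNge.
  move: lt; under eq_bigr do rewrite -addn1.
  rewrite !big_split /= -!big_distrr /= !sum_nat_const -/Q muln1.
  move: sF sB; set a := (\sum_phi #|_|)%N; set b := (\sum_phi bad _)%N.
  have := leq_mul (leqnn (n ^ 2)%N) (leqnn Q).
  move: Q0; set N := (n ^ 2)%N => Q0 _ sF sB lt.
  have : (N * (4 * b) <= N * Q)%N by rewrite leq_mul2l sB orbT.
  by move: sF lt Q0; clear; lia.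
have bad0 : bad phi = 0%N.
  have := Fle phi; have : (0 < n ^ 2)%N by rewrite expn_gt0 n0.
  by move: hphi; case: (bad phi) => // b; rewrite mulnS; clear; nia.
exists (F phi); split.
- by move: hphi; rewrite bad0 muln0 addn0.
- move=> D DC; move/eqP: bad0; rewrite sum_nat_eq0 => /forall_inP/(_ D DC).
  rewrite eqb0 -ltnNge; apply: leq_trans; rewrite ltnS; apply: subset_leq_card.
  by apply: setIS; apply/subsetP => e; rewrite inE => /andP[].
- move=> [[a b] c] [[a' b'] c']; rewrite !inE /= => /andP[/eqP h1 _] /andP[/eqP h2 _].
  by move=> ea eb; move: h1; rewrite ea eb h2 => ->.
- move=> [[a b] c] [[a' b'] c']; rewrite !inE /= => /andP[/eqP h1 /forallP cl] /andP[/eqP h2 _].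
  move=> ea ec; subst a'; have := cl (a, b').
  by rewrite /near /= eqxx andbT implybE negbK h1 h2 ec eqxx orbF => /eqP[->].
- move=> [[a b] c] [[a' b'] c']; rewrite !inE /= => /andP[/eqP h1 /forallP cl] /andP[/eqP h2 _].
  move=> eb ec; subst b'; have := cl (a', b).
  by rewrite /near /= eqxx orbT andbT implybE negbK h1 h2 ec eqxx orbF => /eqP[->].
Qed.

End RandomSystem.

(** * The lower bound *)

Section Deletion.
Local Open Scope nat_scope.

Lemma card_zero_on (E : finType) s (A : {set E}) :
  s.+1 ^ #|A| * \sum_(chi : {ffun E -> 'I_s.+1}) [forall e in A, chi e == ord0] = s.+1 ^ #|E|.
Proof.
have -> : \sum_(chi : {ffun E -> 'I_s.+1}) [forall e in A, chi e == ord0] =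
    \sum_(chi : {ffun E -> 'I_s.+1}) \prod_e ((e \in A) ==> (chi e == ord0)).
  apply: eq_bigr => chi _; rewrite -big_andE big_mkcond.
  by elim/big_rec2: _ => // e a b _ <-; case: (e \in A); case: (chi e == _); rewrite ?mul1n ?mul0n.
rewrite -(bigA_distr_bigA (fun e c => ((e \in A) ==> (c == ord0)) : nat)).
have h e : \sum_(c < s.+1) ((e \in A) ==> (c == ord0)) = if e \in A then 1 else s.+1.
  case: (e \in A) => /=; last by rewrite sum_nat_const card_ord muln1.
  by rewrite (bigD1 ord0) //= big1 // => c /negbTE ->.
under eq_bigr do rewrite h.
rewrite (bigID (mem A)) /= [X in _ * (X * _)]big1 ?mul1n => [|e ->] //.
rewrite [X in _ * X](eq_bigr (fun=> s.+1)); last by move=> e /negbTE ->.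
rewrite prod_nat_const -expnD; congr (_ ^ _).
by rewrite -[RHS](cardC A); congr (_ + _); apply: eq_card.
Qed.

(** Keeping the elements of colour 0 among [s] uniform colours leaves on average [#|H| / s] elements
    and [#|W| / s^l] forbidden sets, the latter at most half of the former; removing one element
    from each surviving set leaves enough. *)
Lemma deletion (E : finType) (H : {set E}) (W : {set {set E}}) s l :
  0 < l -> 0 < s -> {in W, forall A : {set E}, #|A| = l} ->
  2 * #|W| <= #|H| * s ^ l.-1 ->
  exists G : {set E}, [/\ G \subset H, indep W G & #|H| <= 2 * s * #|G|].
Proof.
case: s => // s l0 _ Wl Ws; pose X := {ffun E -> 'I_s.+1}.
pose Hc (chi : X) := [set e in H | chi e == ord0].
pose Wc (chi : X) := [set A in W | [forall e in A, chi e == ord0]].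
pose Q := s.+1 ^ #|E|.
have QE : #|{: X}| = Q by rewrite card_ffun card_ord.
have Q0 : 0 < Q by rewrite expn_gt0.
have sH : s.+1 * \sum_chi #|Hc chi| = #|H| * Q.
  have -> : \sum_chi #|Hc chi| = \sum_(e in H) \sum_(chi : X) [forall e' in [set e], chi e' == ord0].
    rewrite exchange_big; apply: eq_bigr => chi _ /=; rewrite -sum1_card big_mkcond [RHS]big_mkcond.
    apply: eq_bigr => e _; rewrite inE; case: (e \in H) => //=.
    rewrite (_ : [forall e' in _, _] = (chi e == ord0)); first by case: eqP.
    by apply/forall_inP/idP => [->|h e']; rewrite ?set11 // inE => /eqP ->.
  rewrite big_distrr -sum_nat_const; apply: eq_bigr => e _ /=.
  by have := card_zero_on s [set e]; rewrite cards1 expn1.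
have sW : s.+1 ^ l * \sum_chi #|Wc chi| = #|W| * Q.
  have -> : \sum_chi #|Wc chi| = \sum_(A in W) \sum_(chi : X) [forall e' in A, chi e' == ord0].
    rewrite exchange_big; apply: eq_bigr => chi _ /=; rewrite -sum1_card big_mkcond [RHS]big_mkcond.
    by apply: eq_bigr => A _; rewrite inE; case: (A \in W) => //=; case: [forall _, _].
  rewrite big_distrr -sum_nat_const; apply: eq_bigr => A AW /=.
  by have := card_zero_on s A; rewrite (Wl _ AW).
have [t tE] : exists t, t = 2 * s.+1 by exists (2 * s.+1).
have sW' : t * \sum_chi #|Wc chi| <= #|H| * Q.
  rewrite tE -(@leq_pmul2l (s.+1 ^ l.-1)) ?expn_gt0 //.
  have -> : s.+1 ^ l.-1 * (2 * s.+1 * \sum_chi #|Wc chi|) = 2 * (s.+1 ^ l * \sum_chi #|Wc chi|).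
    by rewrite -{2}(prednK l0) expnS; ring.
  by rewrite sW !mulnA leq_mul2r [s.+1 ^ _ * _]mulnC Ws orbT.
have sH' : t * \sum_chi #|Hc chi| = 2 * (#|H| * Q) by rewrite tE -mulnA sH.
have [chi hchi] : exists chi, #|H| + t * #|Wc chi| <= t * #|Hc chi|.
  apply/existsP; apply: contraT; rewrite negb_exists => /forallP h.
  have lt : \sum_(chi : X) (t * #|Hc chi| + 1) <= \sum_(chi : X) (#|H| + t * #|Wc chi|).
    by apply: leq_sum => chi _; rewrite addn1 ltnNge.
  move: lt; rewrite !big_split -!big_distrr /= !sum_nat_const QE muln1 sH'.
  move=> /leq_trans/(_ (leq_add (leqnn _) sW')); rewrite [Q * #|H|]mulnC.
  by move: Q0; clear; lia.
pose pick (A : {set E}) := if [pick e in A] is Some e then [set e] else set0 : {set E}.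
pose G := Hc chi :\: \bigcup_(A in Wc chi) pick A.
exists G; split.
- by apply/subsetP => e; rewrite !inE => /and3P[].
- move=> A AW; apply/negP => AG.
  have AWc : A \in Wc chi.
    by rewrite inE AW; apply/forall_inP => e /(subsetP AG); rewrite !inE => /and3P[].
  have : 0 < #|A| by rewrite Wl.
  move=> /card_gt0P[e0 e0A].
  have [e eA pe] : exists2 e, e \in A & pick A = [set e].
    by rewrite /pick; case: pickP => [e eA|/(_ e0)]; [exists e|rewrite e0A].
  have := subsetP AG e eA; rewrite !inE => /andP[/bigcupP[]].
  by exists A => //; rewrite pe set11.
- have : #|Hc chi| <= #|G| + #|Wc chi|.
    rewrite -(cardsID (\bigcup_(A in Wc chi) pick A) (Hc chi)) addnC leq_add2l.
    apply: leq_trans (subset_leq_card (subsetIr _ _)) _.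
    rewrite -[leqRHS]muln1; apply: card_bigcup_le => A _.
    by rewrite /pick; case: pickP => *; rewrite ?cards1 ?cards0.
  by rewrite -tE; move: hchi; clear; nia.
Qed.

(** * Counting loose cycles in a linear r-graph *)

Section LowerBound.
Variables (V : finType) (r Delta : nat) (H : {set {set V}}).
Hypotheses (Hr : is_rgraph r H) (Hlin : is_linear H) (HD : max_degree H <= Delta).
Implicit Types (e f g : {set V}).

Definition meets e f := e :&: f != set0.
Definition neighbors e : seq {set V} := enum [set f in H | meets e f].
(* Bridges of disjoint e and f meet them in distinct vertices, so linearity leaves
   at most r^2 of them; an e meeting f could have Delta bridges. *)
Definition bridges e f : seq {set V} :=
  if meets e f then [::] else enum [set g in H | meets e g && meets f g].

Fixpoint walks e m : seq (seq {set V}) :=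
  if m is m'.+1 then [seq f :: p | f <- neighbors e, p <- walks f m'] else [:: [::]].

Lemma size_neighbors e : e \in H -> size (neighbors e) <= r * Delta.
Proof.
move=> eH; rewrite -cardE.
have sub : [set f in H | meets e f] \subset \bigcup_(v in e) [set f in H | v \in f].
  apply/subsetP => f; rewrite inE => /andP[fH /set0Pn[v]]; rewrite inE => /andP[ve vf].
  by apply/bigcupP; exists v; rewrite // inE fH.
apply: leq_trans (subset_leq_card sub) _; rewrite -(Hr eH).
apply: card_bigcup_le => v _; apply: leq_trans HD.
exact: (leq_bigmax (F := degree H)).
Qed.

Lemma size_bridges e f : e \in H -> f \in H -> size (bridges e f) <= r * r.
Proof.
move=> eH fH; rewrite /bridges; case: ifPn => // ef; rewrite -cardE.
have sub : [set g in H | meets e g && meets f g] \subset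
    \bigcup_(p in setX e f) [set g in H | (p.1 \in g) && (p.2 \in g)].
  apply/subsetP => g; rewrite inE => /and3P[gH /set0Pn[u] + /set0Pn[v]].
  rewrite !inE => /andP[ue ug] /andP[vf vg].
  by apply/bigcupP; exists (u, v); rewrite ?inE /= ?ue ?vf // gH ug vg.
apply: leq_trans (subset_leq_card sub) _.
have -> : r * r = #|setX e f| * 1 by rewrite cardsX (Hr eH) (Hr fH) muln1.
apply: card_bigcup_le => -[u v]; rewrite inE /= => /andP[ue vf].
have uv : u != v.
  apply: contraNneq ef => uv; apply/set0Pn; exists u.
  by rewrite inE ue uv vf.
apply/card_le1_eqP => g g'; rewrite !inE => /and3P[gH ug vg] /and3P[g'H ug' vg'].
apply/eqP; apply: contraT => gg'; have := Hlin g'H gH gg'.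
rewrite leqNgt => /negP[]; apply/card_gt1P.
by exists u, v; split=> //; rewrite inE ?ug ?ug' ?vg ?vg'.
Qed.

Lemma size_walks e m : e \in H -> size (walks e m) <= (r * Delta) ^ m.
Proof.
elim: m e => [|m IHm] e eH //=.
rewrite size_allpairs_dep expnS; apply: leq_trans (_ : size (neighbors e) * (r * Delta) ^ m <= _).
  have : all (mem H) (neighbors e) by apply/allP => f; rewrite mem_enum inE => /andP[].
  elim: (neighbors e) => //= f s IHs /andP[fH sH].
  by rewrite mulSn leq_add // ?IHm // IHs.
by rewrite leq_mul2r size_neighbors ?orbT.
Qed.

Lemma mem_walks e p : path meets e p -> all (mem H) p -> p \in walks e (size p).
Proof.
elim: p e => [|f p IHp] e //= /andP[ef fp] /andP[fH pH].
apply/allpairsPdep; exists f, p; split=> //; last exact: IHp.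
by rewrite mem_enum inE fH.
Qed.

Lemma walks_last e m p : e \in H -> p \in walks e m -> last e p \in H.
Proof.
elim: m e p => [|m IHm] e p eH /=; first by rewrite inE => /eqP ->.
move=> /allpairsPdep[f [p' [fe p'f ->]]] /=; apply: IHm => //.
by move: fe; rewrite mem_enum inE => /andP[].
Qed.

(** For [m = l - 2] these have [l] edges: a start, [m] steps and a bridge. Closing with a bridge
    costs [r^2] rather than [r * Delta], which is the saving over the trivial count. *)
Definition closed_walks m : seq {set {set V}} :=
  [seq [set h in g :: w.1 :: w.2] |
     w <- [seq (e, p) | e <- enum H, p <- walks e m], g <- bridges w.1 (last w.1 w.2)].

Lemma size_closed_walks m : size (closed_walks m) <= #|H| * (r * Delta) ^ m * (r * r).
Proof.
have sumn_le (T : eqType) (s : seq T) (F : T -> nat) b :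
    {in s, forall x, F x <= b} -> sumn [seq F x | x <- s] <= size s * b.
  elim: s => //= x s IHs h; rewrite mulSn leq_add ?h ?mem_head //.
  by apply: IHs => y ys; rewrite h // inE ys orbT.
rewrite size_allpairs_dep; apply: leq_trans (sumn_le _ _ _ (r * r) _) _.
  move=> _ /allpairsPdep[e [p [eH pe ->]]] /=; rewrite mem_enum in eH.
  by rewrite size_bridges // (walks_last eH pe).
rewrite leq_mul2r size_allpairs_dep; apply/orP; right.
rewrite cardE; apply: sumn_le => e; rewrite mem_enum; exact: size_walks.
Qed.

Lemma path_map_iota (T : nat -> {set V}) a m :
  (forall j, a <= j < a + m -> meets (T j) (T j.+1)) ->
  path meets (T a) [seq T j | j <- iota a.+1 m].
Proof.
elim: m a => //= m IHm a h; rewrite h ?leqnn ?addnS ?ltnS ?leq_addr //=.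
by apply: IHm => j /andP[aj jm]; apply: h; rewrite addnS -addSn jm (ltnW aj).
Qed.

Lemma last_map_iota (T : nat -> {set V}) a m :
  last (T a) [seq T j | j <- iota a.+1 m] = T (a + m).
Proof. by elim: m a => [|m IHm] a /=; rewrite ?addn0 // IHm addSnnS. Qed.

(** With at least four edges, the first and the next-to-last edge of a loose cycle are disjoint, so
    its last edge is one of their bridges. *)
Lemma copy_closed_walk l (G : {set {set V}}) : 3 < l -> 1 < r -> G \subset H ->
  contains_copy (loose_cycle l r) G ->
  exists A : {set {set V}}, [/\ A \in closed_walks l.-2, #|A| = l & A \subset G].
Proof.
case: l => // l l3 r1 GH /existsP[f /andP[/injectiveP fi /forall_inP fG]].
have r0 : 0 < r.-1 by lia.
pose z : 'I_r.-1 := Ordinal r0.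
have val0 (j : 'I_r.-1) : (j == 0 :> nat) = (j == z) by [].
pose t (i : 'I_l.+1) := f @: loose_edge r i.
have tG i : t i \in G by apply: fG; apply: imset_f.
have l1 : 1 < l.+1 by lia.
have own i : f (i, z) \in t i by apply: imset_f; rewrite inE eqxx.
have nxt i : f (ordS i, z) \in t i by apply: imset_f; rewrite inE /= !eqxx orbT.
have mem i a : (f (a, z) \in t i) = (a == i) || (a == ordS i).
  rewrite mem_imset // inE /= andbT //.
have ti : injective t.
  move=> i j E; have := own i; have := own j; rewrite {1}E -{1}E !mem.
  move=> /orP[/eqP //|/eqP ->] /orP[/eqP //|].
  by rewrite eq_sym (negbTE (ordSS_neq i _)) //; lia.
have tm i : meets (t i) (t (ordS i)).
  by apply/set0Pn; exists (f (ordS i, z)); rewrite inE nxt own.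
have td i j : i != j -> j != ordS i -> i != ordS j -> ~~ meets (t i) (t j).
  move=> ij jSi iSj; apply/negP => /set0Pn[v]; rewrite inE => /andP[/imsetP[[a b] abi ->]].
  rewrite mem_imset //; move: abi; rewrite !inE /=.
  case: (eqVneq a i) => [->|_] /=; first by rewrite (negbTE ij) (negbTE iSj).
  case: (eqVneq a (ordS i)) => [->|_] //=.
  rewrite ![ordS i == _]eq_sym (negbTE jSi) /= => _ /andP[/eqP/ordS_inj ji _].
  by rewrite ji eqxx in ij.
pose T j := t (inord j).
have Tm j : j < l -> meets (T j) (T j.+1).
  move=> jl; have -> : T j.+1 = t (ordS (inord j)); last exact: tm.
  congr t; apply: val_inj; rewrite /= !inordK ?modn_small ?ltnS //; exact: ltnW.
have TH j : T j \in H by apply: (subsetP GH); apply: tG.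
have v j : j <= l -> val (inord j : 'I_l.+1) = j by move=> jl; apply: inordK.
have m0 : meets (T 0) (T l).
  have -> : T 0 = t (ordS (inord l)).
    by congr t; apply: val_inj; rewrite [RHS]/= !v // modnn.
  by rewrite /meets setIC; apply: tm.
have nm : ~~ meets (T 0) (T l.-1).
  have p1 : l.-1.+1 = l by lia.
  apply: td; apply/eqP => /(congr1 val); rewrite ?[val (ordS _)]/= !v ?p1 ?modn_small //; lia.
exists [set t i | i : 'I_l.+1]; split.
- pose p := [seq T j | j <- iota 1 l.-1].
  apply/allpairsPdep; exists (T 0, p), (T l); split=> /=.
  + apply/allpairsPdep; exists (T 0), p; split=> //.
      by rewrite mem_enum TH.
    have -> : l.-1 = size p by rewrite size_map size_iota.
    apply: mem_walks; last by apply/allP => _ /mapP[j _ ->]; rewrite /= TH.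
    by apply: path_map_iota => j /andP[_ jl]; apply: Tm; lia.
  + rewrite last_map_iota add0n /bridges.
    rewrite (negbTE nm) mem_enum inE TH m0 /=.
    by have := Tm l.-1; rewrite prednK; [apply; lia|lia].
  + apply/setP => A; rewrite inE; apply/imsetP/idP => [[i _ ->]|].
      have -> : t i = T i by rewrite /T inord_val.
      rewrite !in_cons; have := ltn_ord i; rewrite ltnS => il.
      have [->|i0] := posnP i; first by rewrite eqxx orbT.
      move: il; rewrite leq_eqVlt => /orP[/eqP ->|il]; first by rewrite eqxx.
      by apply/orP; right; apply/orP; right; apply: map_f; rewrite mem_iota; lia.
    rewrite !in_cons => /or3P[/eqP ->|/eqP ->|/mapP[j _ ->]]; by [exists (inord l)|exists (inord 0)|exists (inord j)].
- by rewrite card_imset // card_ord.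
- by apply/subsetP => _ /imsetP[i _ ->].
Qed.

Lemma turan_lower l s : 3 < l -> 1 < r -> 0 < s -> 0 < Delta ->
  2 * r ^ l * Delta ^ l.-2 <= s ^ l.-1 ->
  #|H| <= 2 * s * turan H (loose_cycle l r).
Proof.
move=> l3 r1 s0 D0 hs.
pose W := [set A in closed_walks l.-2 | #|A| == l].
have Wl : {in W, forall A : {set {set V}}, #|A| = l} by move=> A; rewrite inE => /andP[_ /eqP].
have [||G [GH Gi HG]] := @deletion _ H W s l _ s0 Wl.
- by lia.
- have : #|W| <= #|H| * (r * Delta) ^ l.-2 * (r * r).
    apply: leq_trans (size_closed_walks _); apply: leq_trans (card_size _).
    by apply: subset_leq_card; apply/subsetP => A; rewrite inE => /andP[].
  have -> : #|H| * (r * Delta) ^ l.-2 * (r * r) = #|H| * (r ^ l * Delta ^ l.-2).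
    have lE : l = l.-2.+2 by lia.
    by rewrite {2}lE expnMn !expnS; ring.
  move=> hW; apply: leq_trans (leq_mul (leqnn 2) hW) _.
  by rewrite mulnCA leq_mul2l mulnA hs orbT.
apply: leq_trans HG _; rewrite leq_mul2l; apply/orP; right.
apply: (leq_bigmax_cond (F := fun G : {set {set V}} => #|G|)); rewrite GH /=.
apply/negP => /(copy_closed_walk l3 r1 GH)[A [AW Al AG]].
have AW' : A \in W by rewrite inE AW Al eqxx.
by have := Gi A AW'; rewrite AG.
Qed.

End LowerBound.

End Deletion.

(** * The upper bound *)

Lemma powR_root (R : realType) (a : R) n : 0 < a -> (0 < n)%N ->
  exists2 b, 0 < b & b ^+ n = a.
Proof.
move=> a0 n0; exists (a `^ n%:R^-1); first exact: powR_gt0.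
by rewrite -powR_mulrn ?powR_ge0 // -powRrM mulVf ?powRr1 ?ltW // pnatr_eq0 -lt0n.
Qed.

Lemma poly_le_exp2 j c : exists w0, forall w, (w0 <= w)%N -> (c * w ^ j <= 2 ^ w)%N.
Proof.
elim: j c => [|j IHj] c.
  exists c => w cw; rewrite muln1; apply: leq_trans (ltnW (ltn_expl c (ltnSn 1))) _.
  by rewrite leq_exp2l.
have [u0 Hu] := IHj (c * 3 ^ j.+1)%N; exists (u0.*2.+2) => w w0w.
have [u0u wu] : (u0 <= w./2)%N /\ (w <= 3 * w./2)%N.
  by have := odd_double_half w; move: w0w; rewrite -!muln2; case: (odd w); lia.
apply: leq_trans (_ : c * (3 * w./2) ^ j.+1 <= _)%N; first by rewrite leq_mul2l leq_expl ?orbT.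
have := leq_mul (Hu _ u0u) (ltnW (ltn_expl w./2 (ltnSn 1))).
rewrite -expnD addnn => h; apply: leq_trans (_ : 2 ^ w./2.*2 <= _)%N; last first.
  by rewrite leq_exp2l // -{2}(odd_double_half w) leq_addl.
by apply: leq_trans h; rewrite expnMn !mulnA -[(_ * _ * w./2)%N]mulnA -expnSr.
Qed.

(** * Arithmetic of the parameters *)

Section Budget.
Variables (l w s e K : nat).
Hypotheses (l2 : (2 <= l)%N) (w4 : (4 ^ l.+1 <= w)%N) (wl : (256 * l ^ 2 <= w)%N).
Hypotheses (s0 : (0 < s)%N) (HK : (s ^ (2 * l).-1 * w ^ 62 <= K)%N).

Let w0 : (0 < w)%N.
Proof. by apply: leq_trans w4; rewrite expn_gt0. Qed.

Lemma order_budget : ((4 * s ^ l.-1) ^ l <= w * (s ^ l) ^ l.-1)%N.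
Proof.
rewrite expnMn -!expnM [(l.-1 * l)%N]mulnC leq_mul2r (leq_trans _ w4) ?orbT //.
by rewrite leq_exp2l.
Qed.

(** The powers of [s] agree exactly, [(l-1) * (l+1) = (2l-1) + l * (l-2)]; this is what fixes the
    container size at [s^(2l-1)] up to powers of [w]. *)
Lemma degree_budget : ((4 * s ^ l.-1) ^ l.+1 <= w * K * (s ^ l) ^ l.-2)%N.
Proof.
apply: leq_trans (_ : w * s ^ (2 * l).-1 * (s ^ l) ^ l.-2 <= _)%N; last first.
  rewrite leq_mul2r leq_mul2l; apply/orP; right; apply/orP; right.
  by apply: leq_trans HK; rewrite leq_pmulr // expn_gt0 w0.
rewrite expnMn -!expnM -mulnA -expnD (_ : l.-1 * l.+1 = (2 * l).-1 + l * l.-2)%N.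
  by rewrite leq_mul2r w4 orbT.
by move: l2; case: l => [|[|j]] //= _; lia.
Qed.

(** Origin of [w^62]: 60 factors come from the constant [A], one from stabilization, and one pays
    for [256 * l^2]. *)
Lemma threshold_budget :
  (16 * l ^ 2 * (4 * w ^ 60) * w * (4 * s ^ l.-1) * s ^ l <= K)%N.
Proof.
apply: leq_trans HK; have -> : (16 * l ^ 2 * (4 * w ^ 60) * w * (4 * s ^ l.-1) * s ^ l =
    s ^ (2 * l).-1 * (256 * l ^ 2 * w ^ 61))%N.
  have -> : (2 * l).-1 = (l.-1 + l)%N by lia.
  by rewrite expnD (expnS w 60); ring.
by rewrite leq_mul2l (expnS w 61) leq_mul2r wl !orbT.
Qed.

Hypotheses (wloss : (4 * (2 * l + 1) ^ l * 4 ^ l <= w)%N) (we : (3 * l.-1 * 2 ^ e <= w)%N).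

Lemma loss_le : (loss l w <= w ^ (60 * l + 9))%N.
Proof.
have -> : (loss l w = 4 * (2 * l + 1) ^ l * 4 ^ l * (w ^ 8 * w ^ (60 * l)))%N.
  by rewrite /loss expnMn -expnM; ring.
have -> : (w ^ (60 * l + 9) = w * (w ^ 8 * w ^ (60 * l)))%N.
  by rewrite -expnD -expnS addnC.
by rewrite leq_mul2r wloss orbT.
Qed.

(** The three summands bound the binary logarithms of 4, of the number of containers and of the
    moment bound. To the exponent [60 * l + 9] of [loss], one factor [w] is added for the logarithm
    of the ground set, one for the number of halvings, one for the constants and one for adding
    up. *)
Lemma container_budget :
  (2 + w * (l.-1 * (2 * s ^ l).+1 * (loss l w * 2 ^ e * w)) + s ^ l * w ^ 62
    <= s ^ l * w ^ (60 * l + 13))%N.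
Proof.
have sl0 : (0 < s ^ l)%N by rewrite expn_gt0 s0.
pose W := (w ^ (60 * l + 12))%N.
have W0 : (0 < W)%N by rewrite expn_gt0 w0.
have w3 : (4 <= w)%N by apply: leq_trans w4; rewrite (expnS 4 l) leq_pmulr // expn_gt0.
have h1 : (2 <= s ^ l * W)%N.
  apply: leq_trans (_ : 1 * W <= _)%N; last by rewrite leq_mul2r sl0 orbT.
  rewrite mul1n /W addnS expnS.
  by apply: leq_trans (leq_pmulr _ _); rewrite ?expn_gt0 ?w0 //; apply: leq_trans w3.
have h2 : (s ^ l * w ^ 62 <= s ^ l * W)%N.
  by rewrite leq_mul2l; apply/orP; right; apply: leq_pexp2l => //; lia.
have h3 : (w * (l.-1 * (2 * s ^ l).+1 * (loss l w * 2 ^ e * w)) <= s ^ l * W)%N.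
  have -> : (w * (l.-1 * (2 * s ^ l).+1 * (loss l w * 2 ^ e * w)) =
     (l.-1 * 2 ^ e * (2 * s ^ l).+1) * (w * w * loss l w))%N by ring.
  apply: leq_trans (_ : (w * s ^ l) * (w * w * w ^ (60 * l + 9)) <= _)%N.
    apply: leq_mul; last by rewrite leq_mul2l loss_le orbT.
    apply: leq_trans (_ : 3 * l.-1 * 2 ^ e * s ^ l <= _)%N; last by rewrite leq_mul2r we orbT.
    have -> : (3 * l.-1 * 2 ^ e * s ^ l = l.-1 * 2 ^ e * (3 * s ^ l))%N by ring.
    by rewrite leq_mul2l; apply/orP; right; lia.
  have -> : W = (w * (w * w * w ^ (60 * l + 9)))%N.
    by rewrite -[(w * w * _)%N]mulnA -!expnS /W !addnS.
  by rewrite leq_eqVlt; apply/orP; left; apply/eqP; ring.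
have -> : (s ^ l * w ^ (60 * l + 13) = w * (s ^ l * W))%N.
  by rewrite mulnCA -expnS /W !addnS.
apply: leq_trans (_ : 4 * (s ^ l * W) <= _)%N; last by rewrite leq_mul2r w3 orbT.
by move: h1 h2 h3; clear; lia.
Qed.

End Budget.

(** With [s = w^h] and [n = s^(l-1)], the ratio [s^l / n^2] equals [n^(-1 + 1/(l-1))]. The exponent
    [h] is fixed before [w], so every constant built from [l] and [h] can be paid by one factor
    [w]. *)
Lemma sparse_system (R : realType) l k h r : l = k.*2.+2 -> (0 < k)%N -> (3 <= r)%N ->
  exists w0, forall w, (w0 <= w)%N ->
  let n := ((w ^ h) ^ l.-1)%N in
  exists (V : finType) (H : {set {set V}}),
  [/\ is_rgraph r H, is_linear H, (n ^ 2 <= 4 * #|H|)%N, (max_degree H <= n)%N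
    & (turan H (loose_cycle l r) <= (w ^ h) ^ l * w ^ (60 * l + 13))%N].
Proof.
move=> lE k0 r3; have [e eE] : exists e, e = container_depth l.-1 by exists (container_depth l.-1).
have l2 : (2 <= l)%N by rewrite lE.
(* The [4 * n^3] triples number at most [w^a], so [J] bounds the stabilization rounds independently
   of [w]. *)
pose a := (h * l.-1 * 3).+1; pose J := (a * l.-1)%N.
have [wp Hwp] := poly_le_exp2 a 2.
exists (4 ^ l.+1 + 256 * l ^ 2 + 4 * (2 * l + 1) ^ l * 4 ^ l + 3 * l.-1 * 2 ^ e + 2 ^ J + wp)%N.
move=> w hw n.
have [[w1 w2 w3 w4 w5] w6] : [/\ 4 ^ l.+1 <= w, 256 * l ^ 2 <= w,
    4 * (2 * l + 1) ^ l * 4 ^ l <= w, 3 * l.-1 * 2 ^ e <= w & 2 ^ J <= w]%N /\ (wp <= w)%N.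
  move: hw; move: (4 ^ l.+1)%N (256 * l ^ 2)%N (4 * (2 * l + 1) ^ l * 4 ^ l)%N (3 * l.-1 * 2 ^ e)%N (2 ^ J)%N.
  by clear => *; split; [split|]; lia.
have w4' : (4 <= w)%N by apply: leq_trans w1; rewrite (expnS 4 l) leq_pmulr // expn_gt0.
have w0 : (0 < w)%N by apply: leq_trans w4'.
pose s := (w ^ h)%N; have s0 : (0 < s)%N by rewrite expn_gt0 w0.
have n0 : (0 < n)%N by rewrite expn_gt0 s0.
pose Om : finType := ('I_n * 'I_n * 'I_(4 * n))%type.
pose x (t : Om) := t.1.1; pose y (t : Om) := t.1.2; pose z (t : Om) := t.2.
have inj t t' : x t = x t' -> y t = y t' -> z t = z t' -> t = t'.
  by case: t t' => [[? ?] ?] [[? ?] ?]; rewrite /x /y /z /= => -> -> ->.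
have OmE : #|Om| = (4 * n ^ 3)%N by rewrite !card_prod !card_ord; ring.
have Oma : (#|Om| <= w ^ a)%N.
  have -> : (w ^ a = w * n ^ 3)%N by rewrite /a expnS !expnM.
  by rewrite OmE leq_mul2r w4' orbT.
have Omw : (#|Om| < 2 ^ w)%N.
  apply: leq_ltn_trans Oma _; apply: leq_trans (Hwp _ w6).
  by rewrite mul2n -addnn -[ltnLHS]addn0 ltn_add2l expn_gt0 w0.
pose m0 := (s ^ l)%N; have m00 : (0 < m0)%N by rewrite expn_gt0 s0.
have lE2 : (2 * l).-1 = (l + l.-1)%N by move: l2; clear; lia.
pose kap := (s ^ (2 * l).-1 * w ^ 62)%N.
have mk : (m0 <= kap)%N.
  apply: leq_trans (_ : s ^ (2 * l).-1 <= _)%N; last by rewrite leq_pmulr // expn_gt0 w0.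
  by apply: leq_pexp2l => //; rewrite lE2 leq_addr.
have unif : {in cycles x y z l, forall A : {set Om}, #|A| = l.-1.+1}.
  by move=> A /cycles_uniform ->; rewrite prednK // ltnW.
have [|C [C1 C2 C3]] := @small_containers R Om l.-1 (cycles x y z l) m0 (loss l w) kap w
   m00 (loss_gt0 _ w0) mk Omw unif.
  move=> K HK.
  apply: (@supersaturation R Om _ _ _ x y z (@powR_root R) inj l k w m0 (4 * n) J K lE) => //.
  - exact: leq_trans w4'.
  - rewrite /J expnM; exact: leq_expl.
  - by rewrite card_ord leq_pmull.
  - by rewrite card_ord leq_pmull.
  - by rewrite card_ord.
  - exact: order_budget.
  - exact: degree_budget.
  - exact: threshold_budget.
  - by rewrite muln_gt0.
rewrite -eE in C1.
pose q := (s ^ l * w ^ 62)%N; pose m := (s ^ l * w ^ (60 * l + 13))%N.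
have [||F [nF CF xyF xzF yzF]] := @random_system R n n0 C m q.
- apply: leq_trans (_ : 2 ^ (2 + w * (l.-1 * (2 * s ^ l).+1 * (loss l w * 2 ^ e * w)) + q) <= _)%N.
    rewrite !expnD leq_mul2r; apply/orP; right; rewrite leq_mul2l /=.
    by apply: leq_trans C1 _; rewrite [X in (_ <= X)%N]expnM leq_expl.
  by rewrite leq_exp2l //; apply: container_budget.
- move=> D /C2/ltnW; rewrite /kap /q lE2 expnD -/s -/n => Dk; apply: leq_trans Dk _.
  by rewrite mulnAC.
have [|||V [H [h1 h2 h3 h4 h5]]] := @padded Om _ _ _ r l n x y z r3 _ n0 _ _ F xyF xzF yzF.
- exact: ltnW.
- by rewrite card_ord.
- by rewrite card_ord.
exists V, H; split=> //; first by rewrite h3.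
apply: h5 => I IF /C3[D DC ID]; apply: ltnW; apply: leq_ltn_trans (CF D DC).
by apply: subset_leq_card; rewrite subsetI ID.
Qed.

(** * From integer parameters to real exponents *)

Lemma archimedean_nat (R : realType) (a : R) : exists n : nat, a <= n%:R.
Proof.
exists (Num.truncn a).+1; exact: ltW (real_truncnS_gt (num_real a)).
Qed.

Lemma nat_root E D : (0 < E)%N -> (0 < D)%N -> exists w, (w ^ E <= D < w.+1 ^ E)%N.
Proof.
move=> E0 D0; have ex : exists w, (w ^ E <= D)%N by exists 0%N; rewrite exp0n.
have bnd w : (w ^ E <= D)%N -> (w <= D)%N.
  move=> h; apply: leq_trans h; case: w => // w.
  by rewrite -{1}[w.+1]expn1 leq_pexp2l.
case: (ex_maxnP ex bnd) => w h1 h2; exists w; rewrite h1 ltnNge.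
by apply/negP => /h2; rewrite ltnn.
Qed.

Lemma powRX (R : realType) (a x : R) n : (a `^ x) ^+ n = a `^ (x * n%:R).
Proof. by rewrite powRrM powR_mulrn ?powR_ge0. Qed.

Lemma powR_nat (R : realType) (w n : nat) (x : R) :
  (w ^ n)%:R `^ x = w%:R `^ (n%:R * x).
Proof. by rewrite natrX -powR_mulrn ?ler0n // -powRrM. Qed.

(** Replacing [D] by [w^E] changes the base by at most one factor [w], which matters only for
    negative exponents and costs at most [w] as [a >= -1]. *)
Lemma powR_between (R : realType) (w E D : nat) (a : R) : (0 < w)%N ->
  (w ^ E <= D <= w ^ E.+1)%N -> -1 <= a -> w%:R `^ (E%:R * a - 1) <= D%:R `^ a.
Proof.
move=> w0 /andP[D1 D2] a1; have w1 : 1 <= w%:R :> R by rewrite ler1n.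
have D0 : (0 < D)%N by apply: leq_trans D1; rewrite expn_gt0 w0.
have [a0|a0] := lerP 0 a.
  apply: le_trans (_ : (w ^ E)%:R `^ a <= _); last first.
    by apply: ge0_ler_powR => //; rewrite ?nnegrE ?ler0n // ler_nat.
  by rewrite powR_nat; apply: ler_powR => //; rewrite gerBl.
apply: le_trans (_ : (w ^ E.+1)%:R `^ a <= _).
  rewrite powR_nat; apply: ler_powR => //; rewrite -natr1 mulrDl mul1r; lra.
rewrite -[a]opprK !(powRN _ (- a)) lef_pV2 ?posrE ?powR_gt0 ?ltr0n ?expn_gt0 ?w0 //.
apply: ge0_ler_powR; rewrite ?nnegrE ?ler0n ?ler_nat //.
by rewrite oppr_ge0 ltW.
Qed.

Lemma lower_bound (R : realType) (l r : nat) (eps : R) :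
  (4 <= l)%N -> (3 <= r)%N -> 0 < eps ->
  exists Delta0 : nat, forall Delta : nat, (Delta0 <= Delta)%N ->
    forall (V : finType) (H : {set {set V}}),
      is_rgraph r H -> is_linear H -> (max_degree H <= Delta)%N ->
      Delta%:R `^ (-1 + 1 / (l%:R - 1) - eps) * #|H|%:R
        <= (turan H (loose_cycle l r))%:R :> R.
Proof.
move=> l4 r3 eps0.
pose L := l.-1; have L0 : (0 < L)%N by rewrite /L; lia.
have lL : l%:R - 1 = L%:R :> R by rewrite -(@prednK l) ?(leq_trans _ l4) // -natr1 addrK.
have L0' : 0 < L%:R :> R by rewrite ltr0n.
pose c := (2 * r ^ l)%N; have c0 : (0 < c)%N by rewrite muln_gt0 expn_gt0 (leq_trans _ r3).
have [D0 HD0] := archimedean_nat ((c * 4 ^ L)%:R `^ (L%:R * eps)^-1 : R).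
exists (maxn D0 1) => D; rewrite geq_max => /andP[DD0 D1] V H Hr Hl HD.
have D1' : 1 <= D%:R :> R by rewrite ler1n.
have D0' : 0 < D%:R :> R by rewrite ltr0n.
have Le0 : 0 < L%:R * eps by rewrite mulr_gt0.
have big : (c * 4 ^ L)%:R <= D%:R `^ (L%:R * eps) :> R.
  have -> : (c * 4 ^ L)%:R = ((c * 4 ^ L)%:R `^ (L%:R * eps)^-1) `^ (L%:R * eps) :> R.
    by rewrite -powRrM mulVf ?powRr1 ?ler0n // gt_eqF.
  apply: ge0_ler_powR; rewrite ?nnegrE ?powR_ge0 ?ler0n //; first exact: ltW.
  by apply: le_trans HD0 _; rewrite ler_nat.
pose b := (c * D ^ l.-2)%N; have b0 : (0 < b)%N by rewrite muln_gt0 c0 expn_gt0 D1.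
have [t /andP[t1 t2]] := nat_root L0 b0.
have t0 : (0 < t)%N.
  rewrite lt0n; apply/eqP => t0; move: t2; rewrite t0 exp1n ltnS leqn0 => /eqP b00.
  by rewrite b00 in b0.
have low := @turan_lower V r D H Hr Hl HD l t.+1 l4 (ltnW r3) (ltn0Sn t) D1 (ltnW t2).
pose x : R := 1 - 1 / L%:R + eps.
have xE : -1 + 1 / L%:R - eps = - x by rewrite /x; ring.
(* Rounding the root up at most doubles [t], so [2 * t.+1 <= 4 * t]; the resulting constant
   [c * 4^L] is absorbed by [D^(L * eps)]. *)
have ts : (2 * t.+1)%:R <= D%:R `^ x :> R.
  rewrite -(@ler_pXn2r _ L) ?nnegrE ?powR_ge0 ?ler0n // powRX.
  have -> : x * L%:R = l.-2%:R + L%:R * eps.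
    have -> : l.-2%:R = L%:R - 1 :> R.
      by rewrite /L -(@prednK l.-1) // -natr1 addrK.
    by rewrite /x; field; rewrite gt_eqF.
  rewrite powRD; last by rewrite (lt0r_neq0 D0') implybT.
  rewrite powR_mulrn ?ler0n //.
  apply: le_trans (_ : (c * 4 ^ L)%:R * D%:R ^+ l.-2 <= _); last first.
    by rewrite mulrC ler_wpM2l ?exprn_ge0.
  rewrite -!natrX -natrM ler_nat.
  apply: leq_trans (_ : (4 * t) ^ L <= _)%N; first by rewrite leq_exp2r //; lia.
  by rewrite expnMn mulnAC mulnC leq_mul2r -/b t1 orbT.
rewrite lL xE powRN mulrC ler_pdivrMr ?powR_gt0 //.
apply: le_trans (_ : (2 * t.+1 * turan H (loose_cycle l r))%:R <= _).
  by rewrite ler_nat.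
by rewrite natrM mulrC ler_wpM2l.
Qed.

Lemma upper_bound (R : realType) (l r : nat) (eps : R) :
  (4 <= l)%N -> ~~ odd l -> (3 <= r)%N -> 0 < eps ->
  exists Delta0 : nat, forall Delta : nat, (Delta0 <= Delta)%N ->
    exists (V : finType) (H : {set {set V}}),
      [/\ is_rgraph r H, is_linear H, (0 < #|H|)%N, (max_degree H <= Delta)%N
        & (turan H (loose_cycle l r))%:R
            <= Delta%:R `^ (-1 + 1 / (l%:R - 1) + eps) * #|H|%:R :> R].
Proof.
move=> l4 lev r3 eps0.
have [k k0 lE] : exists2 k, (0 < k)%N & l = k.*2.+2.
  exists (l./2).-1; have := odd_double_half l; rewrite (negbTE lev) -!muln2; move: l4; clear; lia.
pose L := l.-1; have L0 : (0 < L)%N by rewrite /L; lia.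
have lL : l%:R - 1 = L%:R :> R by rewrite -(@prednK l) ?(leq_trans _ l4) // -natr1 addrK.
have L0' : 0 < L%:R :> R by rewrite ltr0n.
(* To the [60 * l + 13] lost in the sparse system are added one power of [w] for the factor 4 in the
   number of edges and one for rounding [D] down to [w^E]. *)
have [h0 Hh] := archimedean_nat ((60 * l + 15)%:R / (L%:R * eps) : R).
pose h := h0.+1; pose E := (h * L)%N.
have E0 : (0 < E)%N by rewrite muln_gt0.
have Eeps : (60 * l + 15)%:R <= E%:R * eps.
  have Le0 : 0 < L%:R * eps by rewrite mulr_gt0.
  rewrite /E natrM -mulrA -ler_pdivrMr //; apply: le_trans Hh _.
  by rewrite ler_nat.
have [w0 Hw] := @sparse_system R l k h r lE k0 r3.
(* The summand [2^E] ensures [(2 * w)^E <= w^(E+1)], which confines [D] between two consecutive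
   powers of [w]. *)
pose w1 := (w0 + 2 ^ E + 4)%N.
exists (w1 ^ E)%N => D hD.
have w10 : (0 < w1)%N by rewrite /w1 addn4.
have D0 : (0 < D)%N by apply: leq_trans hD; rewrite expn_gt0 w10.
have [w /andP[wD Dw]] := nat_root E0 D0.
have w1w : (w1 <= w)%N by rewrite -ltnS -(@ltn_exp2r _ _ E) // (leq_ltn_trans hD).
have [ww0 [w2E w4]] : (w0 <= w)%N /\ (2 ^ E <= w)%N /\ (4 <= w)%N.
  by move: w1w; rewrite /w1; move: (2 ^ E)%N => p; lia.
have wpos : (0 < w)%N by apply: leq_trans w4.
have DwE : (D <= w ^ E.+1)%N.
  apply: leq_trans (ltnW Dw) _; apply: leq_trans (_ : (2 * w) ^ E <= _)%N.
    by rewrite leq_exp2r //; move: wpos; clear; lia.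
  by rewrite expnMn expnS leq_mul2r w2E orbT.
have [V [H [h1 h2 h3 h4 h5]]] := Hw w ww0.
have nE : ((w ^ h) ^ l.-1 = w ^ E)%N by rewrite -expnM.
rewrite nE in h3 h4.
have w1' : 1 <= w%:R :> R by rewrite ler1n.
have w0' : 0 < w%:R :> R by rewrite ltr0n.
exists V, H; split=> //.
- have : (0 < 4 * #|H|)%N by apply: leq_trans h3; rewrite !expn_gt0 wpos.
  by rewrite muln_gt0.
- exact: leq_trans h4 wD.
rewrite lL; set a : R := -1 + 1 / L%:R + eps.
have a1 : -1 <= a.
  have : 0 <= 1 / L%:R :> R by rewrite divr_ge0.
  by rewrite /a; lra.
have Da := @powR_between R w E D a wpos (introT andP (conj wD DwE)) a1.
apply: le_trans (_ : w%:R `^ (E%:R * a - 1) * #|H|%:R <= _); last by rewrite ler_wpM2r.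
have Ea : E%:R * a - 1 + (E * 2)%:R = (h * l)%:R + E%:R * eps - 1.
  have El : (h * l)%:R = E%:R + h%:R :> R.
    by rewrite -natrD -[X in (_ + X)%N]muln1 -mulnDr addn1 prednK // (leq_trans _ l4).
  have EL : E%:R / L%:R = h%:R :> R by rewrite natrM mulfK // gt_eqF.
  by rewrite El -EL /a natrM; ring.
rewrite -(@ler_pM2l _ 4) // mulrCA -natrM.
apply: le_trans (_ : w%:R ^+ (h * l + (60 * l + 14)) <= _).
  rewrite -natrX ler_nat; apply: leq_trans (leq_mul w4 h5) _.
  by rewrite -expnM -expnD -expnS !addnS.
apply: le_trans (_ : w%:R `^ (E%:R * a - 1) * ((w ^ E) ^ 2)%:R <= _); last first.
  by rewrite ler_wpM2l ?powR_ge0 // -natrM ler_nat.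
have -> : ((w ^ E) ^ 2)%:R = w%:R `^ (E * 2)%:R :> R.
  by rewrite powR_mulrn ?ler0n // -expnM natrX.
rewrite -powRD; last by rewrite (lt0r_neq0 w0') implybT.
rewrite Ea -powR_mulrn ?ler0n //.
apply: ler_powR => //; rewrite natrD -addrA lerD2l.
by rewrite (_ : 60 * l + 15 = (60 * l + 14).+1)%N ?addnS // -natr1 in Eeps; lra.
Qed.

Theorem proposition1p4 (R : realType) (l r : nat)
    (hl : (4 <= l)%N) (hl_even : ~~ odd l) (hr : (3 <= r)%N) :
  (forall eps : R, 0 < eps ->
     exists Delta0 : nat, forall Delta : nat, (Delta0 <= Delta)%N ->
       forall (V : finType) (H : {set {set V}}),
         is_rgraph r H -> is_linear H -> (max_degree H <= Delta)%N ->
         Delta%:R `^ (-1 + 1 / (l%:R - 1) - eps) * #|H|%:R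
           <= (turan H (loose_cycle l r))%:R :> R)
  /\
  (forall eps : R, 0 < eps ->
     exists Delta0 : nat, forall Delta : nat, (Delta0 <= Delta)%N ->
       exists (V : finType) (H : {set {set V}}),
         [/\ is_rgraph r H, is_linear H, (0 < #|H|)%N,
             (max_degree H <= Delta)%N
           & (turan H (loose_cycle l r))%:R
               <= Delta%:R `^ (-1 + 1 / (l%:R - 1) + eps) * #|H|%:R :> R]).
Proof.
split=> eps eps0; first exact: lower_bound.
exact: upper_bound.
Qed.
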